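(* Let $\mathbf{A}$ be a weakly Mal'tsev category with a $V$-Mal'tsev operation $p$, where $V\colon\mathbf{A}\to\mathbf{B}$ is faithful and preserves finite limits ($\mathbf{A},\mathbf{B}$ with finite limits). An internal bicategory in $\mathbf{A}$ (homogeneous, with invertible 2-cells) is completely determined by a diagram in $\mathbf{A}$ consisting of objects $A,B$ and morphisms $$d,c\colon A\to B,\qquad e\colon B\to A,\qquad s,t,\lambda,\rho\colon A\to A$$ satisfying $$de=1_B=ce,\qquad st=t,\quad ts=s,$$ $$ds=d=dt,\quad cs=c=ct,\quad se=e=te,$$ $$d\lambda=d=d\rho,\quad c\lambda=c=c\rho,\quad \lambda e=e=\rho e,$$ $$p_A\langle V\lambda,V\lambda s,Vt\lambda s\rangle=1_{V(A)}=p_A\langle V\rho,V\rho s,Vt\rho s\rangle,$$ and such that the following properties hold. (P1) For every three morphisms $\alpha,\beta,\gamma\colon X\to A$ in $\mathbf{A}$ with $s\alpha=s\beta$ and $t\beta=t\gamma$, there exists a unique morphism $\varphi\colon X\to A$ in $\mathbf{A}$ such that $V\varphi=p_A\langle V\alpha,V\beta,V\gamma\rangle$. (P2) There are two morphisms $m,\mu\colon A\times_BA\to A$ in $\mathbf{A}$ such that $$Vm=p_A\langle Vu\pi_1,Ved\pi_1,Vv\pi_2\rangle,\qquad V\mu=p_A\langle V\alpha_2\pi_1,Ved\pi_1,V\alpha_3\pi_2\rangle,$$ where the morphisms $u,v,\alpha_2,\alpha_3\colon A\to A$ are defined by $$Vu=p_A\langle Vs\rho t,V\rho t,V\rho\rangle,\qquad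 Vv=p_A\langle Vs\lambda t,V\lambda t,V\lambda\rangle,$$ $$V\alpha_2=p_A\big\langle Vs\rho\lambda t,V\rho s\lambda t,p_A\langle Vs\rho t,V\rho t,V\rho\rangle\big\rangle,\qquad V\alpha_3=p_A\langle V\lambda s\lambda t,V\lambda^2t,V\lambda^2\rangle.$$ (P3) There exists a morphism $\theta\colon A\times_B(A\times_BA)\to A$ in $\mathbf{A}$ such that $$V\theta=p_A\langle V\alpha_1\pi_1,Ved\pi_1,V\mu\pi_{23}\rangle,$$ where $\mu$ is as in (P2) and $\alpha_1\colon A\to A$ is such that $$V\alpha_1=p_A\big\langle Vs\rho^2t,V\rho s\rho t,p_A\langle Vs\rho t,V\rho t,V\rho\rangle\big\rangle.$$
   Context: **$V$-Mal'tsev operation.** A natural transformation $p\colon V^3\to V$ with $p_A\langle x,y,y\rangle=x=p_A\langle y,y,x\rangle$ for all $x,y\colon B\to V(A)$ in $\mathbf{B}$. A category with finite limits is weakly Mal'tsev if for all split epimorphisms $f\colon A\to B$, $g\colon C\to B$ with sections $r,s$ the morphisms $\langle1_A,sf\rangle$, $\langle rg,1_C\rangle$ into $A\times_BC$ are jointly epimorphic (this holds automatically here). Juxtapositions such as $Vs\rho t$ and $Vu\pi_1$ mean $V(s\rho t)$, $V(u\pi_1)$. **Pullbacks.** $A\times_BA$ is the pullback of $d$ (first factor, projection $\pi_1$) and $c$ (second factor, projection $\pi_2$); on $A\times_B(A\times_BA)$, $\pi_1$ is the first projection and $\pi_{23}$ the projection to $A\times_BA$ of the last two factors. **The 2-category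 $\mathsf{G}(\mathbf{A})^{*}$.** Objects: triples $(A,s,t)$ with $s,t\colon A\to A$ in $\mathbf{A}$, $st=t$, $ts=s$, satisfying (P1) of the claim. Morphisms $(A',s',t')\to(A,s,t)$: $f\colon A'\to A$ in $\mathbf{A}$ with $sf=fs'$, $tf=ft'$. 2-cells: morphisms $\tau\colon A'\to A$ of $\mathbf{A}$ with $s\tau s'=s\tau$, $t\tau t'=t\tau$, with domain and codomain the unique morphisms satisfying $V(\mathrm{dom}(\tau))=p_A\langle V(s\tau t'),V(\tau t'),V(\tau)\rangle$, $V(\mathrm{cod}(\tau))=p_A\langle V(\tau),V(\tau s'),V(t\tau s')\rangle$; the identity 2-cell on $f$ is $f$; vertical composition of $\sigma$ followed by $\tau$ with $\mathrm{dom}(\tau)=f=\mathrm{cod}(\sigma)$ is the unique morphism $\tau+\sigma$ with $V(\tau+\sigma)=p_A\langle V\tau,Vf,V\sigma\rangle$; whiskering is composition in $\mathbf{A}$. This is equivalent to the 2-category $\mathsf{Grpd}(\mathbf{A})$ of internal groupoids, internal functors and internal natural transformations in $\mathbf{A}$: a groupoid with object of arrows $A$, domain $d$, codomain $c$ and identities $e$ corresponds to $(A,ed,ec)$; discrete groupoids correspond to triples $(B,1_B,1_B)$. **Pseudocategories.** A pseudocategory in a 2-category consists of objects $C_0,C_1$, morphisms $d,c\colon C_1\to C_0$, $e\colon C_0\to C_1$ with $de=1=ce$, a morphism $m\colon C_1\times_{C_0}C_1\to C_1$ on the pullback of $d$ and $c$ with $dm=d\pi_2$, $cm=c\pi_1$,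 and invertible 2-cells $\alpha\colon m(1\times m)\Rightarrow m(m\times1)$, $\lambda\colon me_2\Rightarrow1_{C_1}$, $\rho\colon me_1\Rightarrow1_{C_1}$, where $e_1=\langle1,ed\rangle$, $e_2=\langle ec,1\rangle$, such that $d\lambda=d=d\rho$, $c\lambda=c=c\rho$, $d\alpha=d\pi_3$, $c\alpha=c\pi_1$, $\lambda e=\rho e$, and satisfying the pentagon $\alpha(m\times1\times1)\cdot\alpha(1\times1\times m)=m(\alpha\times1)\cdot\alpha(1\times m\times1)\cdot m(1\times\alpha)$ and triangle $m(\rho\times1)\cdot\alpha\langle\pi_1,ed\pi_1,\pi_2\rangle=m(1\times\lambda)$. It is homogeneous if $\lambda e=e=\rho e$. **Internal bicategories.** An internal bicategory in $\mathbf{A}$, homogeneous and with invertible 2-cells, is a homogeneous pseudocategory in $\mathsf{Grpd}(\mathbf{A})$ (equivalently in $\mathsf{G}(\mathbf{A})^{*}$) whose object of objects $C_0$ is discrete. In the claim, $C_0$ corresponds to $(B,1_B,1_B)$ and $C_1$ to $(A,s,t)$; $d,c,e$ are the structure morphisms, $m$ the horizontal composition, $\lambda,\rho$ the unit isomorphisms and $\theta$ the associativity isomorphism.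
   Formalization: In (P2) the formula for α₂ is corrected: its inner term p⟨Vsρt, Vρt, Vρ⟩ is replaced by p⟨Vsλt, Vλt, Vλρ⟩; as printed, the claim fails for the indiscrete groupoid on a non-abelian group with m the second projection. *)

(* Defs.v *)
From Stdlib Require Import ssreflect ClassicalEpsilon ProofIrrelevance.

Set Implicit Arguments.
Unset Strict Implicit.
Unset Printing Implicit Defensive.
Set SsrOldRewriteGoalsOrder.

Declare Scope cat_scope.
Delimit Scope cat_scope with cat.
Local Open Scope cat_scope.

(** * Categories, finite limits, functors *)

Record category := Category {
  ob :> Type;
  hom : ob -> ob -> Type;
  idm : forall X, hom X X;
  comp : forall X Y Z, hom Y Z -> hom X Y -> hom X Z;
  comp_idl : forall X Y (f : hom X Y), comp (idm Y) f = f;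
  comp_idr : forall X Y (f : hom X Y), comp f (idm X) = f;
  comp_assoc : forall X Y Z T (h : hom Z T) (g : hom Y Z) (f : hom X Y),
    comp h (comp g f) = comp (comp h g) f
}.

Arguments hom {c} X Y.
Arguments idm {c} X.
Arguments comp {c X Y Z} g f.

Notation "g ∘ f" := (comp g f) (at level 40, left associativity) : cat_scope.

Record pullbacks (C : category) := Pullbacks {
  pb : forall X Y Z : C, hom X Z -> hom Y Z -> C;
  pb1 : forall (X Y Z : C) (f : hom X Z) (g : hom Y Z), hom (pb f g) X;
  pb2 : forall (X Y Z : C) (f : hom X Z) (g : hom Y Z), hom (pb f g) Y;
  pb_comm : forall (X Y Z : C) (f : hom X Z) (g : hom Y Z),
    f ∘ pb1 f g = g ∘ pb2 f g;
  pb_pair : forall (X Y Z : C) (f : hom X Z) (g : hom Y Z) (T : C)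
    (x : hom T X) (y : hom T Y), f ∘ x = g ∘ y -> hom T (pb f g);
  pb1_pair : forall (X Y Z : C) (f : hom X Z) (g : hom Y Z) (T : C)
    (x : hom T X) (y : hom T Y) (H : f ∘ x = g ∘ y),
    pb1 f g ∘ pb_pair H = x;
  pb2_pair : forall (X Y Z : C) (f : hom X Z) (g : hom Y Z) (T : C)
    (x : hom T X) (y : hom T Y) (H : f ∘ x = g ∘ y),
    pb2 f g ∘ pb_pair H = y;
  pb_ext : forall (X Y Z : C) (f : hom X Z) (g : hom Y Z) (T : C)
    (h k : hom T (pb f g)),
    pb1 f g ∘ h = pb1 f g ∘ k -> pb2 f g ∘ h = pb2 f g ∘ k -> h = k
}.

Arguments pb {C} p {X Y Z} f g.
Arguments pb1 {C} p {X Y Z} f g.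
Arguments pb2 {C} p {X Y Z} f g.
Arguments pb_comm {C} p {X Y Z} f g.
Arguments pb_pair {C} p {X Y Z f g T x y} H.
Arguments pb1_pair {C} p {X Y Z f g T x y} H.
Arguments pb2_pair {C} p {X Y Z f g T x y} H.
Arguments pb_ext {C} p {X Y Z f g T} h k.

(** Finite limits are presented by a terminal object and pullbacks. *)
Record finite_limits (C : category) := FiniteLimits {
  fl_pb :> pullbacks C;
  term : C;
  to_term : forall X : C, hom X term;
  to_term_uniq : forall (X : C) (f g : hom X term), f = g
}.

Arguments term {C} l : rename.
Arguments to_term {C} l X : rename.
Arguments to_term_uniq {C} l {X} f g : rename.

Section Products.
Variables (C : category) (L : finite_limits C).

Definition prod (X Y : C) : C := pb L (to_term L X) (to_term L Y).

Definition pair (T X Y : C) (x : hom T X) (y : hom T Y) : hom T (prod X Y) :=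
  pb_pair L (to_term_uniq L (to_term L X ∘ x) (to_term L Y ∘ y)).

Definition pr1 (X Y : C) : hom (prod X Y) X := pb1 L _ _.
Definition pr2 (X Y : C) : hom (prod X Y) Y := pb2 L _ _.

Lemma pr1_pair (T X Y : C) (x : hom T X) (y : hom T Y) :
  pr1 X Y ∘ pair x y = x.
Proof. exact: pb1_pair. Qed.

Lemma pr2_pair (T X Y : C) (x : hom T X) (y : hom T Y) :
  pr2 X Y ∘ pair x y = y.
Proof. exact: pb2_pair. Qed.

Lemma pair_comp (T U X Y : C) (x : hom T X) (y : hom T Y) (w : hom U T) :
  pair x y ∘ w = pair (x ∘ w) (y ∘ w).
Proof.
apply: (pb_ext L); rewrite comp_assoc.
  by rewrite [in LHS]/pair pb1_pair [RHS]pr1_pair.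
by rewrite [in LHS]/pair pb2_pair [RHS]pr2_pair.
Qed.

Definition cube (X : C) : C := prod X (prod X X).

Definition cube1 (X : C) : hom (cube X) X := pr1 X (prod X X).
Definition cube2 (X : C) : hom (cube X) X := pr1 X X ∘ pr2 X (prod X X).
Definition cube3 (X : C) : hom (cube X) X := pr2 X X ∘ pr2 X (prod X X).

Definition triple (T X : C) (x y z : hom T X) : hom T (cube X) :=
  pair x (pair y z).

End Products.

Record functor (A B : category) := Functor {
  fob :> A -> B;
  fhom : forall X Y : A, hom X Y -> hom (fob X) (fob Y);
  fhom_id : forall X : A, fhom (idm X) = idm (fob X);
  fhom_comp : forall (X Y Z : A) (g : hom Y Z) (f : hom X Y),
    fhom (g ∘ f) = fhom g ∘ fhom f
}.

Arguments fhom {A B} F {X Y} f : rename.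
Arguments fhom_id {A B} F X : rename.
Arguments fhom_comp {A B} F {X Y Z} g f : rename.

Definition faithful (A B : category) (V : functor A B) : Prop :=
  forall (X Y : A) (f g : hom X Y), fhom V f = fhom V g -> f = g.

Definition is_terminal (C : category) (T : C) : Prop :=
  forall X : C, exists! f : hom X T, True.

Definition is_pullback (C : category) (P X Y Z : C) (f : hom X Z) (g : hom Y Z)
    (u : hom P X) (v : hom P Y) : Prop :=
  f ∘ u = g ∘ v /\
  forall (T : C) (x : hom T X) (y : hom T Y), f ∘ x = g ∘ y ->
    exists! h : hom T P, u ∘ h = x /\ v ∘ h = y.

Definition preserves_finite_limits (A B : category) (V : functor A B) : Prop :=
  (forall T : A, is_terminal T -> is_terminal (V T)) /\
  (forall (P X Y Z : A) (f : hom X Z) (g : hom Y Z) (u : hom P X) (v : hom P Y),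
     is_pullback f g u v ->
     is_pullback (fhom V f) (fhom V g) (fhom V u) (fhom V v)).

(** * Weakly Mal'tsev categories and [V]-Mal'tsev operations *)

Definition jointly_epic (C : category) (X Y Z : C) (i : hom X Z) (j : hom Y Z) :
    Prop :=
  forall (T : C) (h k : hom Z T), h ∘ i = k ∘ i -> h ∘ j = k ∘ j -> h = k.

Section WeaklyMaltsev.
Variables (A : category) (L : pullbacks A).
Variables (X Y B : A) (f : hom X B) (g : hom Y B) (r : hom B X) (s : hom B Y).
Hypotheses (fr : f ∘ r = idm B) (gs : g ∘ s = idm B).

Lemma split_injl_proof : f ∘ idm X = g ∘ (s ∘ f).
Proof. by rewrite comp_assoc gs comp_idl comp_idr. Qed.

Lemma split_injr_proof : f ∘ (r ∘ g) = g ∘ idm Y.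
Proof. by rewrite comp_assoc fr comp_idl comp_idr. Qed.

Definition split_injl : hom X (pb L f g) := pb_pair L split_injl_proof.
Definition split_injr : hom Y (pb L f g) := pb_pair L split_injr_proof.
End WeaklyMaltsev.

Definition weakly_maltsev (A : category) (L : finite_limits A) : Prop :=
  forall (X Y B : A) (f : hom X B) (g : hom Y B) (r : hom B X) (s : hom B Y)
    (fr : f ∘ r = idm B) (gs : g ∘ s = idm B),
    jointly_epic (split_injl L f gs) (split_injr L g fr).

Record maltsev_op (A B : category) (L : finite_limits B) (V : functor A B) :=
  MaltsevOp {
  mop : forall X : A, hom (cube L (V X)) (V X);
  mop_nat : forall (X Y : A) (f : hom X Y),
    fhom V f ∘ mop X =
    mop Y ∘ triple L (fhom V f ∘ cube1 L (V X)) (fhom V f ∘ cube2 L (V X))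
                     (fhom V f ∘ cube3 L (V X));
  mop_l : forall (X : A) (T : B) (x y : hom T (V X)), mop X ∘ triple L x y y = x;
  mop_r : forall (X : A) (T : B) (x y : hom T (V X)), mop X ∘ triple L y y x = x
}.

Definition mal (A B : category) (L : finite_limits B) (V : functor A B)
    (p : maltsev_op L V) (X : A) (T : B) (x y z : hom T (V X)) : hom T (V X) :=
  mop p X ∘ triple L x y z.

(** * Strict 2-categories, 2-dimensional pullbacks *)

(** The 2-cells between two given objects form a single type equipped with
    domain and codomain; [vcomp t u _] is [u] followed by [t]. *)
Record two_category := TwoCategory {
  tc_cat :> category;
  cell : tc_cat -> tc_cat -> Type;
  dom2 : forall X Y, cell X Y -> hom X Y;
  cod2 : forall X Y, cell X Y -> hom X Y;
  id2 : forall X Y, hom X Y -> cell X Y;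
  vcomp : forall X Y (t u : cell X Y), dom2 t = cod2 u -> cell X Y;
  lwhisk : forall X Y Z, hom Y Z -> cell X Y -> cell X Z;
  rwhisk : forall X Y Z, cell Y Z -> hom X Y -> cell X Z;
  dom2_id : forall X Y (f : hom X Y), dom2 (id2 f) = f;
  cod2_id : forall X Y (f : hom X Y), cod2 (id2 f) = f;
  dom2_vcomp : forall X Y (t u : cell X Y) H, dom2 (@vcomp _ _ t u H) = dom2 u;
  cod2_vcomp : forall X Y (t u : cell X Y) H, cod2 (@vcomp _ _ t u H) = cod2 t;
  dom2_lwhisk : forall X Y Z (h : hom Y Z) (t : cell X Y),
    dom2 (lwhisk h t) = h ∘ dom2 t;
  cod2_lwhisk : forall X Y Z (h : hom Y Z) (t : cell X Y),
    cod2 (lwhisk h t) = h ∘ cod2 t;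
  dom2_rwhisk : forall X Y Z (t : cell Y Z) (h : hom X Y),
    dom2 (rwhisk t h) = dom2 t ∘ h;
  cod2_rwhisk : forall X Y Z (t : cell Y Z) (h : hom X Y),
    cod2 (rwhisk t h) = cod2 t ∘ h;
  vcomp_idl : forall X Y (f : hom X Y) (t : cell X Y) H, @vcomp _ _ (id2 f) t H = t;
  vcomp_idr : forall X Y (f : hom X Y) (t : cell X Y) H, @vcomp _ _ t (id2 f) H = t;
  vcomp_assoc : forall X Y (t u v : cell X Y) H1 H2 H3 H4,
    @vcomp _ _ t (@vcomp _ _ u v H1) H2 = @vcomp _ _ (@vcomp _ _ t u H3) v H4;
  lwhisk_id : forall X Y (t : cell X Y), lwhisk (idm Y) t = t;
  rwhisk_id : forall X Y (t : cell X Y), rwhisk t (idm X) = t;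
  lwhisk_comp : forall X Y Z T (h : hom Z T) (k : hom Y Z) (t : cell X Y),
    lwhisk (h ∘ k) t = lwhisk h (lwhisk k t);
  rwhisk_comp : forall X Y Z T (t : cell Z T) (h : hom Y Z) (k : hom X Y),
    rwhisk t (h ∘ k) = rwhisk (rwhisk t h) k;
  lrwhisk : forall X Y Z T (h : hom Z T) (t : cell Y Z) (k : hom X Y),
    lwhisk h (rwhisk t k) = rwhisk (lwhisk h t) k;
  lwhisk_id2 : forall X Y Z (h : hom Y Z) (f : hom X Y),
    lwhisk h (id2 f) = id2 (h ∘ f);
  rwhisk_id2 : forall X Y Z (f : hom Y Z) (h : hom X Y),
    rwhisk (id2 f) h = id2 (f ∘ h);
  lwhisk_vcomp : forall X Y Z (h : hom Y Z) (t u : cell X Y) H H',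
    lwhisk h (@vcomp _ _ t u H) = @vcomp _ _ (lwhisk h t) (lwhisk h u) H';
  rwhisk_vcomp : forall X Y Z (t u : cell Y Z) (h : hom X Y) H H',
    rwhisk (@vcomp _ _ t u H) h = @vcomp _ _ (rwhisk t h) (rwhisk u h) H';
  interchange : forall X Y Z (t : cell Y Z) (u : cell X Y) H H',
    @vcomp _ _ (lwhisk (cod2 t) u) (rwhisk t (dom2 u)) H =
    @vcomp _ _ (rwhisk t (cod2 u)) (lwhisk (dom2 t) u) H'
}.

Arguments cell {K} X Y : rename.
Arguments dom2 {K X Y} t : rename.
Arguments cod2 {K X Y} t : rename.
Arguments id2 {K X Y} f : rename.
Arguments vcomp {K X Y} t u H : rename.
Arguments lwhisk {K X Y Z} h t : rename.
Arguments rwhisk {K X Y Z} t h : rename.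

Record two_pullbacks (K : two_category) := TwoPullbacks {
  tp_pb :> pullbacks K;
  pb_cell : forall (X Y Z : K) (f : hom X Z) (g : hom Y Z) (T : K)
    (t : cell T X) (u : cell T Y),
    lwhisk f t = lwhisk g u -> cell T (pb tp_pb f g);
  pb1_cell : forall (X Y Z : K) (f : hom X Z) (g : hom Y Z) (T : K)
    (t : cell T X) (u : cell T Y) (H : lwhisk f t = lwhisk g u),
    lwhisk (pb1 tp_pb f g) (pb_cell H) = t;
  pb2_cell : forall (X Y Z : K) (f : hom X Z) (g : hom Y Z) (T : K)
    (t : cell T X) (u : cell T Y) (H : lwhisk f t = lwhisk g u),
    lwhisk (pb2 tp_pb f g) (pb_cell H) = u;
  pb_cell_ext : forall (X Y Z : K) (f : hom X Z) (g : hom Y Z) (T : K)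
    (t u : cell T (pb tp_pb f g)),
    lwhisk (pb1 tp_pb f g) t = lwhisk (pb1 tp_pb f g) u ->
    lwhisk (pb2 tp_pb f g) t = lwhisk (pb2 tp_pb f g) u -> t = u
}.

Arguments pb_cell {K} P {X Y Z f g T t u} H : rename.
Arguments pb1_cell {K} P {X Y Z f g T t u} H : rename.
Arguments pb2_cell {K} P {X Y Z f g T t u} H : rename.

Definition invertible2 (K : two_category) (X Y : K) (t : cell X Y) : Prop :=
  exists (u : cell X Y) (H : dom2 t = cod2 u) (H' : dom2 u = cod2 t),
    vcomp t u H = id2 (cod2 t) /\ vcomp u t H' = id2 (dom2 t).

(** * Pseudocategories *)

Record pre_pseudocategory (K : two_category) (P : two_pullbacks K) :=
  PrePseudocategory {
  pc0 : K;
  pc1 : K;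
  pcd : hom pc1 pc0;
  pcc : hom pc1 pc0;
  pce : hom pc0 pc1;
  pcm : hom (pb P pcd pcc) pc1;
  pc_de : pcd ∘ pce = idm pc0;
  pc_ce : pcc ∘ pce = idm pc0;
  pc_dm : pcd ∘ pcm = pcd ∘ pb2 P pcd pcc;
  pc_cm : pcc ∘ pcm = pcc ∘ pb1 P pcd pcc
}.

Section PrePseudo.
Variables (K : two_category) (P : two_pullbacks K) (S : pre_pseudocategory P).

Local Notation C0 := (pc0 S).
Local Notation C1 := (pc1 S).
Local Notation d := (pcd S).
Local Notation c := (pcc S).
Local Notation e := (pce S).
Local Notation m := (pcm S).

(** [m⟨x,y⟩]. *)
Definition pmul (T : K) (x y : hom T C1) (H : d ∘ x = c ∘ y) : hom T C1 :=
  m ∘ pb_pair P H.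

Lemma d_pmul (T : K) (x y : hom T C1) (H : d ∘ x = c ∘ y) :
  d ∘ pmul H = d ∘ y.
Proof. by rewrite /pmul comp_assoc pc_dm -comp_assoc pb2_pair. Qed.

Lemma c_pmul (T : K) (x y : hom T C1) (H : d ∘ x = c ∘ y) :
  c ∘ pmul H = c ∘ x.
Proof. by rewrite /pmul comp_assoc pc_cm -comp_assoc pb1_pair. Qed.

Lemma eq_pmul (T : K) (x y x' y' : hom T C1) (H : d ∘ x = c ∘ y)
    (H' : d ∘ x' = c ∘ y') : x = x' -> y = y' -> pmul H = pmul H'.
Proof.
by move=> ex ey; subst x' y'; rewrite (proof_irrelevance _ H H').
Qed.

Lemma pmul_comp (T U : K) (x y : hom T C1) (w : hom U T) (H : d ∘ x = c ∘ y)
    (H' : d ∘ (x ∘ w) = c ∘ (y ∘ w)) : pmul H ∘ w = pmul H'.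
Proof.
rewrite /pmul -comp_assoc; congr (_ ∘ _).
by apply: (pb_ext P); rewrite comp_assoc ?pb1_pair ?pb2_pair.
Qed.

(** [m⟨t,u⟩] for 2-cells [t], [u]. *)
Definition pmul2 (T : K) (t u : cell T C1) (H : lwhisk d t = lwhisk c u) :
  cell T C1 := lwhisk m (pb_cell P H).

Lemma dom_match (T : K) (t u : cell T C1) (H : lwhisk d t = lwhisk c u) :
  d ∘ dom2 t = c ∘ dom2 u.
Proof. by rewrite -!dom2_lwhisk H. Qed.

Lemma cod_match (T : K) (t u : cell T C1) (H : lwhisk d t = lwhisk c u) :
  d ∘ cod2 t = c ∘ cod2 u.
Proof. by rewrite -!cod2_lwhisk H. Qed.

Lemma dom2_pmul2 (T : K) (t u : cell T C1) (H : lwhisk d t = lwhisk c u) :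
  dom2 (pmul2 H) = pmul (dom_match H).
Proof.
rewrite /pmul2 dom2_lwhisk /pmul; congr (_ ∘ _).
by apply: (pb_ext P); rewrite -dom2_lwhisk ?pb1_cell ?pb2_cell
  ?pb1_pair ?pb2_pair.
Qed.

Lemma cod2_pmul2 (T : K) (t u : cell T C1) (H : lwhisk d t = lwhisk c u) :
  cod2 (pmul2 H) = pmul (cod_match H).
Proof.
rewrite /pmul2 cod2_lwhisk /pmul; congr (_ ∘ _).
by apply: (pb_ext P); rewrite -cod2_lwhisk ?pb1_cell ?pb2_cell
  ?pb1_pair ?pb2_pair.
Qed.

(** [C1 ×_{C0} C1], [C1 ×_{C0} (C1 ×_{C0} C1)] and the analogous quadruple
    pullback, with their projections to [C1]. *)
Definition pcs2 : K := pb P d c.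
Definition pcs2_1 : hom pcs2 C1 := pb1 P d c.
Definition pcs2_2 : hom pcs2 C1 := pb2 P d c.

Definition pcs3 : K := pb P d (c ∘ pcs2_1).
Definition pcs3_1 : hom pcs3 C1 := pb1 P d (c ∘ pcs2_1).
Definition pcs3_23 : hom pcs3 pcs2 := pb2 P d (c ∘ pcs2_1).
Definition pcs3_2 : hom pcs3 C1 := pcs2_1 ∘ pcs3_23.
Definition pcs3_3 : hom pcs3 C1 := pcs2_2 ∘ pcs3_23.

Definition pcs4 : K := pb P d (c ∘ pcs3_1).
Definition pcs4_1 : hom pcs4 C1 := pb1 P d (c ∘ pcs3_1).
Definition pcs4_234 : hom pcs4 pcs3 := pb2 P d (c ∘ pcs3_1).
Definition pcs4_2 : hom pcs4 C1 := pcs3_1 ∘ pcs4_234.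
Definition pcs4_3 : hom pcs4 C1 := pcs3_2 ∘ pcs4_234.
Definition pcs4_4 : hom pcs4 C1 := pcs3_3 ∘ pcs4_234.

Lemma pcs2_12 : d ∘ pcs2_1 = c ∘ pcs2_2.
Proof. exact: pb_comm. Qed.

Lemma pcs3_12 : d ∘ pcs3_1 = c ∘ pcs3_2.
Proof. by rewrite /pcs3_2 comp_assoc; apply: pb_comm. Qed.

Lemma pcs3_p23 : d ∘ pcs3_2 = c ∘ pcs3_3.
Proof. by rewrite /pcs3_2 /pcs3_3 !comp_assoc pcs2_12. Qed.

Lemma pcs4_12 : d ∘ pcs4_1 = c ∘ pcs4_2.
Proof. by rewrite /pcs4_2 comp_assoc; apply: pb_comm. Qed.

Lemma pcs4_23 : d ∘ pcs4_2 = c ∘ pcs4_3.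
Proof. by rewrite /pcs4_2 /pcs4_3 comp_assoc pcs3_12 -comp_assoc. Qed.

Lemma pcs4_34 : d ∘ pcs4_3 = c ∘ pcs4_4.
Proof. by rewrite /pcs4_3 /pcs4_4 comp_assoc pcs3_p23 -comp_assoc. Qed.

Lemma tri_proof (T : K) (x y z : hom T C1) (H1 : d ∘ x = c ∘ y)
    (H2 : d ∘ y = c ∘ z) : d ∘ x = (c ∘ pcs2_1) ∘ pb_pair P H2.
Proof. by rewrite -comp_assoc /pcs2_1 pb1_pair. Qed.

(** [⟨x,⟨y,z⟩⟩]. *)
Definition tri (T : K) (x y z : hom T C1) (H1 : d ∘ x = c ∘ y)
    (H2 : d ∘ y = c ∘ z) : hom T pcs3 := pb_pair P (tri_proof H1 H2).

Lemma pcs3_1_tri (T : K) (x y z : hom T C1) (H1 : d ∘ x = c ∘ y)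
  (H2 : d ∘ y = c ∘ z) : pcs3_1 ∘ tri H1 H2 = x.
Proof. by rewrite /pcs3_1 /tri pb1_pair. Qed.

Lemma pcs3_2_tri (T : K) (x y z : hom T C1) (H1 : d ∘ x = c ∘ y)
  (H2 : d ∘ y = c ∘ z) : pcs3_2 ∘ tri H1 H2 = y.
Proof.
by rewrite /pcs3_2 /pcs3_23 /tri -comp_assoc pb2_pair /pcs2_1 pb1_pair.
Qed.

Lemma pcs3_3_tri (T : K) (x y z : hom T C1) (H1 : d ∘ x = c ∘ y)
  (H2 : d ∘ y = c ∘ z) : pcs3_3 ∘ tri H1 H2 = z.
Proof.
by rewrite /pcs3_3 /pcs3_23 /tri -comp_assoc pb2_pair /pcs2_2 pb2_pair.
Qed.

Lemma pmulR_proof (T : K) (x y z : hom T C1) (H1 : d ∘ x = c ∘ y)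
    (H2 : d ∘ y = c ∘ z) : d ∘ x = c ∘ pmul H2.
Proof. by rewrite c_pmul. Qed.

Lemma pmulL_proof (T : K) (x y z : hom T C1) (H1 : d ∘ x = c ∘ y)
    (H2 : d ∘ y = c ∘ z) : d ∘ pmul H1 = c ∘ z.
Proof. by rewrite d_pmul. Qed.

(** [m⟨x,m⟨y,z⟩⟩] and [m⟨m⟨x,y⟩,z⟩]. *)
Definition pmulR (T : K) (x y z : hom T C1) (H1 : d ∘ x = c ∘ y)
  (H2 : d ∘ y = c ∘ z) : hom T C1 := pmul (pmulR_proof H1 H2).

Definition pmulL (T : K) (x y z : hom T C1) (H1 : d ∘ x = c ∘ y)
  (H2 : d ∘ y = c ∘ z) : hom T C1 := pmul (pmulL_proof H1 H2).

Lemma unitl_proof (T : K) (x : hom T C1) : d ∘ (e ∘ c ∘ x) = c ∘ x.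
Proof. by rewrite !comp_assoc pc_de comp_idl. Qed.

Lemma unitr_proof (T : K) (x : hom T C1) : d ∘ x = c ∘ (e ∘ d ∘ x).
Proof. by rewrite !comp_assoc pc_ce comp_idl. Qed.

(** [m⟨ecx,x⟩] and [m⟨x,edx⟩]. *)
Definition unitl (T : K) (x : hom T C1) : hom T C1 := pmul (unitl_proof x).
Definition unitr (T : K) (x : hom T C1) : hom T C1 := pmul (unitr_proof x).

End PrePseudo.

Arguments pcs2 {K P} S.
Arguments pcs3 {K P} S.
Arguments pcs4 {K P} S.
Arguments pcs2_1 {K P} S.
Arguments pcs2_2 {K P} S.
Arguments pcs3_1 {K P} S.
Arguments pcs3_2 {K P} S.
Arguments pcs3_3 {K P} S.
Arguments pcs3_23 {K P} S.
Arguments pcs4_1 {K P} S.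
Arguments pcs4_2 {K P} S.
Arguments pcs4_3 {K P} S.
Arguments pcs4_4 {K P} S.
Arguments unitl {K P} S {T} x.
Arguments unitr {K P} S {T} x.

Record pseudo_data (K : two_category) (P : two_pullbacks K) := PseudoData {
  pd_pre :> pre_pseudocategory P;
  pc_assoc : cell (pcs3 pd_pre) (pc1 pd_pre);
  pc_lunit : cell (pc1 pd_pre) (pc1 pd_pre);
  pc_runit : cell (pc1 pd_pre) (pc1 pd_pre);
  dom2_assoc : dom2 pc_assoc = pmulR (pcs3_12 pd_pre) (pcs3_p23 pd_pre);
  cod2_assoc : cod2 pc_assoc = pmulL (pcs3_12 pd_pre) (pcs3_p23 pd_pre);
  dom2_lunit : dom2 pc_lunit = unitl pd_pre (idm (pc1 pd_pre));
  cod2_lunit : cod2 pc_lunit = idm (pc1 pd_pre);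
  dom2_runit : dom2 pc_runit = unitr pd_pre (idm (pc1 pd_pre));
  cod2_runit : cod2 pc_runit = idm (pc1 pd_pre);
  inv_assoc : invertible2 pc_assoc;
  inv_lunit : invertible2 pc_lunit;
  inv_runit : invertible2 pc_runit;
  d_assoc : lwhisk (pcd pd_pre) pc_assoc = id2 (pcd pd_pre ∘ pcs3_3 pd_pre);
  c_assoc : lwhisk (pcc pd_pre) pc_assoc = id2 (pcc pd_pre ∘ pcs3_1 pd_pre);
  d_lunit : lwhisk (pcd pd_pre) pc_lunit = id2 (pcd pd_pre);
  c_lunit : lwhisk (pcc pd_pre) pc_lunit = id2 (pcc pd_pre);
  d_runit : lwhisk (pcd pd_pre) pc_runit = id2 (pcd pd_pre);
  c_runit : lwhisk (pcc pd_pre) pc_runit = id2 (pcc pd_pre);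
  lunit_runit_e : rwhisk pc_lunit (pce pd_pre) = rwhisk pc_runit (pce pd_pre)
}.

Section Coherence.
Variables (K : two_category) (P : two_pullbacks K) (S : pseudo_data P).

Local Notation C1 := (pc1 S).
Local Notation d := (pcd S).
Local Notation c := (pcc S).
Local Notation e := (pce S).

(** [α⟨x,y,z⟩]. *)
Definition assoc_at (T : K) (x y z : hom T C1) (H1 : d ∘ x = c ∘ y)
  (H2 : d ∘ y = c ∘ z) : cell T C1 := rwhisk (pc_assoc S) (tri H1 H2).

Lemma dom2_assoc_at (T : K) (x y z : hom T C1) (H1 : d ∘ x = c ∘ y)
  (H2 : d ∘ y = c ∘ z) : dom2 (assoc_at H1 H2) = pmulR H1 H2.
Proof.
have H2' : d ∘ (pcs3_2 S ∘ tri H1 H2) = c ∘ (pcs3_3 S ∘ tri H1 H2).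
  by rewrite pcs3_2_tri pcs3_3_tri.
have H1' : d ∘ (pcs3_1 S ∘ tri H1 H2) =
    c ∘ (pmul (pcs3_p23 S) ∘ tri H1 H2).
  by rewrite (pmul_comp _ H2') c_pmul pcs3_1_tri pcs3_2_tri.
rewrite /assoc_at dom2_rwhisk dom2_assoc /pmulR (pmul_comp _ H1').
apply: eq_pmul; first by rewrite pcs3_1_tri.
by rewrite (pmul_comp _ H2'); apply: eq_pmul; rewrite ?pcs3_2_tri ?pcs3_3_tri.
Qed.

Lemma cod2_assoc_at (T : K) (x y z : hom T C1) (H1 : d ∘ x = c ∘ y)
  (H2 : d ∘ y = c ∘ z) : cod2 (assoc_at H1 H2) = pmulL H1 H2.
Proof.
have H1' : d ∘ (pcs3_1 S ∘ tri H1 H2) = c ∘ (pcs3_2 S ∘ tri H1 H2).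
  by rewrite pcs3_1_tri pcs3_2_tri.
have H2' : d ∘ (pmul (pcs3_12 S) ∘ tri H1 H2) =
    c ∘ (pcs3_3 S ∘ tri H1 H2).
  by rewrite (pmul_comp _ H1') d_pmul pcs3_3_tri pcs3_2_tri.
rewrite /assoc_at cod2_rwhisk cod2_assoc /pmulL (pmul_comp _ H2').
apply: eq_pmul; last by rewrite pcs3_3_tri.
by rewrite (pmul_comp _ H1'); apply: eq_pmul; rewrite ?pcs3_1_tri ?pcs3_2_tri.
Qed.

Lemma d_assoc_at (T : K) (x y z : hom T C1) (H1 : d ∘ x = c ∘ y)
  (H2 : d ∘ y = c ∘ z) : lwhisk d (assoc_at H1 H2) = id2 (d ∘ z).
Proof.
by rewrite /assoc_at lrwhisk d_assoc rwhisk_id2 -comp_assoc pcs3_3_tri.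
Qed.

Lemma c_assoc_at (T : K) (x y z : hom T C1) (H1 : d ∘ x = c ∘ y)
  (H2 : d ∘ y = c ∘ z) : lwhisk c (assoc_at H1 H2) = id2 (c ∘ x).
Proof.
by rewrite /assoc_at lrwhisk c_assoc rwhisk_id2 -comp_assoc pcs3_1_tri.
Qed.

(** The triangle is an equation of 2-cells [C1 ×_{C0} C1 → C1]; here
    [x = π1], [y = π2]. *)
Section Triangle.
Local Notation x := (pcs2_1 S).
Local Notation y := (pcs2_2 S).

Lemma tri_runit_proof :
  lwhisk d (rwhisk (pc_runit S) x) = lwhisk c (id2 y).
Proof. by rewrite lrwhisk d_runit rwhisk_id2 lwhisk_id2 pcs2_12. Qed.

Lemma tri_lunit_proof :
  lwhisk d (id2 x) = lwhisk c (rwhisk (pc_lunit S) y).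
Proof. by rewrite lrwhisk c_lunit rwhisk_id2 lwhisk_id2 pcs2_12. Qed.

Lemma tri_mid_proof : d ∘ (e ∘ d ∘ x) = c ∘ y.
Proof. by rewrite !comp_assoc pc_de comp_idl pcs2_12. Qed.

Definition runit_times_1 : cell (pcs2 S) C1 := pmul2 tri_runit_proof.
Definition one_times_lunit : cell (pcs2 S) C1 := pmul2 tri_lunit_proof.
Definition triangle_assoc : cell (pcs2 S) C1 :=
  assoc_at (unitr_proof x) tri_mid_proof.

Lemma triangle_proof : dom2 runit_times_1 = cod2 triangle_assoc.
Proof.
rewrite dom2_pmul2 cod2_assoc_at /pmulL; apply: eq_pmul; last by rewrite dom2_id.
rewrite dom2_rwhisk dom2_runit /unitr.
have H : d ∘ (idm C1 ∘ x) = c ∘ (e ∘ d ∘ idm C1 ∘ x).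
  by rewrite comp_idl comp_idr; apply: unitr_proof.
by rewrite (pmul_comp _ H); apply: eq_pmul; rewrite ?comp_idl ?comp_idr.
Qed.

Definition triangle : Prop :=
  vcomp runit_times_1 triangle_assoc triangle_proof = one_times_lunit.
End Triangle.

(** The pentagon is an equation of 2-cells on the quadruple pullback; here
    [x], [y], [z], [w] are the four projections. *)
Section Pentagon.
Local Notation x := (pcs4_1 S).
Local Notation y := (pcs4_2 S).
Local Notation z := (pcs4_3 S).
Local Notation w := (pcs4_4 S).

Definition pent_m11 : cell (pcs4 S) C1 :=
  assoc_at (pmulL_proof (pcs4_12 S) (pcs4_23 S)) (pcs4_34 S).
Definition pent_11m : cell (pcs4 S) C1 :=
  assoc_at (pcs4_12 S) (pmulR_proof (pcs4_23 S) (pcs4_34 S)).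
Definition pent_1m1 : cell (pcs4 S) C1 :=
  assoc_at (pmulR_proof (pcs4_12 S) (pcs4_23 S))
           (pmulL_proof (pcs4_23 S) (pcs4_34 S)).

Lemma pent_a1_proof :
  lwhisk d (assoc_at (pcs4_12 S) (pcs4_23 S)) = lwhisk c (id2 w).
Proof. by rewrite d_assoc_at lwhisk_id2 pcs4_34. Qed.

Lemma pent_1a_proof :
  lwhisk d (id2 x) = lwhisk c (assoc_at (pcs4_23 S) (pcs4_34 S)).
Proof. by rewrite c_assoc_at lwhisk_id2 pcs4_12. Qed.

Definition pent_a1 : cell (pcs4 S) C1 := pmul2 pent_a1_proof.
Definition pent_1a : cell (pcs4 S) C1 := pmul2 pent_1a_proof.

Lemma pent_short_proof : dom2 pent_m11 = cod2 pent_11m.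
Proof.
by rewrite dom2_assoc_at cod2_assoc_at /pmulL /pmulR; apply: eq_pmul.
Qed.

Lemma pent_long1_proof : dom2 pent_a1 = cod2 pent_1m1.
Proof.
rewrite dom2_pmul2 cod2_assoc_at /pmulL; apply: eq_pmul; last by rewrite dom2_id.
by rewrite dom2_assoc_at.
Qed.

Definition pent_long1 : cell (pcs4 S) C1 :=
  vcomp pent_a1 pent_1m1 pent_long1_proof.

Lemma pent_long2_proof : dom2 pent_long1 = cod2 pent_1a.
Proof.
rewrite dom2_vcomp dom2_assoc_at cod2_pmul2 /pmulR; apply: eq_pmul.
  by rewrite cod2_id.
by rewrite cod2_assoc_at.
Qed.

Definition pentagon : Prop :=
  vcomp pent_m11 pent_11m pent_short_proof =
  vcomp pent_long1 pent_1a pent_long2_proof.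
End Pentagon.

End Coherence.

Arguments triangle {K P} S.
Arguments pentagon {K P} S.

Record pseudocategory (K : two_category) (P : two_pullbacks K) :=
  Pseudocategory {
  ps_data :> pseudo_data P;
  ps_pentagon : pentagon ps_data;
  ps_triangle : triangle ps_data
}.

Definition homogeneous (K : two_category) (P : two_pullbacks K)
    (S : pseudocategory P) : Prop :=
  rwhisk (pc_lunit S) (pce S) = id2 (pce S) /\
  rwhisk (pc_runit S) (pce S) = id2 (pce S).

(** * The 2-category [G(A)*] *)

Section GStar.
Variables (A B : category) (LA : finite_limits A) (LB : finite_limits B).
Variables (V : functor A B) (p : maltsev_op LB V).
Variables (Vfaith : faithful V) (Vlim : preserves_finite_limits V).

Local Notation "'V[' f ]" := (fhom V f) (format "V[ f ]").
Local Notation "p⟨ x , y , z ⟩" := (mal p x y z).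

Definition P1 (X : A) (s t : hom X X) : Prop :=
  forall (T : A) (a b c : hom T X), s ∘ a = s ∘ b -> t ∘ b = t ∘ c ->
    exists! f : hom T X, V[f] = p⟨V[a], V[b], V[c]⟩.

(** For a groupoid with object of arrows [gcar], domain [d], codomain [c] and
    identities [e], [gs = e∘d] and [gt = e∘c]; [p⟨a,b,c⟩] in [P1] is the
    composite of [c], the inverse of [b], and [a]. *)
Record gobj := GObj {
  gcar : A;
  gs : hom gcar gcar;
  gt : hom gcar gcar;
  gst : gs ∘ gt = gt;
  gts : gt ∘ gs = gs;
  gP1 : P1 gs gt
}.

Record gmor (X Y : gobj) := GMor {
  gm :> hom (gcar X) (gcar Y);
  gm_s : gs Y ∘ gm = gm ∘ gs X;
  gm_t : gt Y ∘ gm = gm ∘ gt X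
}.

(** A natural transformation is encoded by its values on arrows, i.e. the
    diagonals of its naturality squares. *)
Record gcell (X Y : gobj) := GCell {
  gc :> hom (gcar X) (gcar Y);
  gc_s : gs Y ∘ gc ∘ gs X = gs Y ∘ gc;
  gc_t : gt Y ∘ gc ∘ gt X = gt Y ∘ gc
}.

Lemma triple_comp (T U : B) (X : B) (x y z : hom T X) (w : hom U T) :
  triple LB x y z ∘ w = triple LB (x ∘ w) (y ∘ w) (z ∘ w).
Proof. by rewrite /triple !pair_comp. Qed.

Lemma cube1_triple (T X : B) (x y z : hom T X) :
  cube1 LB X ∘ triple LB x y z = x.
Proof. exact: pr1_pair. Qed.

Lemma cube2_triple (T X : B) (x y z : hom T X) :
  cube2 LB X ∘ triple LB x y z = y.
Proof. by rewrite /cube2 -comp_assoc /triple pr2_pair pr1_pair. Qed.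

Lemma cube3_triple (T X : B) (x y z : hom T X) :
  cube3 LB X ∘ triple LB x y z = z.
Proof. by rewrite /cube3 -comp_assoc /triple !pr2_pair. Qed.

Lemma mal_comp (X : A) (T U : B) (x y z : hom T (V X)) (w : hom U T) :
  p⟨x, y, z⟩ ∘ w = p⟨x ∘ w, y ∘ w, z ∘ w⟩.
Proof. by rewrite /mal -comp_assoc triple_comp. Qed.

Lemma mal_nat (X Y : A) (f : hom X Y) (T : B) (x y z : hom T (V X)) :
  V[f] ∘ p⟨x, y, z⟩ = p⟨V[f] ∘ x, V[f] ∘ y, V[f] ∘ z⟩.
Proof.
rewrite /mal comp_assoc mop_nat -comp_assoc triple_comp.
rewrite -(comp_assoc _ (cube1 _ _)) -(comp_assoc _ (cube2 _ _)).
by rewrite -(comp_assoc _ (cube3 _ _)) cube1_triple cube2_triple cube3_triple.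
Qed.

Lemma mal_l (X : A) (T : B) (x y : hom T (V X)) : p⟨x, y, y⟩ = x.
Proof. exact: mop_l. Qed.

Lemma mal_r (X : A) (T : B) (x y : hom T (V X)) : p⟨y, y, x⟩ = x.
Proof. exact: mop_r. Qed.

Lemma P1_ex (X : A) (s t : hom X X) (H : P1 s t) (T : A) (a b c : hom T X) :
  s ∘ a = s ∘ b -> t ∘ b = t ∘ c ->
  {f : hom T X | V[f] = p⟨V[a], V[b], V[c]⟩}.
Proof.
move=> H1 H2; apply: constructive_indefinite_description.
by have [f [Hf _]] := H T a b c H1 H2; exists f.
Qed.

Lemma P1_intro (X : A) (s t : hom X X) :
  (forall (T : A) (a b c : hom T X), s ∘ a = s ∘ b -> t ∘ b = t ∘ c ->
    exists f : hom T X, V[f] = p⟨V[a], V[b], V[c]⟩) -> P1 s t.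
Proof.
move=> H T a b c H1 H2; have [f Hf] := H T a b c H1 H2.
by exists f; split=> // g Hg; apply: Vfaith; rewrite Hf Hg.
Qed.

Lemma mal_mal (X : gobj) (T : A) (a1 b1 c1 a2 b2 c2 a3 b3 c3 : hom T (gcar X)) :
  gs X ∘ a1 = gs X ∘ b1 -> gt X ∘ b1 = gt X ∘ c1 ->
  gs X ∘ a2 = gs X ∘ b2 -> gt X ∘ b2 = gt X ∘ c2 ->
  gs X ∘ a3 = gs X ∘ b3 -> gt X ∘ b3 = gt X ∘ c3 ->
  p⟨p⟨V[a1], V[b1], V[c1]⟩, p⟨V[a2], V[b2], V[c2]⟩, p⟨V[a3], V[b3], V[c3]⟩⟩ =
  p⟨p⟨V[a1], V[a2], V[a3]⟩, p⟨V[b1], V[b2], V[b3]⟩, p⟨V[c1], V[c2], V[c3]⟩⟩.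
Proof.
move=> s1 t1 s2 t2 s3 t3.
set P := pb LA (gs X) (gs X).
set Q := pb LA (gt X ∘ pb2 LA (gs X) (gs X)) (gt X).
set a : hom Q _ := pb1 LA (gs X) (gs X) ∘ pb1 LA _ _.
set b : hom Q _ := pb2 LA (gs X) (gs X) ∘ pb1 LA _ _.
set c : hom Q _ := pb2 LA (gt X ∘ pb2 LA (gs X) (gs X)) (gt X).
have Hs : gs X ∘ a = gs X ∘ b by rewrite /a /b !comp_assoc (pb_comm LA).
have Ht : gt X ∘ b = gt X ∘ c by rewrite /b /c comp_assoc (pb_comm LA).
have [f Hf] := P1_ex (gP1 (g := X)) Hs Ht.
have key (x y z : hom T (gcar X)) : gs X ∘ x = gs X ∘ y ->
    gt X ∘ y = gt X ∘ z ->
    exists r : hom T Q, a ∘ r = x /\ b ∘ r = y /\ c ∘ r = z.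
  move=> Hxy Hyz.
  have Hr : gt X ∘ pb2 LA (gs X) (gs X) ∘ pb_pair LA Hxy = gt X ∘ z.
    by rewrite -comp_assoc pb2_pair.
  exists (pb_pair LA Hr).
  by rewrite /a /b /c -!comp_assoc pb1_pair pb2_pair pb1_pair pb2_pair.
clearbody a b c.
have [r1 [<- [<- <-]]] := key _ _ _ s1 t1.
have [r2 [<- [<- <-]]] := key _ _ _ s2 t2.
have [r3 [<- [<- <-]]] := key _ _ _ s3 t3.
rewrite !fhom_comp -!mal_comp -!mal_nat -mal_comp -Hf.
by rewrite mal_nat.
Qed.

Lemma gtt (X : gobj) : gt X ∘ gt X = gt X.
Proof. by rewrite -{2}gst comp_assoc gts gst. Qed.

Lemma gss (X : gobj) : gs X ∘ gs X = gs X.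
Proof. by rewrite -{2}gts comp_assoc gst gts. Qed.

Lemma gmor_ext (X Y : gobj) (f g : gmor X Y) : gm f = gm g -> f = g.
Proof.
case: f g => [f fs ft] [g gs' gt'] /= E; subst g.
by rewrite (proof_irrelevance _ fs gs') (proof_irrelevance _ ft gt').
Qed.

Lemma gcell_ext (X Y : gobj) (f g : gcell X Y) : gc f = gc g -> f = g.
Proof.
case: f g => [f fs ft] [g gs' gt'] /= E; subst g.
by rewrite (proof_irrelevance _ fs gs') (proof_irrelevance _ ft gt').
Qed.

Lemma gid_proof (X : gobj) (s : hom (gcar X) (gcar X)) :
  s ∘ idm (gcar X) = idm (gcar X) ∘ s.
Proof. by rewrite comp_idl comp_idr. Qed.

Definition gid (X : gobj) : gmor X X :=
  @GMor X X (idm (gcar X)) (gid_proof _) (gid_proof _).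

Lemma gcomp_s (X Y Z : gobj) (g : gmor Y Z) (f : gmor X Y) :
  gs Z ∘ (g ∘ f) = g ∘ f ∘ gs X.
Proof. by rewrite comp_assoc gm_s -comp_assoc gm_s comp_assoc. Qed.

Lemma gcomp_t (X Y Z : gobj) (g : gmor Y Z) (f : gmor X Y) :
  gt Z ∘ (g ∘ f) = g ∘ f ∘ gt X.
Proof. by rewrite comp_assoc gm_t -comp_assoc gm_t comp_assoc. Qed.

Definition gcomp (X Y Z : gobj) (g : gmor Y Z) (f : gmor X Y) : gmor X Z :=
  GMor (gcomp_s g f) (gcomp_t g f).

Definition gcat : category.
Proof.
refine (@Category gobj gmor gid gcomp _ _ _) => *; apply: gmor_ext => /=.
- exact: comp_idl.
- exact: comp_idr.
- exact: comp_assoc.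
Defined.

Section DomCod.
Variables (X Y : gobj) (t : gcell X Y).

Lemma gdom_s :
  gs Y ∘ (gs Y ∘ t ∘ gt X) = gs Y ∘ (t ∘ gt X).
Proof. by rewrite !comp_assoc gss. Qed.

Lemma gdom_t : gt Y ∘ (t ∘ gt X) = gt Y ∘ t.
Proof. by rewrite comp_assoc gc_t. Qed.

Lemma gcod_s : gs Y ∘ t = gs Y ∘ (t ∘ gs X).
Proof. by rewrite comp_assoc gc_s. Qed.

Lemma gcod_t : gt Y ∘ (t ∘ gs X) = gt Y ∘ (gt Y ∘ t ∘ gs X).
Proof. by rewrite !comp_assoc gtt. Qed.

Definition gdom_mor : hom (gcar X) (gcar Y) :=
  proj1_sig (P1_ex (gP1 (g := Y)) gdom_s gdom_t).

Definition gcod_mor : hom (gcar X) (gcar Y) :=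
  proj1_sig (P1_ex (gP1 (g := Y)) gcod_s gcod_t).

Lemma gdom_morE :
  V[gdom_mor] = p⟨V[gs Y ∘ t ∘ gt X], V[t ∘ gt X], V[t]⟩.
Proof. exact: (proj2_sig (P1_ex (gP1 (g := Y)) gdom_s gdom_t)). Qed.

Lemma gcod_morE :
  V[gcod_mor] = p⟨V[t], V[t ∘ gs X], V[gt Y ∘ t ∘ gs X]⟩.
Proof. exact: (proj2_sig (P1_ex (gP1 (g := Y)) gcod_s gcod_t)). Qed.

Lemma s_gdom : gs Y ∘ gdom_mor = gs Y ∘ t.
Proof.
apply: Vfaith; rewrite fhom_comp gdom_morE mal_nat -!fhom_comp !comp_assoc.
by rewrite gss mal_r.
Qed.

Lemma t_gdom : gt Y ∘ gdom_mor = gs Y ∘ t ∘ gt X.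
Proof.
apply: Vfaith; rewrite fhom_comp gdom_morE mal_nat -!fhom_comp !comp_assoc.
by rewrite gts gc_t mal_l.
Qed.

Lemma s_gcod : gs Y ∘ gcod_mor = gt Y ∘ t ∘ gs X.
Proof.
apply: Vfaith; rewrite fhom_comp gcod_morE mal_nat -!fhom_comp !comp_assoc.
by rewrite gst gc_s mal_r.
Qed.

Lemma t_gcod : gt Y ∘ gcod_mor = gt Y ∘ t.
Proof.
apply: Vfaith; rewrite fhom_comp gcod_morE mal_nat -!fhom_comp !comp_assoc.
by rewrite gtt mal_l.
Qed.

Lemma gdom_mor_s : gs Y ∘ gdom_mor = gdom_mor ∘ gs X.
Proof.
rewrite s_gdom; apply: Vfaith.
rewrite fhom_comp (fhom_comp V gdom_mor) gdom_morE mal_comp -!fhom_comp.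
by rewrite -!comp_assoc gts mal_l comp_assoc gc_s.
Qed.

Lemma gdom_mor_t : gt Y ∘ gdom_mor = gdom_mor ∘ gt X.
Proof.
rewrite t_gdom; apply: Vfaith.
rewrite (fhom_comp V gdom_mor) gdom_morE mal_comp -!fhom_comp.
by rewrite -!comp_assoc gtt mal_l.
Qed.

Lemma gcod_mor_s : gs Y ∘ gcod_mor = gcod_mor ∘ gs X.
Proof.
rewrite s_gcod; apply: Vfaith.
rewrite (fhom_comp V gcod_mor) gcod_morE mal_comp -!fhom_comp.
by rewrite -!comp_assoc gss mal_r.
Qed.

Lemma gcod_mor_t : gt Y ∘ gcod_mor = gcod_mor ∘ gt X.
Proof.
rewrite t_gcod; apply: Vfaith.
rewrite (fhom_comp V gcod_mor) gcod_morE mal_comp -!fhom_comp.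
by rewrite -!comp_assoc gst mal_r comp_assoc gc_t.
Qed.

Definition gdom : gmor X Y := GMor gdom_mor_s gdom_mor_t.
Definition gcod : gmor X Y := GMor gcod_mor_s gcod_mor_t.
End DomCod.

Lemma gid2_s (X Y : gobj) (f : gmor X Y) : gs Y ∘ f ∘ gs X = gs Y ∘ f.
Proof. by rewrite gm_s -comp_assoc gss. Qed.

Lemma gid2_t (X Y : gobj) (f : gmor X Y) : gt Y ∘ f ∘ gt X = gt Y ∘ f.
Proof. by rewrite gm_t -comp_assoc gtt. Qed.

Definition gid2 (X Y : gobj) (f : gmor X Y) : gcell X Y :=
  GCell (gid2_s f) (gid2_t f).

Section VComp.
Variables (X Y : gobj) (t u : gcell X Y) (H : gdom t = gcod u).

Lemma gvcomp_H1 : gs Y ∘ t = gs Y ∘ gdom t.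
Proof. by rewrite /= s_gdom. Qed.

Lemma gvcomp_H2 : gt Y ∘ gdom t = gt Y ∘ u.
Proof. by rewrite H /= t_gcod. Qed.

Definition gvcomp_mor : hom (gcar X) (gcar Y) :=
  proj1_sig (P1_ex (gP1 (g := Y)) gvcomp_H1 gvcomp_H2).

Lemma gvcomp_morE : V[gvcomp_mor] = p⟨V[t], V[gdom t], V[u]⟩.
Proof. exact: (proj2_sig (P1_ex (gP1 (g := Y)) gvcomp_H1 gvcomp_H2)). Qed.

Lemma s_gvcomp : gs Y ∘ gvcomp_mor = gs Y ∘ u.
Proof.
by apply: Vfaith; rewrite fhom_comp gvcomp_morE mal_nat -!fhom_comp gvcomp_H1
  mal_r.
Qed.

Lemma t_gvcomp : gt Y ∘ gvcomp_mor = gt Y ∘ t.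
Proof.
by apply: Vfaith; rewrite fhom_comp gvcomp_morE mal_nat -!fhom_comp gvcomp_H2
  mal_l.
Qed.

Lemma gvcomp_s : gs Y ∘ gvcomp_mor ∘ gs X = gs Y ∘ gvcomp_mor.
Proof. by rewrite s_gvcomp gc_s. Qed.

Lemma gvcomp_t : gt Y ∘ gvcomp_mor ∘ gt X = gt Y ∘ gvcomp_mor.
Proof. by rewrite t_gvcomp gc_t. Qed.

Definition gvcomp : gcell X Y := GCell gvcomp_s gvcomp_t.
End VComp.

Section Whisker.
Variables X Y Z : gobj.

Lemma glwhisk_s (h : gmor Y Z) (t : gcell X Y) :
  gs Z ∘ (h ∘ t) ∘ gs X = gs Z ∘ (h ∘ t).
Proof. by rewrite comp_assoc gm_s -!comp_assoc (comp_assoc (gs Y)) gc_s. Qed.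

Lemma glwhisk_t (h : gmor Y Z) (t : gcell X Y) :
  gt Z ∘ (h ∘ t) ∘ gt X = gt Z ∘ (h ∘ t).
Proof. by rewrite comp_assoc gm_t -!comp_assoc (comp_assoc (gt Y)) gc_t. Qed.

Definition glwhisk (h : gmor Y Z) (t : gcell X Y) : gcell X Z :=
  GCell (glwhisk_s h t) (glwhisk_t h t).

Lemma grwhisk_s (t : gcell Y Z) (h : gmor X Y) :
  gs Z ∘ (t ∘ h) ∘ gs X = gs Z ∘ (t ∘ h).
Proof. by rewrite -!comp_assoc -gm_s !comp_assoc gc_s. Qed.

Lemma grwhisk_t (t : gcell Y Z) (h : gmor X Y) :
  gt Z ∘ (t ∘ h) ∘ gt X = gt Z ∘ (t ∘ h).
Proof. by rewrite -!comp_assoc -gm_t !comp_assoc gc_t. Qed.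

Definition grwhisk (t : gcell Y Z) (h : gmor X Y) : gcell X Z :=
  GCell (grwhisk_s t h) (grwhisk_t t h).
End Whisker.

Lemma gdom_id2 (X Y : gobj) (f : gmor X Y) : gdom (gid2 f) = f.
Proof.
apply: gmor_ext; apply: Vfaith; rewrite [LHS]gdom_morE /=.
by rewrite gm_s -comp_assoc gst mal_r.
Qed.

Lemma gcod_id2 (X Y : gobj) (f : gmor X Y) : gcod (gid2 f) = f.
Proof.
apply: gmor_ext; apply: Vfaith; rewrite [LHS]gcod_morE /=.
by rewrite gm_t -comp_assoc gts mal_l.
Qed.

Lemma gdom_vcomp (X Y : gobj) (t u : gcell X Y) (H : gdom t = gcod u) :
  gdom (gvcomp H) = gdom u.
Proof.
apply: gmor_ext; apply: Vfaith; rewrite [LHS]gdom_morE [RHS]gdom_morE.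
rewrite [gc _]/= s_gvcomp [V[gvcomp_mor H ∘ _]]fhom_comp !gvcomp_morE.
set b := gs Y ∘ t ∘ gt X.
have Eb : b = gt Y ∘ gdom t by rewrite /b -t_gdom.
rewrite mal_comp -!fhom_comp.
have E : V[gs Y ∘ u ∘ gt X] = p⟨V[b], V[b], V[gs Y ∘ u ∘ gt X]⟩.
  by rewrite mal_r.
rewrite {1}E -mal_mal.
- by rewrite -(gdom_morE t) -[gdom_mor t]/(gm (gdom t)) -gm_t -Eb !mal_r.
- by rewrite /b !comp_assoc gss.
- by rewrite comp_assoc gc_t.
- by rewrite Eb gm_t.
- by rewrite -gm_t comp_assoc gtt.
- by rewrite !comp_assoc gss.
- by rewrite comp_assoc gc_t.
Qed.

Lemma gcod_vcomp (X Y : gobj) (t u : gcell X Y) (H : gdom t = gcod u) :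
  gcod (gvcomp H) = gcod t.
Proof.
apply: gmor_ext; apply: Vfaith; rewrite [LHS]gcod_morE [RHS]gcod_morE.
rewrite [gc _]/= t_gvcomp [V[gvcomp_mor H ∘ _]]fhom_comp !gvcomp_morE.
set b := gt Y ∘ u ∘ gs X.
have Eb : b = gs Y ∘ gdom t by rewrite /b H -s_gcod.
rewrite mal_comp -!fhom_comp.
have E : V[gt Y ∘ t ∘ gs X] = p⟨V[gt Y ∘ t ∘ gs X], V[b], V[b]⟩.
  by rewrite mal_l.
rewrite {1}E -mal_mal.
- by rewrite -(gcod_morE u) -[gcod_mor u]/(gm (gcod u)) -H -gm_s -Eb !mal_l.
- by rewrite comp_assoc gc_s.
- by rewrite !comp_assoc gtt.
- by rewrite -gm_s comp_assoc gss.
- by rewrite Eb gm_s.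
- by rewrite comp_assoc gc_s.
- by rewrite /b !comp_assoc gtt.
Qed.

Lemma gvcomp_idl (X Y : gobj) (f : gmor X Y) (t : gcell X Y)
  (H : gdom (gid2 f) = gcod t) : gvcomp H = t.
Proof.
apply: gcell_ext; apply: Vfaith; rewrite [LHS]gvcomp_morE.
by rewrite gdom_id2 mal_r.
Qed.

Lemma gvcomp_idr (X Y : gobj) (f : gmor X Y) (t : gcell X Y)
  (H : gdom t = gcod (gid2 f)) : gvcomp H = t.
Proof.
apply: gcell_ext; apply: Vfaith; rewrite [LHS]gvcomp_morE.
by rewrite H gcod_id2 mal_l.
Qed.

Lemma gvcomp_assoc (X Y : gobj) (t u v : gcell X Y)
    (H1 : gdom u = gcod v) (H2 : gdom t = gcod (gvcomp H1))
    (H3 : gdom t = gcod u) (H4 : gdom (gvcomp H3) = gcod v) :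
  gvcomp H2 = gvcomp H4.
Proof.
apply: gcell_ext; apply: Vfaith; rewrite [LHS]gvcomp_morE [RHS]gvcomp_morE.
rewrite gdom_vcomp [gc _]/= [gc (gvcomp H3)]/= !gvcomp_morE.
set b := gt Y ∘ gdom u.
have Hb1 : gt Y ∘ b = gt Y ∘ gdom u by rewrite /b comp_assoc gtt.
have Hb2 : gt Y ∘ b = gt Y ∘ v by rewrite Hb1 (gvcomp_H2 H1).
have := mal_mal (gvcomp_H1 t) (gvcomp_H2 H3) (eq_refl (gs Y ∘ b)) Hb1
  (eq_refl (gs Y ∘ b)) Hb2.
by rewrite !mal_l !mal_r.
Qed.

Section DomWhisker.
Variables X Y Z : gobj.

Lemma gdom_lwhisk (h : gmor Y Z) (t : gcell X Y) :
  gdom (glwhisk h t) = gcomp h (gdom t).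
Proof.
apply: gmor_ext; apply: Vfaith; rewrite [LHS]gdom_morE [RHS]fhom_comp.
rewrite [V[gdom t]]gdom_morE mal_nat -!fhom_comp /=.
by rewrite !comp_assoc gm_s.
Qed.

Lemma gcod_lwhisk (h : gmor Y Z) (t : gcell X Y) :
  gcod (glwhisk h t) = gcomp h (gcod t).
Proof.
apply: gmor_ext; apply: Vfaith; rewrite [LHS]gcod_morE [RHS]fhom_comp.
rewrite [V[gcod t]]gcod_morE mal_nat -!fhom_comp /=.
by rewrite !comp_assoc gm_t.
Qed.

Lemma gdom_rwhisk (t : gcell Y Z) (h : gmor X Y) :
  gdom (grwhisk t h) = gcomp (gdom t) h.
Proof.
apply: gmor_ext; apply: Vfaith; rewrite [LHS]gdom_morE [RHS]fhom_comp.
rewrite [V[gdom t]]gdom_morE mal_comp -!fhom_comp /=.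
by rewrite -!comp_assoc gm_t.
Qed.

Lemma gcod_rwhisk (t : gcell Y Z) (h : gmor X Y) :
  gcod (grwhisk t h) = gcomp (gcod t) h.
Proof.
apply: gmor_ext; apply: Vfaith; rewrite [LHS]gcod_morE [RHS]fhom_comp.
rewrite [V[gcod t]]gcod_morE mal_comp -!fhom_comp /=.
by rewrite -!comp_assoc gm_s.
Qed.
End DomWhisker.

Section Interchange.
Variables (X Y Z : gobj) (t : gcell Y Z) (u : gcell X Y).

Lemma ginterchange_l (H : gdom (glwhisk (gcod t) u) =
    gcod (grwhisk t (gdom u))) : gc (gvcomp H) = t ∘ u.
Proof.
apply: Vfaith; rewrite [LHS]gvcomp_morE.
rewrite gdom_lwhisk [gm (gcomp _ _)]/=.
rewrite [gc _]/= [gc (grwhisk _ _)]/=.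
rewrite [V[gcod t ∘ u]]fhom_comp [V[gcod t ∘ gdom u]]fhom_comp.
rewrite [V[gcod t]]gcod_morE.
rewrite !mal_comp -!fhom_comp.
set b := gs Z ∘ (t ∘ gdom u).
have Hb : gs Z ∘ (t ∘ gdom u) = gs Z ∘ b by rewrite /b !comp_assoc gss.
have E : V[t ∘ gdom u] = p⟨V[t ∘ gdom u], V[b], V[b]⟩ by rewrite mal_l.
rewrite [X in p⟨_, _, X⟩]E mal_mal //.
- have -> : t ∘ gs Y ∘ gdom u = t ∘ gs Y ∘ u.
    by rewrite -!comp_assoc s_gdom.
  have -> : gt Z ∘ t ∘ gs Y ∘ gdom u = gt Z ∘ t ∘ gs Y ∘ u.
    by rewrite -!comp_assoc s_gdom.
  by rewrite mal_l !mal_r mal_l.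
- by rewrite !comp_assoc gc_s.
- by rewrite !comp_assoc gtt.
- by rewrite !comp_assoc gc_s.
- by rewrite !comp_assoc gtt.
Qed.

Lemma ginterchange_r (H : gdom (grwhisk t (gcod u)) =
    gcod (glwhisk (gdom t) u)) : gc (gvcomp H) = t ∘ u.
Proof.
apply: Vfaith; rewrite [LHS]gvcomp_morE.
rewrite gdom_rwhisk [gm (gcomp _ _)]/=.
rewrite [gc _]/= [gc (glwhisk _ _)]/=.
rewrite [V[gdom t ∘ u]]fhom_comp [V[gdom t ∘ gcod u]]fhom_comp.
rewrite [V[gdom t]]gdom_morE.
rewrite !mal_comp -!fhom_comp.
set b := gt Z ∘ (t ∘ gcod u).
have Hb : gt Z ∘ b = gt Z ∘ (t ∘ gcod u) by rewrite /b !comp_assoc gtt.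
have E : V[t ∘ gcod u] = p⟨V[b], V[b], V[t ∘ gcod u]⟩ by rewrite mal_r.
rewrite [X in p⟨X, _, _⟩]E mal_mal //.
- have -> : t ∘ gt Y ∘ gcod u = t ∘ gt Y ∘ u.
    by rewrite -!comp_assoc t_gcod.
  have -> : gs Z ∘ t ∘ gt Y ∘ gcod u = gs Z ∘ t ∘ gt Y ∘ u.
    by rewrite -!comp_assoc t_gcod.
  by rewrite !mal_l !mal_r.
- by rewrite !comp_assoc gss.
- by rewrite !comp_assoc gc_t.
- by rewrite !comp_assoc gss.
- by rewrite !comp_assoc gc_t.
Qed.
End Interchange.

Lemma glwhisk_vcomp (X Y Z : gobj) (h : gmor Y Z) (t u : gcell X Y)
    (H : gdom t = gcod u) (H' : gdom (glwhisk h t) = gcod (glwhisk h u)) :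
  glwhisk h (gvcomp H) = gvcomp H'.
Proof.
apply: gcell_ext; apply: Vfaith; rewrite [LHS]fhom_comp [RHS]gvcomp_morE.
by rewrite [V[gc (gvcomp H)]]gvcomp_morE mal_nat -!fhom_comp gdom_lwhisk.
Qed.

Lemma grwhisk_vcomp (X Y Z : gobj) (t u : gcell Y Z) (h : gmor X Y)
    (H : gdom t = gcod u) (H' : gdom (grwhisk t h) = gcod (grwhisk u h)) :
  grwhisk (gvcomp H) h = gvcomp H'.
Proof.
apply: gcell_ext; apply: Vfaith; rewrite [LHS]fhom_comp [RHS]gvcomp_morE.
by rewrite [V[gc (gvcomp H)]]gvcomp_morE mal_comp -!fhom_comp gdom_rwhisk.
Qed.

Definition gstar : two_category.
Proof.
refine (@TwoCategory gcat gcell gdom gcod gid2 gvcomp glwhisk grwhisk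
  gdom_id2 gcod_id2 gdom_vcomp gcod_vcomp
  gdom_lwhisk gcod_lwhisk gdom_rwhisk gcod_rwhisk
  gvcomp_idl gvcomp_idr gvcomp_assoc _ _ _ _ _ _ _
  glwhisk_vcomp grwhisk_vcomp _) => /=.
- by move=> *; apply: gcell_ext; apply: comp_idl.
- by move=> *; apply: gcell_ext; apply: comp_idr.
- by move=> *; apply: gcell_ext; rewrite /= comp_assoc.
- by move=> *; apply: gcell_ext; rewrite /= comp_assoc.
- by move=> *; apply: gcell_ext; rewrite /= comp_assoc.
- by move=> *; apply: gcell_ext.
- by move=> *; apply: gcell_ext.
- move=> X Y Z t u H H'; apply: gcell_ext.
  by rewrite ginterchange_l ginterchange_r.
Defined.

Section GPullback.
Variables (X Y Z : gobj) (f : gmor X Z) (g : gmor Y Z).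

Local Notation P := (pb LA f g).
Local Notation q1 := (pb1 LA f g).
Local Notation q2 := (pb2 LA f g).

Lemma gpb_s_proof : f ∘ (gs X ∘ q1) = g ∘ (gs Y ∘ q2).
Proof.
by rewrite !comp_assoc -!gm_s -!comp_assoc; congr (_ ∘ _); apply: pb_comm.
Qed.

Lemma gpb_t_proof : f ∘ (gt X ∘ q1) = g ∘ (gt Y ∘ q2).
Proof.
by rewrite !comp_assoc -!gm_t -!comp_assoc; congr (_ ∘ _); apply: pb_comm.
Qed.

Definition gpb_s : hom P P := pb_pair LA gpb_s_proof.
Definition gpb_t : hom P P := pb_pair LA gpb_t_proof.

Lemma q1_s : q1 ∘ gpb_s = gs X ∘ q1. Proof. exact: pb1_pair. Qed.
Lemma q2_s : q2 ∘ gpb_s = gs Y ∘ q2. Proof. exact: pb2_pair. Qed.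
Lemma q1_t : q1 ∘ gpb_t = gt X ∘ q1. Proof. exact: pb1_pair. Qed.
Lemma q2_t : q2 ∘ gpb_t = gt Y ∘ q2. Proof. exact: pb2_pair. Qed.

Lemma gpb_st : gpb_s ∘ gpb_t = gpb_t.
Proof.
apply: (pb_ext LA); rewrite comp_assoc ?q1_s ?q2_s -comp_assoc ?q1_t ?q2_t.
  by rewrite comp_assoc gst.
by rewrite comp_assoc gst.
Qed.

Lemma gpb_ts : gpb_t ∘ gpb_s = gpb_s.
Proof.
apply: (pb_ext LA); rewrite comp_assoc ?q1_t ?q2_t -comp_assoc ?q1_s ?q2_s.
  by rewrite comp_assoc gts.
by rewrite comp_assoc gts.
Qed.

Lemma Vpb_ext (T : B) (h k : hom T (V P)) :
  V[q1] ∘ h = V[q1] ∘ k -> V[q2] ∘ h = V[q2] ∘ k -> h = k.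
Proof.
move=> H1 H2.
have Ppb : is_pullback f g q1 q2.
  split=> [|T' x y E]; first exact: pb_comm.
  exists (pb_pair LA E); split=> [|r [Hr1 Hr2]].
    by rewrite pb1_pair pb2_pair.
  by apply: (pb_ext LA); rewrite ?pb1_pair ?pb2_pair ?Hr1 ?Hr2.
have [E Huniv] := proj2 Vlim _ _ _ _ _ _ _ _ Ppb.
have Ek : V[f] ∘ (V[q1] ∘ k) = V[g] ∘ (V[q2] ∘ k) by rewrite !comp_assoc E.
have [r [_ Hr]] := Huniv _ _ _ Ek.
by rewrite -(Hr h) // -(Hr k).
Qed.

Lemma gpb_P1 : P1 gpb_s gpb_t.
Proof.
apply: P1_intro => T a b c Hs Ht.
have Hs1 : gs X ∘ (q1 ∘ a) = gs X ∘ (q1 ∘ b).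
  by rewrite !comp_assoc -q1_s -!comp_assoc Hs.
have Hs2 : gs Y ∘ (q2 ∘ a) = gs Y ∘ (q2 ∘ b).
  by rewrite !comp_assoc -q2_s -!comp_assoc Hs.
have Ht1 : gt X ∘ (q1 ∘ b) = gt X ∘ (q1 ∘ c).
  by rewrite !comp_assoc -q1_t -!comp_assoc Ht.
have Ht2 : gt Y ∘ (q2 ∘ b) = gt Y ∘ (q2 ∘ c).
  by rewrite !comp_assoc -q2_t -!comp_assoc Ht.
have [h1 E1] := P1_ex (gP1 (g := X)) Hs1 Ht1.
have [h2 E2] := P1_ex (gP1 (g := Y)) Hs2 Ht2.
have E : f ∘ h1 = g ∘ h2.
  apply: Vfaith; rewrite !fhom_comp E1 E2 !mal_nat -!fhom_comp !comp_assoc.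
  by rewrite pb_comm.
exists (pb_pair LA E); apply: Vpb_ext.
  by rewrite -fhom_comp pb1_pair E1 mal_nat -!fhom_comp.
by rewrite -fhom_comp pb2_pair E2 mal_nat -!fhom_comp.
Qed.

Definition gpb : gobj := GObj gpb_st gpb_ts gpb_P1.

Definition gpb1 : gmor gpb X :=
  @GMor gpb X q1 (eq_sym q1_s) (eq_sym q1_t).
Definition gpb2 : gmor gpb Y :=
  @GMor gpb Y q2 (eq_sym q2_s) (eq_sym q2_t).

Lemma gpb_comm : gcomp f gpb1 = gcomp g gpb2.
Proof. by apply: gmor_ext; apply: pb_comm. Qed.

Section Pair.
Variables (T : gobj) (x : gmor T X) (y : gmor T Y).
Hypothesis H : gcomp f x = gcomp g y.

Lemma gpair_proof : f ∘ x = g ∘ y.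
Proof. exact: (f_equal (@gm _ _) H). Qed.

Lemma gpair_s :
  gs gpb ∘ pb_pair LA gpair_proof = pb_pair LA gpair_proof ∘ gs T.
Proof.
apply: (pb_ext LA); rewrite !comp_assoc /= ?pb1_pair ?pb2_pair -comp_assoc.
  by rewrite pb1_pair gm_s.
by rewrite pb2_pair gm_s.
Qed.

Lemma gpair_t :
  gt gpb ∘ pb_pair LA gpair_proof = pb_pair LA gpair_proof ∘ gt T.
Proof.
apply: (pb_ext LA); rewrite !comp_assoc /= ?pb1_pair ?pb2_pair -comp_assoc.
  by rewrite pb1_pair gm_t.
by rewrite pb2_pair gm_t.
Qed.

Definition gpair : gmor T gpb := @GMor T gpb _ gpair_s gpair_t.
End Pair.

Section PairCell.
Variables (T : gobj) (x : gcell T X) (y : gcell T Y).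
Hypothesis H : glwhisk f x = glwhisk g y.

Lemma gpair_cell_proof : f ∘ x = g ∘ y.
Proof. exact: (f_equal (@gc _ _) H). Qed.

Lemma gpair_cell_s :
  gs gpb ∘ pb_pair LA gpair_cell_proof ∘ gs T =
  gs gpb ∘ pb_pair LA gpair_cell_proof.
Proof.
apply: (pb_ext LA); rewrite !comp_assoc /= ?pb1_pair ?pb2_pair.
  by rewrite -(comp_assoc (gs X) q1) pb1_pair gc_s.
by rewrite -(comp_assoc (gs Y) q2) pb2_pair gc_s.
Qed.

Lemma gpair_cell_t :
  gt gpb ∘ pb_pair LA gpair_cell_proof ∘ gt T =
  gt gpb ∘ pb_pair LA gpair_cell_proof.
Proof.
apply: (pb_ext LA); rewrite !comp_assoc /= ?pb1_pair ?pb2_pair.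
  by rewrite -(comp_assoc (gt X) q1) pb1_pair gc_t.
by rewrite -(comp_assoc (gt Y) q2) pb2_pair gc_t.
Qed.

Definition gpair_cell : gcell T gpb := @GCell T gpb _ gpair_cell_s gpair_cell_t.
End PairCell.
End GPullback.

Definition gpullbacks : pullbacks gcat.
Proof.
refine (@Pullbacks gcat gpb gpb1 gpb2 gpb_comm gpair _ _ _).
- by move=> *; apply: gmor_ext; apply: pb1_pair.
- by move=> *; apply: gmor_ext; apply: pb2_pair.
- move=> X Y Z f g T h k /(f_equal (@gm _ _)) H1 /(f_equal (@gm _ _)) H2.
  by apply: gmor_ext; apply: (pb_ext LA).
Defined.

Definition gstar_pullbacks : two_pullbacks gstar.
Proof.
refine (@TwoPullbacks gstar gpullbacks gpair_cell _ _ _).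
- by move=> *; apply: gcell_ext; apply: pb1_pair.
- by move=> *; apply: gcell_ext; apply: pb2_pair.
- move=> X Y Z f g T h k /(f_equal (@gc _ _)) H1 /(f_equal (@gc _ _)) H2.
  by apply: gcell_ext; apply: (pb_ext LA).
Defined.

End GStar.

(** * Internal bicategories and the diagrams determining them *)

Section Bicategory.
Variables (A B : category) (LA : finite_limits A) (LB : finite_limits B).
Variables (V : functor A B) (p : maltsev_op LB V).
Variables (Vfaith : faithful V) (Vlim : preserves_finite_limits V).

Local Notation "'V[' f ]" := (fhom V f) (format "V[ f ]").
Local Notation "p⟨ x , y , z ⟩" := (mal p x y z).
Local Notation GA := (gstar_pullbacks LA p Vfaith Vlim).

Definition discrete (X : gobj p) : Prop :=
  gs X = idm (gcar X) /\ gt X = idm (gcar X).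

Record internal_bicategory := InternalBicategory {
  ib_ps :> pseudocategory GA;
  ib_homogeneous : homogeneous ib_ps;
  ib_discrete : discrete (pc0 ib_ps)
}.

Record diagram := Diagram {
  dgA : A;
  dgB : A;
  dgd : hom dgA dgB;
  dgc : hom dgA dgB;
  dge : hom dgB dgA;
  dgs : hom dgA dgA;
  dgt : hom dgA dgA;
  dgl : hom dgA dgA;
  dgr : hom dgA dgA
}.

Definition diagram_of (C : internal_bicategory) : diagram :=
  @Diagram (gcar (pc1 C)) (gcar (pc0 C)) (gm (pcd C)) (gm (pcc C)) (gm (pce C))
    (gs (pc1 C)) (gt (pc1 C)) (gc (pc_lunit C)) (gc (pc_runit C)).

Section Conditions.
Variable D : diagram.

Local Notation d := (dgd D).
Local Notation c := (dgc D).
Local Notation e := (dge D).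
Local Notation s := (dgs D).
Local Notation t := (dgt D).
Local Notation λ := (dgl D).
Local Notation ρ := (dgr D).

Definition dg2 : A := pb LA d c.
Definition dg2_1 : hom dg2 (dgA D) := pb1 LA d c.
Definition dg2_2 : hom dg2 (dgA D) := pb2 LA d c.

Definition dg3 : A := pb LA d (c ∘ dg2_1).
Definition dg3_1 : hom dg3 (dgA D) := pb1 LA d (c ∘ dg2_1).
Definition dg3_23 : hom dg3 dg2 := pb2 LA d (c ∘ dg2_1).

Definition is_u (u : hom (dgA D) (dgA D)) : Prop :=
  V[u] = p⟨V[s ∘ ρ ∘ t], V[ρ ∘ t], V[ρ]⟩.

Definition is_v (v : hom (dgA D) (dgA D)) : Prop :=
  V[v] = p⟨V[s ∘ λ ∘ t], V[λ ∘ t], V[λ]⟩.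

Definition is_alpha1 (a1 : hom (dgA D) (dgA D)) : Prop :=
  V[a1] = p⟨V[s ∘ ρ ∘ ρ ∘ t], V[ρ ∘ s ∘ ρ ∘ t],
            p⟨V[s ∘ ρ ∘ t], V[ρ ∘ t], V[ρ]⟩⟩.

(** [a1], [a2], [a3] are the restrictions of the associator along the three
    inclusions of [A] into [A ×_B (A ×_B A)].  In particular [a2] goes from
    [1⊗(x⊗1)] to [(1⊗y)⊗1] for a 2-cell [x → y]: it is [λ∘ρ] followed by the
    inverse of [λ] at [y] (the inner [p⟨…⟩]), then by the inverse of [ρ] at
    [1⊗y]. *)
Definition is_alpha2 (a2 : hom (dgA D) (dgA D)) : Prop :=
  V[a2] = p⟨V[s ∘ ρ ∘ λ ∘ t], V[ρ ∘ s ∘ λ ∘ t],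
            p⟨V[s ∘ λ ∘ t], V[λ ∘ t], V[λ ∘ ρ]⟩⟩.

Definition is_alpha3 (a3 : hom (dgA D) (dgA D)) : Prop :=
  V[a3] = p⟨V[λ ∘ s ∘ λ ∘ t], V[λ ∘ λ ∘ t], V[λ ∘ λ]⟩.

Definition is_m (m : hom dg2 (dgA D)) : Prop :=
  exists u v : hom (dgA D) (dgA D), is_u u /\ is_v v /\
    V[m] = p⟨V[u ∘ dg2_1], V[e ∘ d ∘ dg2_1], V[v ∘ dg2_2]⟩.

Definition is_mu (mu : hom dg2 (dgA D)) : Prop :=
  exists a2 a3 : hom (dgA D) (dgA D), is_alpha2 a2 /\ is_alpha3 a3 /\
    V[mu] = p⟨V[a2 ∘ dg2_1], V[e ∘ d ∘ dg2_1], V[a3 ∘ dg2_2]⟩.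

Definition is_theta (theta : hom dg3 (dgA D)) : Prop :=
  exists (a1 : hom (dgA D) (dgA D)) (mu : hom dg2 (dgA D)),
    is_alpha1 a1 /\ is_mu mu /\
    V[theta] = p⟨V[a1 ∘ dg3_1], V[e ∘ d ∘ dg3_1], V[mu ∘ dg3_23]⟩.

Definition P2 : Prop := exists m mu : hom dg2 (dgA D), is_m m /\ is_mu mu.

Definition P3 : Prop := exists theta : hom dg3 (dgA D), is_theta theta.

Record bicategory_diagram : Prop := BicategoryDiagram {
  bd_de : d ∘ e = idm (dgB D);
  bd_ce : c ∘ e = idm (dgB D);
  bd_st : s ∘ t = t;
  bd_ts : t ∘ s = s;
  bd_ds : d ∘ s = d;
  bd_dt : d ∘ t = d;
  bd_cs : c ∘ s = c;
  bd_ct : c ∘ t = c;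
  bd_se : s ∘ e = e;
  bd_te : t ∘ e = e;
  bd_dl : d ∘ λ = d;
  bd_dr : d ∘ ρ = d;
  bd_cl : c ∘ λ = c;
  bd_cr : c ∘ ρ = c;
  bd_le : λ ∘ e = e;
  bd_re : ρ ∘ e = e;
  bd_codl : p⟨V[λ], V[λ ∘ s], V[t ∘ λ ∘ s]⟩ = idm (V (dgA D));
  bd_codr : p⟨V[ρ], V[ρ ∘ s], V[t ∘ ρ ∘ s]⟩ = idm (V (dgA D));
  bd_P1 : P1 p s t;
  bd_P2 : P2;
  bd_P3 : P3
}.

End Conditions.
End Bicategory.

(* Main.v *)
From Stdlib Require Import ssreflect ProofIrrelevance Eqdep.
Require Import Defs.

Set Implicit Arguments.
Unset Strict Implicit.
Unset Printing Implicit Defensive.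

Local Open Scope cat_scope.

(** Think of an arrow of the groupoid [(A,s,t)] as a generalized element
    [x : T → V A], on which morphisms of the base category act by
    [f • x = V f ∘ x].  By (P1) the operation [p⟨a,b,c⟩] is the composite
    [a b⁻¹ c] whenever [s a = s b] and [t b = t c] ([elt_mal_mal]), and since
    [p] is natural every morphism commutes with it.  All formulas of a diagram
    thus become formulas of groupoid calculus.

    The notion on which the proof turns is that of a contraction: an
    endofunctor [f] of the groupoid with a natural isomorphism [k : f ⇒ 1].
    Both [λ] and [ρ] are the [k] of contractions, on the functors
    [v = 1 ⊗ -] and [u = - ⊗ 1].  Contractions compose, and between two of them
    there is exactly one 2-cell compatible with the contractions, the canonical
    cell [p⟨g,kg,kf⟩ = g kg⁻¹ kf].  Canonical cells are closed under vertical
    composition and under whiskering ([can_vcomp], [can_lwhisk],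
    [can_rwhisk]), so every diagram made of them commutes.  The formulas for
    [α1], [α2], [α3] are those of the canonical cells [u ⇒ uu], [vu ⇒ uv] and
    [vv ⇒ v] ([alpha1E], [alpha2E], [alpha3E]).

    From a bicategory to its diagram.  The restrictions of the associator along
    [x ↦ (x,1,1)], [(1,x,1)], [(1,1,x)] must be canonical.  For the first and
    the third this is the triangle at [(x,1)] and at [(1,x)]; for the second,
    as in Kelly's reduction of the coherence axioms, it is the pentagon at
    [(1,1,x,1)] after cancelling the faithful functor [v]
    ([pentagon_determines_2]).  In a pullback of split epimorphisms one has
    [(x,y) = p⟨(x,1),(1,1),(1,y)⟩], so that [m] and [θ] are computed from these
    restrictions ([split_decomp]); this is (P2) and (P3).

    From a diagram to a bicategory.  By the weak Mal'tsev property, morphisms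
    out of the iterated pullbacks are equal when they agree on tuples having
    units in all places but one ([wm2], [wm3], [wm_pcs4]).  Functoriality of
    [m], the domain and codomain of [θ], the triangle and the pentagon are
    therefore reduced to identities between composites of [u], [v] and
    canonical cells.  There remains to see that [λ] and [ρ] are 2-cells at all,
    since [sλs = sλ] and [sρs = sρ] are not among the equations of a diagram.
    They hold because [m], [μ] and [θ], being morphisms, commute with [p] on
    triples that are not composable: [p⟨x, s x, e b⟩] carries an arrow [x] to
    one that starts at a unit, where [λ] and [ρ] are known ([lam_s], [rho_s]).

    Uniqueness.  As [V] is faithful, the formulas determine [m] and [θ]; the
    other constituents of a bicategory belong to its diagram or are proofs
    ([diagram_of_inj]). *)

(** * Generalized elements *)

Section Elements.
Variables (A B : category) (LA : finite_limits A) (LB : finite_limits B).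
Variables (V : functor A B) (p : maltsev_op LB V).
Variables (Vfaith : faithful V) (Vlim : preserves_finite_limits V).

Local Notation "'V[' f ]" := (fhom V f) (format "V[ f ]").
Local Notation "p⟨ x , y , z ⟩" := (mal p x y z).
Local Notation "f • x" := (fhom V f ∘ x) (at level 39, right associativity).

Lemma act_comp (X Y Z : A) (g : hom Y Z) (f : hom X Y) (T : B)
  (x : hom T (V X)) : (g ∘ f) • x = g • f • x.
Proof. by rewrite fhom_comp comp_assoc. Qed.

Lemma act_id (X : A) (T : B) (x : hom T (V X)) : idm X • x = x.
Proof. by rewrite fhom_id comp_idl. Qed.

Lemma V_ext (X Y : B) (f g : hom X Y) :
  (forall (T : B) (x : hom T X), f ∘ x = g ∘ x) -> f = g.
Proof. by move=> H; move: (H _ (idm _)); rewrite !comp_idr. Qed.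

Lemma act_faithful (X Y : A) (f g : hom X Y) :
  (forall (T : B) (x : hom T (V X)), f • x = g • x) -> f = g.
Proof.
by move=> H; apply/Vfaith/V_ext.
Qed.

Section Pullback.
Variables (X Y Z : A) (f : hom X Z) (g : hom Y Z).

Lemma pb_is_pullback : is_pullback f g (pb1 LA f g) (pb2 LA f g).
Proof.
split=> [|T x y E]; first exact: pb_comm.
exists (pb_pair LA E); split=> [|r [Hr1 Hr2]].
  by rewrite pb1_pair pb2_pair.
by apply: (pb_ext LA); rewrite ?pb1_pair ?pb2_pair ?Hr1 ?Hr2.
Qed.

Lemma elt_pair (T : B) (x : hom T (V X)) (y : hom T (V Y)) :
  f • x = g • y ->
  exists r : hom T (V (pb LA f g)), pb1 LA f g • r = x /\ pb2 LA f g • r = y.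
Proof.
have [_ U] := proj2 Vlim _ _ _ _ _ _ _ _ pb_is_pullback.
by move=> /U [r [Hr _]]; exists r.
Qed.

Lemma elt_pair_ext (T : B) (h k : hom T (V (pb LA f g))) :
  pb1 LA f g • h = pb1 LA f g • k -> pb2 LA f g • h = pb2 LA f g • k -> h = k.
Proof.
move=> H1 H2.
have [E U] := proj2 Vlim _ _ _ _ _ _ _ _ pb_is_pullback.
have Ek : f • (pb1 LA f g • k) = g • (pb2 LA f g • k).
  by rewrite !comp_assoc E.
have [r [_ Hr]] := U _ _ _ Ek.
by rewrite -(Hr h) // -(Hr k).
Qed.

(** [F] is the effect of [m] on pairs of elements, and [m] commutes with [p].
    No composability is asked of the triples [x1,x2,x3] and [y1,y2,y3]: for
    formulas [F] built from [p] this is a genuine condition, and it is what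
    the existence of [m], [μ] and [θ] as morphisms amounts to. *)
Lemma cooperate (W : A) (m : hom (pb LA f g) W)
    (F : forall T : B, hom T (V X) -> hom T (V Y) -> hom T (V W)) :
  (forall (T : B) (r : hom T (V (pb LA f g))),
     m • r = F T (pb1 LA f g • r) (pb2 LA f g • r)) ->
  forall (T : B) (x1 x2 x3 : hom T (V X)) (y1 y2 y3 : hom T (V Y)),
  f • x1 = g • y1 -> f • x2 = g • y2 -> f • x3 = g • y3 ->
  p⟨F T x1 y1, F T x2 y2, F T x3 y3⟩ = F T p⟨x1, x2, x3⟩ p⟨y1, y2, y3⟩.
Proof.
move=> HF T x1 x2 x3 y1 y2 y3.
move=> /elt_pair [r1 [<- <-]] /elt_pair [r2 [<- <-]] /elt_pair [r3 [<- <-]].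
by rewrite -!HF -!mal_nat -HF.
Qed.
End Pullback.

(** * The groupoid calculus *)

Section Groupoid.
Variables (X : A) (s t : hom X X) (HP1 : P1 p s t).

(** There is a universal composable triple [(a,b,c)], on an iterated pullback of
    [s] and [t].  Its composite is a morphism by (P1), hence commutes with
    [p]. *)
Lemma elt_mal_mal (T : B) (a1 b1 c1 a2 b2 c2 a3 b3 c3 : hom T (V X)) :
  s • a1 = s • b1 -> t • b1 = t • c1 ->
  s • a2 = s • b2 -> t • b2 = t • c2 ->
  s • a3 = s • b3 -> t • b3 = t • c3 ->
  p⟨p⟨a1, b1, c1⟩, p⟨a2, b2, c2⟩, p⟨a3, b3, c3⟩⟩ =
  p⟨p⟨a1, a2, a3⟩, p⟨b1, b2, b3⟩, p⟨c1, c2, c3⟩⟩.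
Proof.
pose P := pb LA s s; pose Q := pb LA (t ∘ pb2 LA s s) t.
pose a : hom Q X := pb1 LA s s ∘ pb1 LA _ _.
pose b : hom Q X := pb2 LA s s ∘ pb1 LA _ _.
pose c : hom Q X := pb2 LA (t ∘ pb2 LA s s) t.
have Hs : s ∘ a = s ∘ b by rewrite /a /b !comp_assoc (pb_comm LA).
have Ht : t ∘ b = t ∘ c by rewrite /b /c comp_assoc (pb_comm LA).
have [f Hf] := P1_ex HP1 Hs Ht.
have key (x y z : hom T (V X)) : s • x = s • y -> t • y = t • z ->
    exists r : hom T (V Q), a • r = x /\ b • r = y /\ c • r = z.
  move=> /elt_pair [q [<- <-]]; rewrite -act_comp => /elt_pair [r [<- <-]].
  by exists r; rewrite !act_comp.
move=> s1 t1 s2 t2 s3 t3.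
have [r1 [<- [<- <-]]] := key _ _ _ s1 t1.
have [r2 [<- [<- <-]]] := key _ _ _ s2 t2.
have [r3 [<- [<- <-]]] := key _ _ _ s3 t3.
by rewrite -!mal_comp -!mal_nat -mal_comp -Hf mal_nat.
Qed.

(** Reading [p⟨a,b,c⟩] as [a b⁻¹ c], this is
    [g (k m⁻¹ x)⁻¹ (k m⁻¹ y) = g x⁻¹ y].  Here and below, one entry is written
    as a degenerate [p] and [elt_mal_mal] moves the cancelling entries
    together. *)
Lemma mal_cancel_l (T : B) (g k m x y : hom T (V X)) :
  s • k = s • m -> t • m = t • x -> t • m = t • y ->
  p⟨g, p⟨k, m, x⟩, p⟨k, m, y⟩⟩ = p⟨g, x, y⟩.
Proof.
move=> H1 H2 H3.
by rewrite -{1}(mal_l p g g) elt_mal_mal // !mal_l mal_r.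
Qed.

Lemma mal_cancel_r (T : B) (g k m x y : hom T (V X)) :
  s • x = s • m -> s • y = s • m -> t • m = t • k ->
  p⟨p⟨x, m, k⟩, p⟨y, m, k⟩, g⟩ = p⟨x, y, g⟩.
Proof.
move=> H1 H2 H3.
by rewrite -{1}(mal_l p g g) elt_mal_mal // !mal_r mal_l.
Qed.

Lemma mal_chain (T : B) (g h k x y : hom T (V X)) :
  s • h = s • k -> t • k = t • x -> s • g = s • x -> t • x = t • y ->
  p⟨p⟨h, k, x⟩, g, p⟨g, x, y⟩⟩ = p⟨h, k, y⟩.
Proof.
move=> H1 H2 H3 H4.
by rewrite -{1}(mal_l p g x) elt_mal_mal // !mal_l mal_r.
Qed.

Lemma mal_solve_l (T : B) (k m x : hom T (V X)) :
  s • k = s • m -> t • k = t • x -> p⟨k, m, p⟨m, k, x⟩⟩ = x.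
Proof.
by move=> H1 H2; rewrite -{1}(mal_l p k k) mal_chain // mal_r.
Qed.

Lemma mal_solve_r (T : B) (k m x : hom T (V X)) :
  s • x = s • m -> t • m = t • k -> p⟨p⟨x, m, k⟩, k, m⟩ = x.
Proof.
by move=> H1 H2; rewrite -{2}(mal_r p k m) mal_cancel_r // mal_l.
Qed.

End Groupoid.

(** * The unit isomorphisms are 2-cells *)

Section UnitCells.
Variables (D : diagram A) (HD : bicategory_diagram LA p D).

Local Notation d := (dgd D).
Local Notation c := (dgc D).
Local Notation e := (dge D).
Local Notation s := (dgs D).
Local Notation t := (dgt D).
Local Notation λ := (dgl D).
Local Notation ρ := (dgr D).
Local Notation elt T := (hom T (V (dgA D))).

Lemma act_rel (X Y Z : A) (f : hom Y Z) (g : hom X Y) (h : hom X Z) (T : B)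
  (x : hom T (V X)) : f ∘ g = h -> f • g • x = h • x.
Proof. by move=> <-; rewrite act_comp. Qed.

Let ss : s ∘ s = s.
Proof. by rewrite -{2}(bd_ts HD) comp_assoc (bd_st HD) (bd_ts HD). Qed.

Let tt : t ∘ t = t.
Proof. by rewrite -{2}(bd_st HD) comp_assoc (bd_ts HD) (bd_st HD). Qed.

Let es (T : B) (x : elt T) : s • s • x = s • x.
Proof. exact: act_rel. Qed.
Let et (T : B) (x : elt T) : t • t • x = t • x.
Proof. exact: act_rel. Qed.
Let est (T : B) (x : elt T) : s • t • x = t • x.
Proof. exact/act_rel/(bd_st HD). Qed.
Let ets (T : B) (x : elt T) : t • s • x = s • x.
Proof. exact/act_rel/(bd_ts HD). Qed.
Let eds (T : B) (x : elt T) : d • s • x = d • x.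
Proof. exact/act_rel/(bd_ds HD). Qed.
Let edt (T : B) (x : elt T) : d • t • x = d • x.
Proof. exact/act_rel/(bd_dt HD). Qed.
Let ecs (T : B) (x : elt T) : c • s • x = c • x.
Proof. exact/act_rel/(bd_cs HD). Qed.
Let ect (T : B) (x : elt T) : c • t • x = c • x.
Proof. exact/act_rel/(bd_ct HD). Qed.
Let edl (T : B) (x : elt T) : d • λ • x = d • x.
Proof. exact/act_rel/(bd_dl HD). Qed.
Let edr (T : B) (x : elt T) : d • ρ • x = d • x.
Proof. exact/act_rel/(bd_dr HD). Qed.
Let ecl (T : B) (x : elt T) : c • λ • x = c • x.
Proof. exact/act_rel/(bd_cl HD). Qed.
Let ecr (T : B) (x : elt T) : c • ρ • x = c • x.
Proof. exact/act_rel/(bd_cr HD). Qed.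
Let ese (T : B) (x : hom T (V (dgB D))) : s • e • x = e • x.
Proof. exact/act_rel/(bd_se HD). Qed.
Let ete (T : B) (x : hom T (V (dgB D))) : t • e • x = e • x.
Proof. exact/act_rel/(bd_te HD). Qed.
Let ele (T : B) (x : hom T (V (dgB D))) : λ • e • x = e • x.
Proof. exact/act_rel/(bd_le HD). Qed.
Let ere (T : B) (x : hom T (V (dgB D))) : ρ • e • x = e • x.
Proof. exact/act_rel/(bd_re HD). Qed.
Let ede (T : B) (x : hom T (V (dgB D))) : d • e • x = x.
Proof. by rewrite -act_comp (bd_de HD) act_id. Qed.
Let ece (T : B) (x : hom T (V (dgB D))) : c • e • x = x.
Proof. by rewrite -act_comp (bd_ce HD) act_id. Qed.

(** The hypothesis [l_cod] says that the codomain of the would-be 2-cell [l] is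
    the identity functor. *)
Section CodId.
Variable l : hom (dgA D) (dgA D).
Hypothesis l_cod : p⟨V[l], V[l ∘ s], V[t ∘ l ∘ s]⟩ = idm (V (dgA D)).

Lemma cod_id_ts : t ∘ l ∘ s = s.
Proof.
apply: Vfaith; move: (f_equal (fun f => f ∘ V[s]) l_cod).
by rewrite mal_comp -!fhom_comp -!comp_assoc ss mal_r comp_idl.
Qed.

Lemma cod_id_t : t ∘ l = t.
Proof.
apply: Vfaith; move: (f_equal (fun f => V[t] ∘ f) l_cod).
rewrite mal_nat comp_idr -!fhom_comp cod_id_ts (bd_ts HD) comp_assoc.
by rewrite cod_id_ts mal_l.
Qed.

Lemma cod_id_elt (T : B) (x : elt T) : p⟨l • x, l • s • x, s • x⟩ = x.
Proof.
move: (f_equal (fun f => f ∘ x) l_cod).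
by rewrite mal_comp cod_id_ts comp_idl act_comp.
Qed.

(** By [cod_id_elt] the value of [l] at [x] is [x] composed with the component
    of [l] at the source of [x]; at a unit this component is trivial. *)
Lemma elt_from_unit (T : B) (x : elt T) (b : hom T (V (dgB D))) :
  l ∘ e = e -> s • x = e • b -> l • x = x.
Proof.
move=> le sx.
by move: (cod_id_elt x); rewrite sx -(act_comp l) le mal_l.
Qed.
End CodId.

Let etl (T : B) (x : elt T) : t • λ • x = t • x.
Proof. exact/act_rel/(cod_id_t (bd_codl HD)). Qed.
Let etr (T : B) (x : elt T) : t • ρ • x = t • x.
Proof. exact/act_rel/(cod_id_t (bd_codr HD)). Qed.

Let simp := (act_comp, es, et, est, ets, eds, edt, ecs, ect, edl, edr, ecl,
  ecr, ese, ete, ele, ere, ede, ece, etl, etr).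

(** Translation of [x] to an arrow starting at a unit.  The triple is not
    composable, so this is not a composite in the groupoid; only the Mal'tsev
    equations and naturality of [p] are available for it. *)
Let unit_arrow (T : B) (x : elt T) (b : hom T (V (dgB D))) :
  exists a : elt T, p⟨x, s • x, e • b⟩ = a /\ s • a = e • b /\
    d • a = b /\ c • a = b /\ λ • a = a /\ ρ • a = a.
Proof.
have sa : s • p⟨x, s • x, e • b⟩ = e • b by rewrite mal_nat !simp mal_r.
exists p⟨x, s • x, e • b⟩; split=> //; split=> //.
rewrite (elt_from_unit (bd_codl HD) (bd_le HD) sa).
rewrite (elt_from_unit (bd_codr HD) (bd_re HD) sa).
by rewrite !mal_nat !simp !mal_r.
Qed.

Section Data.
Variables u v a1 a2 a3 : hom (dgA D) (dgA D).
Variables (m mu : hom (dg2 LA D) (dgA D)) (th : hom (dg3 LA D) (dgA D)).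
Hypotheses (Hu : is_u p u) (Hv : is_v p v).
Hypotheses (H1 : is_alpha1 p a1) (H2 : is_alpha2 p a2) (H3 : is_alpha3 p a3).
Hypothesis Hm : V[m] =
  p⟨V[u ∘ dg2_1 LA D], V[e ∘ d ∘ dg2_1 LA D], V[v ∘ dg2_2 LA D]⟩.
Hypothesis Hmu : V[mu] =
  p⟨V[a2 ∘ dg2_1 LA D], V[e ∘ d ∘ dg2_1 LA D], V[a3 ∘ dg2_2 LA D]⟩.
Hypothesis Hth : V[th] =
  p⟨V[a1 ∘ dg3_1 LA D], V[e ∘ d ∘ dg3_1 LA D], V[mu ∘ dg3_23 LA D]⟩.

Let eu (T : B) (x : elt T) : u • x = p⟨s • ρ • t • x, ρ • t • x, ρ • x⟩.
Proof. by rewrite Hu mal_comp !act_comp. Qed.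
Let ev (T : B) (x : elt T) : v • x = p⟨s • λ • t • x, λ • t • x, λ • x⟩.
Proof. by rewrite Hv mal_comp !act_comp. Qed.
Let ea1 (T : B) (x : elt T) : a1 • x = p⟨s • ρ • ρ • t • x, ρ • s • ρ • t • x,
  p⟨s • ρ • t • x, ρ • t • x, ρ • x⟩⟩.
Proof. by rewrite H1 !mal_comp !act_comp. Qed.
Let ea2 (T : B) (x : elt T) : a2 • x = p⟨s • ρ • λ • t • x, ρ • s • λ • t • x,
  p⟨s • λ • t • x, λ • t • x, λ • ρ • x⟩⟩.
Proof. by rewrite H2 !mal_comp !act_comp. Qed.
Let ea3 (T : B) (x : elt T) : a3 • x =
  p⟨λ • s • λ • t • x, λ • λ • t • x, λ • λ • x⟩.
Proof. by rewrite H3 !mal_comp !act_comp. Qed.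

Let esu (T : B) (x : elt T) : s • u • x = s • ρ • x.
Proof. by rewrite eu mal_nat !simp mal_r. Qed.
Let etu (T : B) (x : elt T) : t • u • x = s • ρ • t • x.
Proof. by rewrite eu mal_nat !simp mal_l. Qed.
Let esv (T : B) (x : elt T) : s • v • x = s • λ • x.
Proof. by rewrite ev mal_nat !simp mal_r. Qed.
Let etv (T : B) (x : elt T) : t • v • x = s • λ • t • x.
Proof. by rewrite ev mal_nat !simp mal_l. Qed.
Let eue (T : B) (x : hom T (V (dgB D))) : u • e • x = e • x.
Proof. by rewrite eu !simp mal_l. Qed.
Let eve (T : B) (x : hom T (V (dgB D))) : v • e • x = e • x.
Proof. by rewrite ev !simp mal_l. Qed.
Let ea2e (T : B) (x : hom T (V (dgB D))) : a2 • e • x = e • x.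
Proof. by rewrite ea2 !simp !mal_l. Qed.
Let ea3e (T : B) (x : hom T (V (dgB D))) : a3 • e • x = e • x.
Proof. by rewrite ea3 !simp mal_l. Qed.
Let euo (T : B) (x : elt T) : t • x = x -> u • x = s • ρ • x.
Proof. by move=> tx; rewrite eu tx mal_l. Qed.
Let evo (T : B) (x : elt T) : t • x = x -> v • x = s • λ • x.
Proof. by move=> tx; rewrite ev tx mal_l. Qed.

Let coop_m (T : B) (x1 x2 x3 y1 y2 y3 : elt T) :
  d • x1 = c • y1 -> d • x2 = c • y2 -> d • x3 = c • y3 ->
  p⟨p⟨u • x1, e • d • x1, v • y1⟩, p⟨u • x2, e • d • x2, v • y2⟩,
    p⟨u • x3, e • d • x3, v • y3⟩⟩ =
  p⟨u • p⟨x1, x2, x3⟩, e • d • p⟨x1, x2, x3⟩, v • p⟨y1, y2, y3⟩⟩.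
Proof.
move=> E1 E2 E3.
pose F T (x y : elt T) := p⟨u • x, e • d • x, v • y⟩.
have HF (U : B) (r : hom U (V (pb LA d c))) :
    m • r = F U (pb1 LA d c • r) (pb2 LA d c • r).
  by rewrite Hm mal_comp !act_comp.
exact: (cooperate HF E1 E2 E3).
Qed.

Let coop_mu (T : B) (x1 x2 x3 y1 y2 y3 : elt T) :
  d • x1 = c • y1 -> d • x2 = c • y2 -> d • x3 = c • y3 ->
  p⟨p⟨a2 • x1, e • d • x1, a3 • y1⟩, p⟨a2 • x2, e • d • x2, a3 • y2⟩,
    p⟨a2 • x3, e • d • x3, a3 • y3⟩⟩ =
  p⟨a2 • p⟨x1, x2, x3⟩, e • d • p⟨x1, x2, x3⟩, a3 • p⟨y1, y2, y3⟩⟩.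
Proof.
move=> E1 E2 E3.
pose F T (x y : elt T) := p⟨a2 • x, e • d • x, a3 • y⟩.
have HF (U : B) (r : hom U (V (pb LA d c))) :
    mu • r = F U (pb1 LA d c • r) (pb2 LA d c • r).
  by rewrite Hmu mal_comp !act_comp.
exact: (cooperate HF E1 E2 E3).
Qed.

(** The formula of [th] has three arguments; the last one is set to the unit
    [e d y], where [a3] is trivial. *)
Let coop_th (T : B) (x1 x2 x3 y1 y2 y3 : elt T) :
  d • x1 = c • y1 -> d • x2 = c • y2 -> d • x3 = c • y3 ->
  p⟨p⟨a1 • x1, e • d • x1, a2 • y1⟩, p⟨a1 • x2, e • d • x2, a2 • y2⟩,
    p⟨a1 • x3, e • d • x3, a2 • y3⟩⟩ =
  p⟨a1 • p⟨x1, x2, x3⟩, e • d • p⟨x1, x2, x3⟩, a2 • p⟨y1, y2, y3⟩⟩.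
Proof.
move=> E1 E2 E3.
pose F T (x y : elt T) := p⟨a1 • x, e • d • x, a2 • y⟩.
have K2 : d ∘ dg2_2 LA D = c ∘ (e ∘ d ∘ dg2_2 LA D).
  by rewrite !comp_assoc (bd_ce HD) comp_idl.
pose k2 := pb_pair LA K2.
have K3 : d ∘ dg2_1 LA D = (c ∘ dg2_1 LA D) ∘ k2.
  by rewrite -comp_assoc /dg2_1 pb1_pair pb_comm.
have HF (U : B) (r : hom U (V (pb LA d c))) :
    (th ∘ pb_pair LA K3) • r = F U (pb1 LA d c • r) (pb2 LA d c • r).
  rewrite act_comp Hth mal_comp -!act_comp -!comp_assoc pb1_pair pb2_pair.
  rewrite !act_comp Hmu mal_comp -!act_comp -!comp_assoc pb1_pair pb2_pair.
  by rewrite !act_comp ea3e mal_l.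
exact: (cooperate HF E1 E2 E3).
Qed.

(** The sources of [u • x], [u • s • x] and [v • y] are combined by [coop_m]
    into that of the image of a translated arrow [a], where [ρ] is trivial. *)
Let srho_fixes (T : B) (x y : elt T) :
  p⟨s • ρ • x, s • ρ • s • x, s • λ • y⟩ = s • λ • y.
Proof.
have E1 : d • x = c • e • d • x by rewrite !simp.
have E2 : d • s • x = c • e • d • x by rewrite !simp.
have E3 : d • e • c • y = c • y by rewrite !simp.
have [a [aE [sa [da [ca [la ra]]]]]] := unit_arrow x (c • y).
move: (f_equal (fun z => s • z) (coop_m E1 E2 E3)).
rewrite !(ede, eds) !eve !eue aE da !mal_l !mal_r.
by rewrite !mal_nat !esu !esv ra sa ese mal_r.
Qed.

Let sa2 (T : B) (x : elt T) : s • a2 • x = s • λ • ρ • x.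
Proof. by rewrite ea2 !mal_nat !es mal_r srho_fixes. Qed.

(** The same argument with [a2] and [a3] in place of [u] and [v]. *)
Let slam_fixes (T : B) (x y : elt T) :
  p⟨s • λ • ρ • x, s • λ • ρ • s • x, s • λ • s • λ • s • y⟩ =
  s • λ • s • λ • s • y.
Proof.
have E1 : d • x = c • e • d • x by rewrite !simp.
have E2 : d • s • x = c • e • d • x by rewrite !simp.
have E3 : d • e • c • y = c • s • y by rewrite !simp.
have [a [aE [sa [da [ca [la ra]]]]]] := unit_arrow x (c • y).
move: (f_equal (fun z => s • z) (coop_mu E1 E2 E3)).
rewrite !(ede, eds) !ea3e !ea2e aE da !mal_l !mal_r.
have sa3 : s • a3 • s • y = s • λ • s • λ • s • y.
  by rewrite ea3 mal_nat !simp mal_l.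
by rewrite !mal_nat !sa2 sa3 ra la sa ese mal_r.
Qed.

(** When the source of [x] lies in the image of [λ], the left-hand side of
    [slam_fixes] is [sλ] of the element [p⟨ρ x, ρ s x, s x⟩], which is [x]
    by the codomain condition on [ρ]. *)
Let slam_from_unit_image (T : B) (x y : elt T) :
  s • x = s • λ • s • y -> s • λ • x = s • λ • s • x.
Proof.
move=> sx; move: (slam_fixes x y); rewrite -!mal_nat -{1}sx.
by rewrite (cod_id_elt (bd_codr HD)) sx.
Qed.

(** Precomposing [x] with the component of [λ] at [s x] gives an arrow [y] whose
    source lies in the image of [λ], so that the previous lemma applies to
    [y]. *)
Lemma lam_s : s ∘ λ ∘ s = s ∘ λ.
Proof.
apply: act_faithful => T x; rewrite !act_comp.
pose y := p⟨x, s • x, λ • s • x⟩.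
have xE : p⟨y, λ • s • x, s • x⟩ = x.
  by apply: (mal_solve_r (bd_P1 HD)); rewrite !simp.
have sy : s • y = s • λ • s • x by rewrite /y mal_nat !simp mal_r.
have hl : s • λ • λ • s • x = s • λ • s • λ • s • x.
  exact: slam_from_unit_image (refl_equal _).
rewrite -{2}xE mal_nat (mal_nat p s) (slam_from_unit_image sy) sy hl.
by rewrite mal_r.
Qed.

Let esls (T : B) (x : elt T) : s • λ • s • x = s • λ • x.
Proof. by rewrite -!act_comp lam_s. Qed.

Let rho_from_unit (T : B) (x : elt T) (b : hom T (V (dgB D))) :
  s • x = e • b -> s • ρ • x = e • b.
Proof. by move=> sx; rewrite (elt_from_unit (bd_codr HD) (bd_re HD) sx). Qed.

Let lam_square (T : B) (x : elt T) :
  p⟨λ • t • x, s • λ • t • x, v • x⟩ = λ • x.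
Proof. by rewrite ev; apply: (mal_solve_l (bd_P1 HD)); rewrite !simp. Qed.

(** Let [o] be the source of [x] and [a] the translate of [x] starting at a
    unit.  By [coop_m], [p⟨λ x, λ o, ρ o⟩] and [p⟨ρ o, e b, v a⟩] are composites
    with the same second factor ([dec1], [dec2]), and by the target part of
    [coop_th] their first factors have the same image under [sρ] ([RN]).
    Hence so do the composites; the first is [p⟨x, o, ρ o⟩] ([dec3]), and the
    second has image [sρρ o] because [v a] starts at a unit. *)
Let rho_after_rho (T : B) (x : elt T) :
  s • ρ • p⟨x, s • x, ρ • s • x⟩ = s • ρ • ρ • s • x.
Proof.
pose b := d • x.
have [a [aE [sa [da [ca [la ra]]]]]] := unit_arrow x b.
pose o := s • x; pose y := t • x; pose w := t • a; pose eb := e • b.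
have oE : t • o = o /\ s • o = o by rewrite /o !simp.
have yE : t • y = y /\ s • y = y by rewrite /y !simp.
have [[to so] [ty sy]] := (oE, yE).
have wE : p⟨y, o, eb⟩ = w by rewrite /w -aE mal_nat !simp.
have tw : t • w = w by rewrite /w !simp.
have sva : s • v • a = eb by rewrite esv la sa.
have rva : s • ρ • v • a = eb by apply: rho_from_unit.
have tva : t • v • a = s • λ • w by rewrite etv.
have E1 : d • e • c • x = c • y by rewrite /y !simp.
have E1' : d • e • c • x = c • x by rewrite !simp.
have E2 : d • e • c • x = c • o by rewrite /o !simp.
have E3 : d • o = c • eb by rewrite /o /eb !simp.
have dob : e • d • o = eb by rewrite /o eds.
have q_obj : p⟨s • λ • y, s • λ • o, s • ρ • o⟩ = p⟨s • ρ • o, eb, s • λ • w⟩.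
  have := coop_m E1 E2 E3.
  rewrite mal_r wE dob ede !eue !eve !mal_r !mal_l.
  by rewrite (evo ty) (evo to) (evo tw) !(euo to).
have q_arr : p⟨v • x, s • λ • o, s • ρ • o⟩ = p⟨s • ρ • o, eb, v • a⟩.
  have := coop_m E1' E2 E3.
  rewrite mal_r -/o aE dob ede !eue !eve !mal_r !mal_l.
  by rewrite (evo to) !(euo to).
have rlw : s • ρ • λ • w = s • ρ • s • λ • w.
  have lw : p⟨a, v • a, s • λ • w⟩ = λ • w.
    rewrite -{1}la -lam_square -/w.
    by apply: (mal_solve_r (bd_P1 HD)); rewrite !simp ?tva ?simp.
  by rewrite -{1}lw !mal_nat rva ra sa mal_r.
have q_rho : p⟨s • ρ • λ • y, s • ρ • λ • o, s • ρ • ρ • o⟩ =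
    p⟨s • ρ • ρ • o, eb, s • ρ • s • λ • w⟩.
  have := f_equal (fun z => t • z) (coop_th E1 E2 E3).
  rewrite mal_r wE dob ede -rlw.
  have ta1 (z : elt T) : t • a1 • z = s • ρ • ρ • t • z.
    by rewrite ea1 !mal_nat !simp !mal_l.
  have ta2 (z : elt T) : t • a2 • z = s • ρ • λ • t • z.
    by rewrite ea2 !mal_nat !simp !mal_l.
  rewrite !mal_nat !ta1 !ta2 to ty tw !simp !mal_r.
  by rewrite !mal_l.
pose q := p⟨s • ρ • o, eb, s • λ • w⟩.
have dec1 : p⟨p⟨λ • y, λ • o, ρ • o⟩, q, p⟨s • ρ • o, eb, v • a⟩⟩ =
    p⟨λ • x, λ • o, ρ • o⟩.
  rewrite -q_arr /q -q_obj -(elt_mal_mal (bd_P1 HD)) ?mal_l ?lam_square //.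
  by rewrite ets etv.
have dec2 : p⟨p⟨ρ • o, eb, s • λ • w⟩, q, p⟨s • ρ • o, eb, v • a⟩⟩ =
    p⟨ρ • o, eb, v • a⟩.
  rewrite /q -(elt_mal_mal (bd_P1 HD)) ?mal_l ?mal_r //.
  by rewrite tva ets.
have dec3 : p⟨λ • x, λ • o, ρ • o⟩ = p⟨x, o, ρ • o⟩.
  have := elt_mal_mal (bd_P1 HD) (a1 := λ • x) (b1 := s • λ • o)
    (c1 := s • λ • o) (a2 := λ • o) (b2 := s • λ • o) (c2 := s • λ • o)
    (a3 := o) (b3 := o) (c3 := ρ • o).
  rewrite !mal_l !mal_r (cod_id_elt (bd_codl HD)) => -> //.
  by rewrite /o es esls.
have RN : s • ρ • p⟨ρ • o, eb, s • λ • w⟩ =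
    s • ρ • p⟨λ • y, λ • o, ρ • o⟩.
  by rewrite !mal_nat q_rho /eb !simp.
rewrite -/o -dec3 -dec1 (mal_nat p ρ) (mal_nat p s) -RN.
rewrite -(mal_nat p s) -(mal_nat p ρ) dec2 !mal_nat rva /eb !simp.
exact: mal_l.
Qed.

(** [x] is [p⟨x, s x, ρ s x⟩] composed with the inverse of [ρ s x]; by
    [rho_after_rho] both factors contribute [sρρ s x], which cancels and leaves
    [sρ s x]. *)
Lemma rho_s : s ∘ ρ ∘ s = s ∘ ρ.
Proof.
apply: act_faithful => T x; rewrite !act_comp.
have xE : p⟨p⟨x, s • x, ρ • s • x⟩, ρ • s • x, s • x⟩ = x.
  by apply: (mal_solve_r (bd_P1 HD)); rewrite !simp.
by rewrite -{2}xE mal_nat (mal_nat p s) rho_after_rho mal_r.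
Qed.

End Data.
End UnitCells.

(** * Contractions *)

Section Contractions.
Variables (X : A) (s t : hom X X).
Hypotheses (HP1 : P1 p s t) (st : s ∘ t = t) (ts : t ∘ s = s).
Local Notation elt T := (hom T (V X)).

Let ss : s ∘ s = s. Proof. by rewrite -{2}ts comp_assoc st ts. Qed.
Let tt : t ∘ t = t. Proof. by rewrite -{2}st comp_assoc ts st. Qed.
Let es (T : B) (x : elt T) : s • s • x = s • x.
Proof. exact: act_rel. Qed.
Let et (T : B) (x : elt T) : t • t • x = t • x.
Proof. exact: act_rel. Qed.
Let est (T : B) (x : elt T) : s • t • x = t • x.
Proof. exact: act_rel. Qed.
Let ets (T : B) (x : elt T) : t • s • x = s • x.
Proof. exact: act_rel. Qed.
Let simp := (es, et, est, ets).

Lemma mal_assoc (T : B) (h k x m y : elt T) :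
  s • h = s • k -> t • k = t • x -> t • m = t • y ->
  p⟨p⟨h, k, x⟩, m, y⟩ = p⟨h, k, p⟨x, m, y⟩⟩.
Proof.
move=> H1 H2 H3.
by rewrite -{1}(mal_l p m m) -{1}(mal_r p y m) (elt_mal_mal HP1) // !mal_l.
Qed.

(** [f] is an endofunctor and [k] a natural transformation [f ⇒ 1], given, like
    the 2-cells of the 2-category, by the diagonals of its naturality squares:
    [k x] goes from [f (dom x)] to [cod x], and the last two fields compute it
    by either side of the square. *)
Record contraction (f k : hom X X) : Prop := Contraction {
  ct_fs : s ∘ f = f ∘ s;
  ct_ft : t ∘ f = f ∘ t;
  ct_s : s ∘ k = s ∘ f;
  ct_t : t ∘ k = t;
  ct_dom : forall (T : B) (x : elt T), k • x = p⟨k • t • x, f • t • x, f • x⟩;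
  ct_cod : forall (T : B) (x : elt T), k • x = p⟨x, s • x, k • s • x⟩
}.

Section Elt.
Variables (f k : hom X X) (H : contraction f k) (T : B) (x : elt T).
Lemma ct_efs : s • f • x = f • s • x.
Proof. by rewrite -!act_comp (ct_fs H). Qed.
Lemma ct_eft : t • f • x = f • t • x.
Proof. by rewrite -!act_comp (ct_ft H). Qed.
Lemma ct_es : s • k • x = f • s • x.
Proof. by rewrite -act_comp (ct_s H) act_comp ct_efs. Qed.
Lemma ct_et : t • k • x = t • x.
Proof. by rewrite -!act_comp (ct_t H). Qed.
End Elt.

Let ctE f k (H : contraction f k) := (ct_efs H, ct_eft H, ct_es H, ct_et H).

(** [(f x) (k x)⁻¹] is the inverse of the component of [k] at the target of [x],
    whatever [x] is. *)
Lemma contraction_tail (f k : hom X X) (H : contraction f k) (T : B)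
    (x y : elt T) :
  p⟨f • x, k • x, y⟩ = p⟨f • t • x, k • t • x, y⟩.
Proof.
rewrite (ct_dom H x) -{1}(mal_r p (f • x) (f • t • x)).
by rewrite (mal_cancel_r HP1) ?(ctE H, simp).
Qed.

Lemma contraction_id : contraction (idm X) (idm X).
Proof.
split; rewrite ?comp_idl ?comp_idr // => T x; rewrite !act_id.
  by rewrite mal_r.
by rewrite mal_l.
Qed.

(** With 2-cells encoded by diagonals, the horizontal composite is the composite
    of the underlying morphisms. *)
Lemma contraction_comp (f k f' k' : hom X X) :
  contraction f k -> contraction f' k' -> contraction (f ∘ f') (k ∘ k').
Proof.
move=> H H'; split; try (apply: act_faithful => T x).
- by rewrite !act_comp (ct_efs H) (ct_efs H').
- by rewrite !act_comp (ct_eft H) (ct_eft H').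
- by rewrite !act_comp (ct_es H) (ct_es H') (ct_efs H) (ct_efs H').
- by rewrite !act_comp (ct_et H) (ct_et H').
- move=> T x; rewrite !act_comp.
  rewrite (ct_dom H) (ct_dom H (k' • t • x)) !(ct_et H') et.
  rewrite mal_assoc ?(ctE H) ?(ctE H') ?simp //.
  by rewrite -mal_nat -(ct_dom H').
- move=> T x; rewrite !act_comp.
  rewrite (ct_cod H) (ct_cod H (k' • s • x)) !(ct_es H') !es.
  by rewrite -mal_assoc -?(ct_cod H') ?(ctE H) ?(ctE H') ?simp.
Qed.

(** This is the form in which the conditions on [λ] and [ρ] are met: [k] is a
    2-cell into the identity and [f] is its domain. *)
Lemma unit_contraction (f k : hom X X) :
  s ∘ k ∘ s = s ∘ k -> t ∘ k = t ->
  (forall (T : B) (x : elt T), p⟨k • x, k • s • x, s • x⟩ = x) ->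
  V[f] = p⟨V[s ∘ k ∘ t], V[k ∘ t], V[k]⟩ ->
  contraction f k.
Proof.
move=> ks kt kcod fE.
have ekt (T : B) (x : elt T) : t • k • x = t • x by exact: act_rel.
have eks (T : B) (x : elt T) : s • k • s • x = s • k • x.
  by rewrite -!act_comp ks.
have ef (T : B) (x : elt T) : f • x = p⟨s • k • t • x, k • t • x, k • x⟩.
  by rewrite fE mal_comp !act_comp.
split=> //; try (apply: act_faithful => T x; rewrite !act_comp).
- by rewrite !ef mal_nat !simp mal_r mal_l eks.
- by rewrite !ef mal_nat !ekt !simp !mal_l.
- by rewrite ef mal_nat es mal_r.
- move=> T x; rewrite !ef !et mal_l.
  by rewrite (mal_solve_l HP1) // ?ekt ?simp.
- by move=> T x; rewrite -{2}(kcod T x) (mal_solve_r HP1) // ?eks ?ekt ?simp.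
Qed.

(** * Canonical cells *)

(** The morphism [a] is the one 2-cell [f ⇒ g] whose composite with [kg] is
    [kf]. *)
Section Canonical.
Variables (f kf g kg : hom X X).
Hypotheses (Hf : contraction f kf) (Hg : contraction g kg).
Variable a : hom X X.
Hypothesis aE : V[a] = p⟨V[g], V[kg], V[kf]⟩.

Lemma canE (T : B) (x : elt T) : a • x = p⟨g • x, kg • x, kf • x⟩.
Proof. by rewrite aE mal_comp. Qed.

Lemma can_es (T : B) (x : elt T) : s • a • x = f • s • x.
Proof. by rewrite canE mal_nat (ctE Hg) !(ct_es Hg) (ct_es Hf) mal_r. Qed.

Lemma can_et (T : B) (x : elt T) : t • a • x = g • t • x.
Proof. by rewrite canE mal_nat !(ctE Hg) (ct_et Hf) mal_l. Qed.

Lemma can_s : s ∘ a ∘ s = s ∘ a.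
Proof.
by apply: act_faithful => T x; rewrite !act_comp !can_es es.
Qed.

Lemma can_t : t ∘ a ∘ t = t ∘ a.
Proof.
by apply: act_faithful => T x; rewrite !act_comp !can_et et.
Qed.

Lemma can_dom : p⟨V[s ∘ a ∘ t], V[a ∘ t], V[a]⟩ = V[f].
Proof.
rewrite -[V[f]]comp_idr -[LHS]comp_idr; move: (idm _) => x.
rewrite mal_comp !act_comp can_es (act_rel x st).
have -> : a • x = p⟨g • t • x, kg • t • x, kf • x⟩.
  by rewrite canE contraction_tail.
rewrite canE (mal_cancel_l HP1) ?(ctE Hg) ?(ctE Hf) ?simp //.
by rewrite (ct_dom Hf x) (mal_solve_l HP1) ?(ctE Hf) ?simp.
Qed.

Lemma can_cod : p⟨V[a], V[a ∘ s], V[t ∘ a ∘ s]⟩ = V[g].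
Proof.
rewrite -[V[g]]comp_idr -[LHS]comp_idr; move: (idm _) => x.
rewrite mal_comp !act_comp can_et (act_rel x ts).
have -> : a • x = p⟨g • x, kg • s • x, kf • s • x⟩.
  rewrite canE (ct_cod Hg x) (ct_cod Hf x).
  by rewrite (mal_cancel_l HP1) ?(ctE Hg) ?(ctE Hf) ?simp.
by rewrite canE (mal_cancel_r HP1) ?(ctE Hg) ?(ctE Hf) ?simp ?mal_l.
Qed.
End Canonical.

Section Calculus.
Variables (f kf g kg h kh : hom X X).
Hypotheses (Hf : contraction f kf) (Hg : contraction g kg).
Hypothesis Hh : contraction h kh.
Variables (T : B) (x : elt T).

Lemma can_vcomp :
  p⟨p⟨h • x, kh • x, kg • x⟩, g • x, p⟨g • x, kg • x, kf • x⟩⟩ =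
  p⟨h • x, kh • x, kf • x⟩.
Proof. by rewrite (mal_chain HP1) ?(ctE Hf, ctE Hg, ctE Hh). Qed.

(** The horizontal composite of [kh] and [kf], pasted in the two possible
    orders; [kf] is whiskered by [h] on the left here, on the right in
    [ct_r]. *)
Lemma ct_l : kh • kf • x = p⟨kh • x, h • x, h • kf • x⟩.
Proof.
rewrite (ct_dom Hh (kf • x)) (ct_dom Hh x) (ct_et Hf).
rewrite -{2}(mal_r p (h • kf • x) (h • x)).
by rewrite (mal_chain HP1) ?(ctE Hf, ctE Hh, simp).
Qed.

Lemma ct_r : kf • kh • x = p⟨kh • x, h • x, kf • h • x⟩.
Proof.
rewrite (ct_cod Hf (kh • x)) (ct_cod Hf (h • x)) (ct_es Hh) (ct_efs Hh).
rewrite -{2}(mal_l p (kh • x) (h • s • x)).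
by rewrite (mal_chain HP1) ?(ctE Hf, ctE Hh, simp).
Qed.
End Calculus.

Section Whiskering.
Variables (f kf g kg h kh : hom X X).
Hypotheses (Hf : contraction f kf) (Hg : contraction g kg).
Hypothesis Hh : contraction h kh.
Variables (T : B) (x : elt T).

Lemma can_lwhisk :
  h • p⟨g • x, kg • x, kf • x⟩ = p⟨h • g • x, kh • kg • x, kh • kf • x⟩.
Proof.
rewrite mal_nat (ct_l Hg Hh) (ct_l Hf Hh).
by rewrite (mal_cancel_l HP1) ?(ctE Hf, ctE Hg, ctE Hh).
Qed.

Lemma can_rwhisk :
  p⟨g • h • x, kg • h • x, kf • h • x⟩ =
  p⟨g • h • x, kg • kh • x, kf • kh • x⟩.
Proof.
rewrite (ct_r Hf Hh) (ct_r Hg Hh).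
by rewrite (mal_cancel_l HP1) ?(ctE Hf, ctE Hg, ctE Hh).
Qed.

Variable a : hom X X.
Hypothesis aE : V[a] = p⟨V[g], V[kg], V[kf]⟩.

Lemma lwhisk_can : h • a • x = p⟨h • g • x, kh • kg • x, kh • kf • x⟩.
Proof. by rewrite (canE aE) can_lwhisk. Qed.

Lemma rwhisk_can : a • h • x = p⟨g • h • x, kg • kh • x, kf • kh • x⟩.
Proof. by rewrite (canE aE) can_rwhisk. Qed.
End Whiskering.

Lemma contraction_dom (u r : hom X X) (Hr : contraction u r) (T : B)
    (x : elt T) :
  u • x = p⟨s • r • t • x, r • t • x, r • x⟩.
Proof.
rewrite (ct_dom Hr x) (ct_es Hr) est.
by rewrite (mal_solve_l HP1) ?(ctE Hr, simp).
Qed.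

Section AssociatorFormulas.
Variables (u r v l : hom X X).
Hypotheses (Hr : contraction u r) (Hl : contraction v l).
Variables (T : B) (x : elt T).

(** The formulas of a diagram for the restricted associators only correct at the
    target of [x], through [t • x]; by [contraction_tail] that is enough to give
    the canonical cells [u ⇒ uu], [vu ⇒ uv] and [vv ⇒ v]. *)
Lemma alpha1E :
  p⟨s • r • r • t • x, r • s • r • t • x,
    p⟨s • r • t • x, r • t • x, r • x⟩⟩ =
  p⟨u • u • x, r • r • x, r • x⟩.
Proof.
rewrite -(contraction_dom Hr) !(ctE Hr) est.
have := contraction_tail (contraction_comp Hr Hr) x (r • x).
rewrite !act_comp => ->; rewrite (ct_r Hr Hr (t • x)) (ct_dom Hr x).
by rewrite (mal_cancel_l HP1) ?(ctE Hr, simp).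
Qed.

Lemma alpha2E :
  p⟨s • r • l • t • x, r • s • l • t • x,
    p⟨s • l • t • x, l • t • x, l • r • x⟩⟩ =
  p⟨u • v • x, r • l • x, l • r • x⟩.
Proof.
rewrite !(ctE Hr) !(ctE Hl) est.
have := contraction_tail (contraction_comp Hr Hl) x (l • r • x).
rewrite !act_comp => ->; rewrite (ct_r Hr Hl (t • x)).
have E : p⟨l • t • x, v • t • x, p⟨v • t • x, l • t • x, l • r • x⟩⟩ =
    l • r • x.
  by rewrite (mal_solve_l HP1) ?(ctE Hl, ctE Hr, simp).
rewrite -{2}E (mal_cancel_l HP1) ?mal_nat ?(ctE Hl, ctE Hr, simp) //.
by rewrite mal_l.
Qed.

Lemma alpha3E :
  p⟨l • s • l • t • x, l • l • t • x, l • l • x⟩ =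
  p⟨v • x, l • x, l • l • x⟩.
Proof.
rewrite (contraction_tail Hl) (ct_es Hl) est.
have lv : l • v • t • x = p⟨v • t • x, v • t • x, l • v • t • x⟩.
  by rewrite mal_r.
rewrite (ct_r Hl Hl (t • x)) {1}lv (mal_cancel_r HP1) //.
all: by rewrite ?(ctE Hl, simp).
Qed.
End AssociatorFormulas.

Section CanonicalAssociator.
Variables (u r v l a1 a2 a3 : hom X X).
Hypotheses (Hr : contraction u r) (Hl : contraction v l).
Hypothesis a1E : V[a1] = p⟨V[u ∘ u], V[r ∘ r], V[r]⟩.
Hypothesis a2E : V[a2] = p⟨V[u ∘ v], V[r ∘ l], V[l ∘ r]⟩.
Hypothesis a3E : V[a3] = p⟨V[v], V[l], V[l ∘ l]⟩.

Let Huu := contraction_comp Hr Hr.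
Let Huv := contraction_comp Hr Hl.
Let Hvu := contraction_comp Hl Hr.
Let Hvv := contraction_comp Hl Hl.

Section Elt.
Variables (T : B) (x : elt T).

Let a1x : a1 • x = p⟨u • u • x, r • r • x, r • x⟩.
Proof. by rewrite (canE a1E) !act_comp. Qed.
Let a2x : a2 • x = p⟨u • v • x, r • l • x, l • r • x⟩.
Proof. by rewrite (canE a2E) !act_comp. Qed.
Let a3x : a3 • x = p⟨v • x, l • x, l • l • x⟩.
Proof. by rewrite (canE a3E) !act_comp. Qed.

(** In these six identities all terms are canonical cells or whiskerings of
    such, and both sides are the canonical cell between the same two
    contractions.  They are the triangle at [(x,1)], [(1,x)] and the pentagon at
    the four quadruples with [x] in one place and units elsewhere. *)
Lemma triangle_elt_1 : p⟨u • r • x, u • u • x, a1 • x⟩ = u • x.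
Proof.
have := can_lwhisk Hr (contraction_id) Hr x.
rewrite !act_id !mal_r a1x => ->.
by have := can_vcomp Hr Huu Hr x; rewrite !act_comp mal_l.
Qed.

Lemma triangle_elt_2 : p⟨v • x, v • x, a3 • x⟩ = v • l • x.
Proof.
rewrite mal_r a3x (ct_l Hl Hl).
apply: (mal_solve_l HP1); first by rewrite (ct_efs Hl) (ct_es Hl).
by rewrite !(ct_eft Hl) (ct_et Hl).
Qed.

Lemma pentagon_elt_1 :
  p⟨a1 • u • x, u • u • x, a1 • x⟩ =
  p⟨p⟨u • a1 • x, u • u • x, a1 • x⟩, u • x, u • x⟩.
Proof.
have := rwhisk_can Hr Huu Hr x a1E.
have := lwhisk_can Hr Huu Hr x a1E.
by rewrite !act_comp mal_l => -> ->.
Qed.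

Lemma pentagon_elt_2 :
  p⟨a1 • v • x, u • v • x, a2 • x⟩ =
  p⟨p⟨u • a2 • x, u • v • u • x, a2 • u • x⟩, v • u • u • x, v • a1 • x⟩.
Proof.
have := can_vcomp Hvu Huv (contraction_comp Huu Hl) x.
have := can_vcomp (contraction_comp Hvu Hr)
  (contraction_comp Huv Hr) (contraction_comp Huu Hl) x.
have := can_vcomp Hvu
  (contraction_comp Hvu Hr) (contraction_comp Huu Hl) x.
have := rwhisk_can Hr Huu Hl x a1E.
have := lwhisk_can Hr Huu Hl x a1E.
have := rwhisk_can Hvu Huv Hr x a2E.
have := lwhisk_can Hvu Huv Hr x a2E.
by rewrite a2x !act_comp => -> -> -> -> E1 E2 E3; rewrite E3 E2 E1.
Qed.

Lemma pentagon_elt_3 :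
  p⟨a2 • x, v • u • x, a3 • u • x⟩ =
  p⟨p⟨u • a3 • x, u • v • v • x, a2 • v • x⟩, v • u • v • x, v • a2 • x⟩.
Proof.
have Hvvu := contraction_comp Hvv Hr.
have Hvuv := contraction_comp Hvu Hl.
have Huvv := contraction_comp Huv Hl.
have := can_vcomp Hvvu Hvu Huv x.
have := can_vcomp Hvuv Huvv Huv x.
have := can_vcomp Hvvu Hvuv Huv x.
have := rwhisk_can Hvv Hl Hr x a3E.
have := lwhisk_can Hvv Hl Hr x a3E.
have := rwhisk_can Hvu Huv Hl x a2E.
have := lwhisk_can Hvu Huv Hl x a2E.
by rewrite a2x !act_comp => -> -> -> -> E1 E2 E3; rewrite E3 E2 E1.
Qed.

Lemma pentagon_elt_4 :
  p⟨a3 • x, v • v • x, a3 • v • x⟩ =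
  p⟨p⟨v • x, v • x, a3 • x⟩, v • v • x, v • a3 • x⟩.
Proof.
have := rwhisk_can Hvv Hl Hl x a3E.
have := lwhisk_can Hvv Hl Hl x a3E.
by rewrite !act_comp mal_r => -> ->.
Qed.
End Elt.

Lemma canonical_triangle_1 : p⟨V[u ∘ r], V[u ∘ u], V[a1]⟩ = V[u].
Proof. by apply: V_ext => T x; rewrite mal_comp !act_comp triangle_elt_1. Qed.

Lemma canonical_triangle_2 : p⟨V[v], V[v], V[a3]⟩ = V[v ∘ l].
Proof. by apply: V_ext => T x; rewrite mal_comp !act_comp triangle_elt_2. Qed.

Lemma canonical_pentagon_1 :
  p⟨V[a1 ∘ u], V[u ∘ u], V[a1]⟩ =
  p⟨p⟨V[u ∘ a1], V[u ∘ u], V[a1]⟩, V[u], V[u]⟩.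
Proof.
by apply: V_ext => T x; rewrite !mal_comp !act_comp pentagon_elt_1.
Qed.

Lemma canonical_pentagon_2 :
  p⟨V[a1 ∘ v], V[u ∘ v], V[a2]⟩ =
  p⟨p⟨V[u ∘ a2], V[u ∘ (v ∘ u)], V[a2 ∘ u]⟩, V[v ∘ (u ∘ u)], V[v ∘ a1]⟩.
Proof.
by apply: V_ext => T x; rewrite !mal_comp !act_comp pentagon_elt_2.
Qed.

Lemma canonical_pentagon_3 :
  p⟨V[a2], V[v ∘ u], V[a3 ∘ u]⟩ =
  p⟨p⟨V[u ∘ a3], V[u ∘ (v ∘ v)], V[a2 ∘ v]⟩, V[v ∘ (u ∘ v)], V[v ∘ a2]⟩.
Proof.
by apply: V_ext => T x; rewrite !mal_comp !act_comp pentagon_elt_3.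
Qed.

Lemma canonical_pentagon_4 :
  p⟨V[a3], V[v ∘ v], V[a3 ∘ v]⟩ =
  p⟨p⟨V[v], V[v], V[a3]⟩, V[v ∘ v], V[v ∘ a3]⟩.
Proof.
by apply: V_ext => T x; rewrite !mal_comp !act_comp pentagon_elt_4.
Qed.
End CanonicalAssociator.

Section Determined.
Variables (u r v l a1 a2 a3 : hom X X).
Hypotheses (Hr : contraction u r) (Hl : contraction v l).

Let ctr := ctE Hr.
Let ctl := ctE Hl.

(** The equation is the triangle at [(x,1)]: it makes [a1] the inverse of
    the whiskering of [r] by [u], hence canonical by [ct_l]. *)
Lemma triangle_determines_1 :
  t ∘ a1 = t ∘ (u ∘ u) -> V[u] = p⟨V[u ∘ r], V[u ∘ u], V[a1]⟩ ->
  V[a1] = p⟨V[u ∘ u], V[r ∘ r], V[r]⟩.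
Proof.
move=> ta E; rewrite -[LHS]comp_idr -[RHS]comp_idr; move: (idm _) => x.
have Ex : u • x = p⟨u • r • x, u • u • x, a1 • x⟩.
  by rewrite {1}E mal_comp !act_comp.
have tax : t • a1 • x = t • u • u • x by rewrite -act_comp ta !act_comp.
rewrite mal_comp !act_comp (ct_l Hr Hr) -{3}(mal_l p (r • x) (u • x)).
rewrite (mal_cancel_l HP1) ?(ctr, simp) // {2}Ex.
rewrite (mal_solve_l HP1) ?(ctr, simp) //.
by rewrite tax ?(ctr, simp).
Qed.

Lemma triangle_determines_3 :
  V[v ∘ l] = p⟨V[v], V[v], V[a3]⟩ -> V[a3] = p⟨V[v], V[l], V[l ∘ l]⟩.
Proof.
rewrite mal_r => <-; rewrite -[LHS]comp_idr -[RHS]comp_idr.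
move: (idm _) => x; rewrite mal_comp !act_comp (ct_l Hl Hl).
by rewrite (mal_solve_l HP1) ?(ctl, simp).
Qed.

(** A functor isomorphic to the identity is faithful. *)
Lemma contraction_mono (T : B) (x y : elt T) :
  s • x = s • y -> t • x = t • y -> v • x = v • y -> x = y.
Proof.
have lE (z : elt T) : p⟨l • z, l • s • z, s • z⟩ = z.
  by rewrite {1}(ct_cod Hl z) (mal_solve_r HP1) ?(ctl, simp).
move=> sxy txy vxy; rewrite -(lE x) -(lE y) sxy.
by rewrite (ct_dom Hl x) (ct_dom Hl y) vxy txy.
Qed.

(** Kelly's argument.  The last equation is the pentagon at [(1,1,x,1)], with
    the third restricted associator replaced by [v ∘ l].  The equation before it is
    naturality of [a2] with respect to [l], which moves the term [a2 ∘ v] of the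
    pentagon to [a2]; cancelling [a2] leaves an equation [v (l u x) = v z], and
    [contraction_mono] removes [v]. *)
Lemma pentagon_determines_2 :
  s ∘ a2 = s ∘ (v ∘ u) -> t ∘ a2 = t ∘ (u ∘ v) ->
  p⟨V[u ∘ (v ∘ l)], V[u ∘ (v ∘ v)], V[a2 ∘ v]⟩ =
    p⟨V[a2], V[v ∘ u], V[v ∘ (u ∘ l)]⟩ ->
  p⟨V[a2], V[v ∘ u], V[v ∘ (l ∘ u)]⟩ =
    p⟨p⟨V[u ∘ (v ∘ l)], V[u ∘ (v ∘ v)], V[a2 ∘ v]⟩, V[v ∘ (u ∘ v)],
      V[v ∘ a2]⟩ ->
  V[a2] = p⟨V[u ∘ v], V[r ∘ l], V[l ∘ r]⟩.
Proof.
move=> sa ta -> E; rewrite -[LHS]comp_idr -[RHS]comp_idr.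
move: (idm _) => x; rewrite mal_comp !act_comp.
have sax : s • a2 • x = v • u • s • x.
  by rewrite -act_comp sa !act_comp ?(ctr, ctl).
have tax : t • a2 • x = u • v • t • x.
  by rewrite -act_comp ta !act_comp ?(ctr, ctl).
pose z := p⟨u • l • x, u • v • x, a2 • x⟩.
have sz : s • z = v • u • s • x.
  by rewrite /z mal_nat ?(ctr, ctl, simp) sax mal_r.
have tz : t • z = u • t • x.
  by rewrite /z mal_nat ?(ctr, ctl, simp) tax mal_l.
have lu : l • u • x = z.
  apply: contraction_mono; rewrite ?sz ?tz ?(ctr, ctl, simp) //.
  move: (f_equal (fun f => f ∘ x) E); rewrite !mal_comp !act_comp.
  rewrite mal_assoc ?(ctr, ctl, simp) ?sax ?tax ?(ctr, ctl, simp) //.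
  rewrite -mal_nat -/z => Ez.
  have cancel (y : elt (V X)) : t • y = v • u • t • x ->
      p⟨v • u • x, a2 • x, p⟨a2 • x, v • u • x, y⟩⟩ = y.
    by move=> ty; rewrite (mal_solve_l HP1) ?(ctr, ctl, simp) ?sax ?ty.
  rewrite -(cancel (v • l • u • x)) ?(ctr, ctl, simp) // Ez cancel //.
  by rewrite ctl tz.
rewrite (ct_l Hl Hr) (ct_r Hl Hr) (mal_cancel_l HP1) ?(ctr, ctl, simp) //.
by rewrite lu (mal_solve_l HP1) ?(ctr, ctl, simp) ?tax ?(ctr, ctl, simp).
Qed.
End Determined.

End Contractions.

(** * Morphisms out of iterated pullbacks *)

(** A pair [⟨x,y⟩] over [z] is [p⟨⟨x, s z⟩, ⟨r z, s z⟩, ⟨r z, y⟩⟩], and [m]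
    commutes with [p]. *)
Lemma split_decomp (X Y Z W : A) (f : hom X Z) (g : hom Y Z) (r : hom Z X)
    (s : hom Z Y) (m : hom (pb LA f g) W) (m1 : hom X W) (m0 : hom Z W)
    (m2 : hom Y W) :
  f ∘ r = idm Z -> g ∘ s = idm Z ->
  (forall (T : A) (i : hom T (pb LA f g)) (x : hom T X),
     pb1 LA f g ∘ i = x -> pb2 LA f g ∘ i = s ∘ f ∘ x -> m ∘ i = m1 ∘ x) ->
  (forall (T : A) (i : hom T (pb LA f g)) (z : hom T Z),
     pb1 LA f g ∘ i = r ∘ z -> pb2 LA f g ∘ i = s ∘ z -> m ∘ i = m0 ∘ z) ->
  (forall (T : A) (i : hom T (pb LA f g)) (y : hom T Y),
     pb1 LA f g ∘ i = r ∘ g ∘ y -> pb2 LA f g ∘ i = y -> m ∘ i = m2 ∘ y) ->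
  V[m] = p⟨V[m1 ∘ pb1 LA f g], V[m0 ∘ f ∘ pb1 LA f g], V[m2 ∘ pb2 LA f g]⟩.
Proof.
move=> fr gs M1 M0 M2; set q1 := pb1 LA f g; set q2 := pb2 LA f g.
have q12 : f ∘ q1 = g ∘ q2 by exact: pb_comm.
have pair (x : hom (pb LA f g) X) (y : hom (pb LA f g) Y) : f ∘ x = g ∘ y ->
    exists i : hom (pb LA f g) (pb LA f g), q1 ∘ i = x /\ q2 ∘ i = y.
  by move=> H; exists (pb_pair LA H); rewrite /q1 /q2 pb1_pair pb2_pair.
have [i1 [i11 i12]] : exists i, q1 ∘ i = q1 /\ q2 ∘ i = s ∘ f ∘ q1.
  by apply: pair; rewrite !comp_assoc gs comp_idl.
have [i0 [i01 i02]] : exists i, q1 ∘ i = r ∘ (f ∘ q1) /\ q2 ∘ i = s ∘ (f ∘ q1).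
  by apply: pair; rewrite !comp_assoc gs fr.
have [i2 [i21 i22]] : exists i, q1 ∘ i = r ∘ g ∘ q2 /\ q2 ∘ i = q2.
  by apply: pair; rewrite !comp_assoc fr comp_idl.
rewrite -(M1 _ _ _ i11 i12) -(M2 _ _ _ i21 i22) -comp_assoc.
rewrite -(M0 _ _ _ i01 i02) !fhom_comp -mal_nat -[LHS]comp_idr.
congr (_ ∘ _); apply: elt_pair_ext; rewrite comp_idr mal_nat -!fhom_comp.
  by rewrite -/q1 i11 i01 i21 -comp_assoc q12 mal_l.
by rewrite -/q2 i12 i02 i22 -comp_assoc mal_r.
Qed.

Section WeaklyMaltsev.
Hypothesis wmA : weakly_maltsev LA.

Lemma wm_pb (X Y Z W : A) (f : hom X Z) (g : hom Y Z) (r : hom Z X)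
    (s : hom Z Y) (h k : hom (pb LA f g) W) :
  f ∘ r = idm Z -> g ∘ s = idm Z ->
  (forall i : hom X (pb LA f g), pb1 LA f g ∘ i = idm X ->
     pb2 LA f g ∘ i = s ∘ f -> h ∘ i = k ∘ i) ->
  (forall j : hom Y (pb LA f g), pb1 LA f g ∘ j = r ∘ g ->
     pb2 LA f g ∘ j = idm Y -> h ∘ j = k ∘ j) ->
  h = k.
Proof.
move=> fr gs Hi Hj; apply: (@wmA _ _ _ _ _ _ _ fr gs).
  by apply: Hi; rewrite ?pb1_pair ?pb2_pair.
by apply: Hj; rewrite ?pb1_pair ?pb2_pair.
Qed.

Section Graph.
Variable D : diagram A.
Local Notation d := (dgd D).
Local Notation c := (dgc D).
Local Notation e := (dge D).
Hypotheses (de : d ∘ e = idm (dgB D)) (ce : c ∘ e = idm (dgB D)).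

Local Notation q2_1 := (dg2_1 LA D).
Local Notation q2_2 := (dg2_2 LA D).
Local Notation q3_1 := (dg3_1 LA D).
Local Notation q3_23 := (dg3_23 LA D).

Definition dg3_2 := q2_1 ∘ q3_23.
Definition dg3_3 := q2_2 ∘ q3_23.

Lemma dg2_ext (T : A) (i j : hom T (dg2 LA D)) :
  q2_1 ∘ i = q2_1 ∘ j -> q2_2 ∘ i = q2_2 ∘ j -> i = j.
Proof. exact: pb_ext. Qed.

Lemma dg3_ext (T : A) (i j : hom T (dg3 LA D)) :
  q3_1 ∘ i = q3_1 ∘ j -> dg3_2 ∘ i = dg3_2 ∘ j -> dg3_3 ∘ i = dg3_3 ∘ j ->
  i = j.
Proof.
rewrite /dg3_2 /dg3_3 -!comp_assoc => H1 H2 H3.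
by apply: (pb_ext LA) => //; apply: dg2_ext.
Qed.

Lemma dg2_ex (T : A) (x y : hom T (dgA D)) : d ∘ x = c ∘ y ->
  exists i : hom T (dg2 LA D), q2_1 ∘ i = x /\ q2_2 ∘ i = y.
Proof.
by move=> H; exists (pb_pair LA H); rewrite /dg2_1 /dg2_2 pb1_pair pb2_pair.
Qed.

Lemma dg3_ex (T : A) (x y z : hom T (dgA D)) : d ∘ x = c ∘ y -> d ∘ y = c ∘ z ->
  exists i : hom T (dg3 LA D),
    q3_1 ∘ i = x /\ dg3_2 ∘ i = y /\ dg3_3 ∘ i = z.
Proof.
move=> H1 /dg2_ex [i [i1 i2]].
have H : d ∘ x = c ∘ q2_1 ∘ i by rewrite -comp_assoc i1.
exists (pb_pair LA H); rewrite /dg3_2 /dg3_3 -!comp_assoc.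
by rewrite /dg3_1 /dg3_23 pb1_pair pb2_pair.
Qed.

Lemma wm2 (W : A) (h k : hom (dg2 LA D) W) :
  (forall i : hom (dgA D) (dg2 LA D), q2_1 ∘ i = idm _ -> q2_2 ∘ i = e ∘ d ->
     h ∘ i = k ∘ i) ->
  (forall i : hom (dgA D) (dg2 LA D), q2_1 ∘ i = e ∘ c -> q2_2 ∘ i = idm _ ->
     h ∘ i = k ∘ i) ->
  h = k.
Proof. exact: wm_pb. Qed.

(** The weak Mal'tsev property is applied to the outer pullback, where
    [c ∘ q2_1] has the section [⟨e,e⟩], and then to the inner one. *)
Lemma wm3 (W : A) (h k : hom (dg3 LA D) W) :
  (forall i : hom (dgA D) (dg3 LA D), q3_1 ∘ i = idm _ ->
     dg3_2 ∘ i = e ∘ d -> dg3_3 ∘ i = e ∘ d -> h ∘ i = k ∘ i) ->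
  (forall i : hom (dgA D) (dg3 LA D), q3_1 ∘ i = e ∘ c ->
     dg3_2 ∘ i = idm _ -> dg3_3 ∘ i = e ∘ d -> h ∘ i = k ∘ i) ->
  (forall i : hom (dgA D) (dg3 LA D), q3_1 ∘ i = e ∘ c ->
     dg3_2 ∘ i = e ∘ c -> dg3_3 ∘ i = idm _ -> h ∘ i = k ∘ i) ->
  h = k.
Proof.
move=> H1 H2 H3.
have [s [s1 s2]] : exists s : hom (dgB D) (dg2 LA D),
    q2_1 ∘ s = e /\ q2_2 ∘ s = e by apply: dg2_ex; rewrite de ce.
apply: (wm_pb (r := e) (s := s)) => //.
- by rewrite -comp_assoc s1.
- move=> i i1 i2; apply: H1 => //.
    by rewrite /dg3_2 -comp_assoc i2 comp_assoc s1.
  by rewrite /dg3_3 -comp_assoc i2 comp_assoc s2.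
- move=> j j1 j2; apply: wm2 => i i1 i2; rewrite -!comp_assoc.
  + apply: H2; rewrite comp_assoc.
    * by rewrite [X in X ∘ i]j1 -!comp_assoc i1 comp_idr.
    * by rewrite /dg3_2 -(comp_assoc _ _ j) [X in _ ∘ X ∘ i]j2 comp_idr.
    * by rewrite /dg3_3 -(comp_assoc _ _ j) [X in _ ∘ X ∘ i]j2 comp_idr.
  + apply: H3; rewrite comp_assoc.
    * by rewrite [X in X ∘ i]j1 -!comp_assoc i1 (comp_assoc c) ce comp_idl.
    * by rewrite /dg3_2 -(comp_assoc _ _ j) [X in _ ∘ X ∘ i]j2 comp_idr.
    * by rewrite /dg3_3 -(comp_assoc _ _ j) [X in _ ∘ X ∘ i]j2 comp_idr.
Qed.

End Graph.
End WeaklyMaltsev.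

(** * Cells as contractions *)

Lemma cell_interchange_l (X Y Z : gobj p) (τ : gcell Y Z) (σ : gcell X Y) :
  V[gc τ ∘ gc σ] = p⟨V[gcod Vfaith τ ∘ gc σ],
    V[gcod Vfaith τ ∘ gdom Vfaith σ], V[gc τ ∘ gdom Vfaith σ]⟩.
Proof.
have H : gdom Vfaith (glwhisk (gcod Vfaith τ) σ) =
    gcod Vfaith (grwhisk τ (gdom Vfaith σ)).
  by rewrite gdom_lwhisk gcod_rwhisk.
rewrite -(ginterchange_l LA H) [V[gc (gvcomp H)]]gvcomp_morE.
by rewrite gdom_lwhisk.
Qed.

Lemma cell_interchange_r (X Y Z : gobj p) (τ : gcell Y Z) (σ : gcell X Y) :
  V[gc τ ∘ gc σ] = p⟨V[gc τ ∘ gcod Vfaith σ],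
    V[gdom Vfaith τ ∘ gcod Vfaith σ], V[gdom Vfaith τ ∘ gc σ]⟩.
Proof.
have H : gdom Vfaith (grwhisk τ (gcod Vfaith σ)) =
    gcod Vfaith (glwhisk (gdom Vfaith τ) σ).
  by rewrite gdom_rwhisk gcod_lwhisk.
rewrite -(ginterchange_r LA H) [V[gc (gvcomp H)]]gvcomp_morE.
by rewrite gdom_rwhisk.
Qed.

(** The equations [dom2 = f] and [cod2 = 1] of a 2-cell are exactly the
    hypotheses of [unit_contraction]. *)
Lemma cell_contraction (X : gobj p) (κ : gcell X X) :
  gcod Vfaith κ = gid X ->
  contraction (gs X) (gt X) (gm (gdom Vfaith κ)) (gc κ).
Proof.
move=> /(f_equal (@gm _ _ _ _ _ _ _)) /= κ1.
have tκ : gt X ∘ κ = gt X by rewrite -(t_gcod Vfaith) κ1 comp_idr.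
apply: (unit_contraction (gP1 (g := X)) (gst X) (gts X) (gc_s κ) tκ).
- move=> T x; have := gcod_morE κ.
  rewrite κ1 tκ gts => /(f_equal (fun f => f ∘ x)).
  by rewrite mal_comp !act_comp act_id.
- exact: gdom_morE.
Qed.

(** * Invertibility of 2-cells *)

Section Invertible.
Variables (X Y : gobj p) (τ : gcell X Y).
Local Notation f := (gdom Vfaith τ).
Local Notation g := (gcod Vfaith τ).
Local Notation elt T := (hom T (V (gcar X))).

Let HP1 := gP1 (g := Y).
Let Ys (T : B) (x : hom T (V (gcar Y))) : gs Y • gs Y • x = gs Y • x.
Proof. exact/act_rel/gss. Qed.
Let Yt (T : B) (x : hom T (V (gcar Y))) : gt Y • gt Y • x = gt Y • x.
Proof. exact/act_rel/gtt. Qed.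
Let Xst (T : B) (x : elt T) : gs X • gt X • x = gt X • x.
Proof. exact/act_rel/gst. Qed.
Let Xts (T : B) (x : elt T) : gt X • gs X • x = gs X • x.
Proof. exact/act_rel/gts. Qed.
Let Xss (T : B) (x : elt T) : gs X • gs X • x = gs X • x.
Proof. exact/act_rel/gss. Qed.
Let Xtt (T : B) (x : elt T) : gt X • gt X • x = gt X • x.
Proof. exact/act_rel/gtt. Qed.
Let fs (T : B) (x : elt T) : gs Y • f • x = f • gs X • x.
Proof. by rewrite -!act_comp gm_s. Qed.
Let ft (T : B) (x : elt T) : gt Y • f • x = f • gt X • x.
Proof. by rewrite -!act_comp gm_t. Qed.
Let gss' (T : B) (x : elt T) : gs Y • g • x = g • gs X • x.
Proof. by rewrite -!act_comp gm_s. Qed.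
Let gts' (T : B) (x : elt T) : gt Y • g • x = g • gt X • x.
Proof. by rewrite -!act_comp gm_t. Qed.
Let τs (T : B) (x : elt T) : gs Y • gc τ • x = f • gs X • x.
Proof.
by rewrite -fs -!act_comp; congr (V[_] ∘ _); rewrite -(s_gdom Vfaith).
Qed.
Let τt (T : B) (x : elt T) : gt Y • gc τ • x = g • gt X • x.
Proof.
by rewrite -gts' -!act_comp; congr (V[_] ∘ _); rewrite -(t_gcod Vfaith).
Qed.
Let simp := (fs, ft, gss', gts', τs, τt, Ys, Yt, Xst, Xts, Xss, Xtt).

Lemma cell_dom_elt (T : B) (x : elt T) :
  gc τ • x = p⟨gc τ • gt X • x, f • gt X • x, f • x⟩.
Proof.
have fE : f • x = p⟨f • gt X • x, gc τ • gt X • x, gc τ • x⟩.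
  rewrite {1}[V[f]]gdom_morE mal_comp !act_comp τs.
  by rewrite Xst.
by rewrite fE (mal_solve_l HP1) ?simp.
Qed.

Lemma cell_cod_elt (T : B) (x : elt T) :
  gc τ • x = p⟨g • x, g • gs X • x, gc τ • gs X • x⟩.
Proof.
have gE : g • x = p⟨gc τ • x, gc τ • gs X • x, g • gs X • x⟩.
  rewrite {1}[V[g]]gcod_morE mal_comp !act_comp τt.
  by rewrite Xts.
by rewrite gE (mal_solve_r HP1) ?simp.
Qed.

(** In terms of diagonals the inverse of [τ : f ⇒ g] is [f τ⁻¹ g], which exists
    by (P1). *)
Lemma cell_inverse : exists σ : gcell X Y, gdom Vfaith σ = g /\
  gcod Vfaith σ = f /\ V[gc σ] = p⟨V[f], V[gc τ], V[g]⟩.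
Proof.
have [h hE] := P1_ex (gP1 (g := Y)) (s_gdom Vfaith τ)
  (eq_sym (t_gcod Vfaith τ)).
have hx (T : B) (x : elt T) : h • x = p⟨f • x, gc τ • x, g • x⟩.
  by rewrite hE mal_comp.
have sh : gs Y ∘ h = gs Y ∘ g.
  by apply: act_faithful => T x; rewrite !act_comp hx mal_nat !simp mal_r.
have th : gt Y ∘ h = gt Y ∘ f.
  by apply: act_faithful => T x; rewrite !act_comp hx mal_nat !simp mal_l.
have hs : gs Y ∘ h ∘ gs X = gs Y ∘ h by rewrite sh gid2_s.
have ht : gt Y ∘ h ∘ gt X = gt Y ∘ h by rewrite th gid2_t.
exists (GCell hs ht); split; last split => //; apply: gmor_ext; apply: Vfaith.
- rewrite [LHS]gdom_morE; apply: V_ext => T x; rewrite mal_comp /=.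
  rewrite sh !act_comp !hx.
  have -> : p⟨f • x, gc τ • x, g • x⟩ =
      p⟨f • gt X • x, gc τ • gt X • x, g • x⟩.
    rewrite (cell_dom_elt x) -{1}(mal_r p (f • x) (f • gt X • x)).
    by rewrite (mal_cancel_r HP1) ?simp.
  by rewrite (mal_cancel_l HP1) ?simp ?mal_r.
- rewrite [LHS]gcod_morE; apply: V_ext => T x; rewrite mal_comp /=.
  rewrite th !act_comp !hx.
  have -> : p⟨f • x, gc τ • x, g • x⟩ =
      p⟨f • x, gc τ • gs X • x, g • gs X • x⟩.
    rewrite (cell_cod_elt x) -{2}(mal_l p (g • x) (g • gs X • x)).
    by rewrite (mal_cancel_l HP1) ?simp.
  by rewrite (mal_cancel_r HP1) ?simp ?mal_l.
Qed.

Lemma gstar_invertible : invertible2 (K := gstar LA p Vfaith) τ.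
Proof.
have [σ [domσ [codσ σE]]] := cell_inverse.
have σx (T : B) (x : elt T) : gc σ • x = p⟨f • x, gc τ • x, g • x⟩.
  by rewrite σE mal_comp.
exists σ, (eq_sym codσ), domσ; split; apply: gcell_ext; apply: Vfaith.
- rewrite [LHS]gvcomp_morE; apply: V_ext => T x; rewrite mal_comp σx.
  by rewrite (mal_solve_l HP1) ?simp.
- rewrite [LHS]gvcomp_morE; apply: V_ext => T x; rewrite mal_comp domσ σx.
  by rewrite (mal_solve_r HP1) ?simp.
Qed.
End Invertible.

(** * Restricting the coherence axioms *)

(** The mediating morphism is returned as an unspecified [k] with its two
    projections, so that the pullbacks of the 2-category are never unfolded. *)
Lemma pre_pmul_at (S : pre_pseudocategory (gstar_pullbacks LA p Vfaith Vlim))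
    (T : gstar LA p Vfaith) (x y : hom T (pc1 S))
    (H : pcd S ∘ x = pcc S ∘ y) :
  exists k : hom (gcar T) (gcar (pcs2 S)), gm (pmul H) = gm (pcm S) ∘ k /\
    gm (pcs2_1 S) ∘ k = gm x /\ gm (pcs2_2 S) ∘ k = gm y.
Proof.
pose GA := gstar_pullbacks LA p Vfaith Vlim.
exists (gm (pb_pair GA H)); split; first by [].
split; first exact: (f_equal (@gm _ _ _ _ _ _ _) (pb1_pair GA H)).
exact: (f_equal (@gm _ _ _ _ _ _ _) (pb2_pair GA H)).
Qed.

Section Restriction.
Local Notation K := (gstar LA p Vfaith).
Local Notation GA := (gstar_pullbacks LA p Vfaith Vlim).
Variable S : pseudo_data GA.

Definition data_diagram : diagram A :=
  @Diagram A (gcar (pc1 S)) (gcar (pc0 S)) (gm (pcd S)) (gm (pcc S))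
    (gm (pce S)) (gs (pc1 S)) (gt (pc1 S)) (gc (pc_lunit S)) (gc (pc_runit S)).

Local Notation D := data_diagram.
Local Notation d := (dgd D).
Local Notation c := (dgc D).
Local Notation e := (dge D).
Local Notation s := (dgs D).
Local Notation t := (dgt D).
Local Notation λ := (dgl D).
Local Notation ρ := (dgr D).
Local Notation m := (gm (pcm S) : hom (dg2 LA D) (dgA D)).
Local Notation θ := (gc (pc_assoc S) : hom (dg3 LA D) (dgA D)).
Local Notation q2_1 := (dg2_1 LA D).
Local Notation q2_2 := (dg2_2 LA D).
Local Notation q3_1 := (dg3_1 LA D).
Local Notation q3_2 := (dg3_2 D).
Local Notation q3_3 := (dg3_3 D).

Lemma data_de : d ∘ e = idm (dgB D).
Proof. exact: (f_equal (@gm _ _ _ _ _ _ _) (pc_de S)). Qed.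
Lemma data_ce : c ∘ e = idm (dgB D).
Proof. exact: (f_equal (@gm _ _ _ _ _ _ _) (pc_ce S)). Qed.
Lemma data_dl : d ∘ λ = d.
Proof. exact: (f_equal (@gc _ _ _ _ _ _ _) (d_lunit S)). Qed.
Lemma data_cl : c ∘ λ = c.
Proof. exact: (f_equal (@gc _ _ _ _ _ _ _) (c_lunit S)). Qed.
Lemma data_dr : d ∘ ρ = d.
Proof. exact: (f_equal (@gc _ _ _ _ _ _ _) (d_runit S)). Qed.
Lemma data_cr : c ∘ ρ = c.
Proof. exact: (f_equal (@gc _ _ _ _ _ _ _) (c_runit S)). Qed.

Lemma pmul_at (T : K) (x y : hom T (pc1 S)) (H : pcd S ∘ x = pcc S ∘ y) :
  exists k : hom (gcar T) (dg2 LA D),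
    gm (pmul H) = m ∘ k /\ q2_1 ∘ k = gm x /\ q2_2 ∘ k = gm y.
Proof. exact: pre_pmul_at. Qed.

Lemma pmul2_at (T : K) (x y : cell T (pc1 S))
    (H : lwhisk (pcd S) x = lwhisk (pcc S) y) :
  exists k : hom (gcar T) (dg2 LA D),
    gc (pmul2 H) = m ∘ k /\ q2_1 ∘ k = gc x /\ q2_2 ∘ k = gc y.
Proof.
exists (gc (pb_cell GA H)); split; first by [].
split; first exact: (f_equal (@gc _ _ _ _ _ _ _) (pb1_cell GA H)).
exact: (f_equal (@gc _ _ _ _ _ _ _) (pb2_cell GA H)).
Qed.

Lemma assoc_at_at (T : K) (x y z : hom T (pc1 S)) (H1 : pcd S ∘ x = pcc S ∘ y)
    (H2 : pcd S ∘ y = pcc S ∘ z) :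
  exists k : hom (gcar T) (dg3 LA D),
    gc (assoc_at H1 H2) = θ ∘ k /\
    q3_1 ∘ k = gm x /\ q3_2 ∘ k = gm y /\ q3_3 ∘ k = gm z.
Proof.
exists (gm (tri H1 H2)); split; first by [].
split; first exact: (f_equal (@gm _ _ _ _ _ _ _) (pcs3_1_tri H1 H2)).
split; first exact: (f_equal (@gm _ _ _ _ _ _ _) (pcs3_2_tri H1 H2)).
exact: (f_equal (@gm _ _ _ _ _ _ _) (pcs3_3_tri H1 H2)).
Qed.

Lemma vcomp_at (X Y : K) (τ σ : cell X Y) (H : dom2 τ = cod2 σ) (T : A)
    (i : hom T (gcar X)) :
  V[gc (vcomp τ σ H) ∘ i] = p⟨V[gc τ ∘ i], V[gm (dom2 τ) ∘ i], V[gc σ ∘ i]⟩.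
Proof. by rewrite !fhom_comp [V[gc _]]gvcomp_morE mal_comp. Qed.

Local Notation u := (gm (dom2 (pc_runit S))).
Local Notation v := (gm (dom2 (pc_lunit S))).
Hypotheses (le : λ ∘ e = e) (re : ρ ∘ e = e).

Lemma data_m_u (T : A) (i : hom T (dg2 LA D)) (x : hom T (dgA D)) :
  q2_1 ∘ i = x -> q2_2 ∘ i = e ∘ d ∘ x -> m ∘ i = u ∘ x.
Proof.
move=> i1 i2; rewrite dom2_runit.
have [k [-> [k1 k2]]] := pmul_at (unitr_proof (idm (pc1 S))).
rewrite -comp_assoc; congr (_ ∘ _); apply: dg2_ext; rewrite comp_assoc.
  by rewrite k1 i1 comp_idl.
by rewrite k2 i2 /= comp_idr.
Qed.

Lemma data_m_v (T : A) (i : hom T (dg2 LA D)) (y : hom T (dgA D)) :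
  q2_1 ∘ i = e ∘ c ∘ y -> q2_2 ∘ i = y -> m ∘ i = v ∘ y.
Proof.
move=> i1 i2; rewrite dom2_lunit.
have [k [-> [k1 k2]]] := pmul_at (unitl_proof (idm (pc1 S))).
rewrite -comp_assoc; congr (_ ∘ _); apply: dg2_ext; rewrite comp_assoc.
  by rewrite k1 i1 /= comp_idr.
by rewrite k2 i2 comp_idl.
Qed.

Lemma data_contraction_r : contraction s t u ρ.
Proof. exact: cell_contraction (cod2_runit S). Qed.
Lemma data_contraction_l : contraction s t v λ.
Proof. exact: cell_contraction (cod2_lunit S). Qed.

Lemma data_du : d ∘ u = d.
Proof.
have E : pcd S ∘ dom2 (pc_runit S) = pcd S.
  by rewrite -dom2_lwhisk d_runit dom2_id.
exact: (f_equal (@gm _ _ _ _ _ _ _) E).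
Qed.
Lemma data_cu : c ∘ u = c.
Proof.
have E : pcc S ∘ dom2 (pc_runit S) = pcc S.
  by rewrite -dom2_lwhisk c_runit dom2_id.
exact: (f_equal (@gm _ _ _ _ _ _ _) E).
Qed.
Lemma data_dv : d ∘ v = d.
Proof.
have E : pcd S ∘ dom2 (pc_lunit S) = pcd S.
  by rewrite -dom2_lwhisk d_lunit dom2_id.
exact: (f_equal (@gm _ _ _ _ _ _ _) E).
Qed.
Lemma data_cv : c ∘ v = c.
Proof.
have E : pcc S ∘ dom2 (pc_lunit S) = pcc S.
  by rewrite -dom2_lwhisk c_lunit dom2_id.
exact: (f_equal (@gm _ _ _ _ _ _ _) E).
Qed.
Lemma data_ue : u ∘ e = e.
Proof.
have E : rwhisk (pc_runit S) (pce S) = id2 (pce S) by apply: gcell_ext.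
have E' : dom2 (pc_runit S) ∘ pce S = pce S.
  by rewrite -dom2_rwhisk E dom2_id.
exact: (f_equal (@gm _ _ _ _ _ _ _) E').
Qed.

Lemma data_is_u : is_u p (D := D) u.
Proof. exact: gdom_morE. Qed.
Lemma data_is_v : is_v p (D := D) v.
Proof. exact: gdom_morE. Qed.

Lemma data_m_ee (T : A) (i : hom T (dg2 LA D)) (z : hom T (dgB D)) :
  q2_1 ∘ i = e ∘ z -> q2_2 ∘ i = e ∘ z -> m ∘ i = e ∘ z.
Proof.
move=> i1 i2; rewrite (data_m_u i1) ?comp_assoc ?data_ue // i2.
by rewrite -!comp_assoc (comp_assoc d) data_de comp_idl.
Qed.

Lemma data_is_m : is_m p (D := D) m.
Proof.
exists u, v; split; first exact: data_is_u.
split; first exact: data_is_v.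
exact: (split_decomp data_de data_ce data_m_u data_m_ee data_m_v).
Qed.

Lemma unit_d_d : pcd S ∘ (pce S ∘ pcd S) = pcd S.
Proof. by rewrite comp_assoc pc_de comp_idl. Qed.
Lemma unit_c_d : pcc S ∘ (pce S ∘ pcd S) = pcd S.
Proof. by rewrite comp_assoc pc_ce comp_idl. Qed.
Lemma unit_d_c : pcd S ∘ (pce S ∘ pcc S) = pcc S.
Proof. by rewrite comp_assoc pc_de comp_idl. Qed.
Lemma unit_c_c : pcc S ∘ (pce S ∘ pcc S) = pcc S.
Proof. by rewrite comp_assoc pc_ce comp_idl. Qed.
Lemma match_1ed : pcd S ∘ idm (pc1 S) = pcc S ∘ (pce S ∘ pcd S).
Proof. by rewrite unit_c_d comp_idr. Qed.
Lemma match_eded : pcd S ∘ (pce S ∘ pcd S) = pcc S ∘ (pce S ∘ pcd S).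
Proof. by rewrite unit_c_d unit_d_d. Qed.
Lemma match_ec1 : pcd S ∘ (pce S ∘ pcc S) = pcc S ∘ idm (pc1 S).
Proof. by rewrite unit_d_c comp_idr. Qed.
Lemma match_ecec : pcd S ∘ (pce S ∘ pcc S) = pcc S ∘ (pce S ∘ pcc S).
Proof. by rewrite unit_d_c unit_c_c. Qed.

Local Notation α1 := (assoc_at match_1ed match_eded).
Local Notation α2 := (assoc_at match_ec1 match_1ed).
Local Notation α3 := (assoc_at match_ecec match_ec1).
Local Notation a1 := (gc α1 : hom (dgA D) (dgA D)).
Local Notation a2 := (gc α2 : hom (dgA D) (dgA D)).
Local Notation a3 := (gc α3 : hom (dgA D) (dgA D)).

Lemma data_θ_1 (T : A) (i : hom T (dg3 LA D)) (x : hom T (dgA D)) :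
  q3_1 ∘ i = x -> q3_2 ∘ i = e ∘ d ∘ x -> q3_3 ∘ i = e ∘ d ∘ x ->
  θ ∘ i = a1 ∘ x.
Proof.
move=> i1 i2 i3; have [k [-> [k1 [k2 k3]]]] := assoc_at_at match_1ed match_eded.
rewrite -comp_assoc; congr (_ ∘ _); apply: dg3_ext; rewrite comp_assoc.
- by rewrite k1 i1 comp_idl.
- by rewrite k2 i2.
- by rewrite k3 i3.
Qed.

Lemma data_θ_2 (T : A) (i : hom T (dg3 LA D)) (x : hom T (dgA D)) :
  q3_1 ∘ i = e ∘ c ∘ x -> q3_2 ∘ i = x -> q3_3 ∘ i = e ∘ d ∘ x ->
  θ ∘ i = a2 ∘ x.
Proof.
move=> i1 i2 i3; have [k [-> [k1 [k2 k3]]]] := assoc_at_at match_ec1 match_1ed.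
rewrite -comp_assoc; congr (_ ∘ _); apply: dg3_ext; rewrite comp_assoc.
- by rewrite k1 i1.
- by rewrite k2 i2 comp_idl.
- by rewrite k3 i3.
Qed.

Lemma data_θ_3 (T : A) (i : hom T (dg3 LA D)) (x : hom T (dgA D)) :
  q3_1 ∘ i = e ∘ c ∘ x -> q3_2 ∘ i = e ∘ c ∘ x -> q3_3 ∘ i = x ->
  θ ∘ i = a3 ∘ x.
Proof.
move=> i1 i2 i3; have [k [-> [k1 [k2 k3]]]] := assoc_at_at match_ecec match_ec1.
rewrite -comp_assoc; congr (_ ∘ _); apply: dg3_ext; rewrite comp_assoc.
- by rewrite k1 i1.
- by rewrite k2 i2.
- by rewrite k3 i3 comp_idl.
Qed.

Lemma data_da (x y z : hom (pc1 S) (pc1 S)) (H1 : pcd S ∘ x = pcc S ∘ y)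
    (H2 : pcd S ∘ y = pcc S ∘ z) : d ∘ gc (assoc_at H1 H2) = gm (pcd S ∘ z).
Proof. exact: (f_equal (@gc _ _ _ _ _ _ _) (d_assoc_at H1 H2)). Qed.

Lemma data_ca (x y z : hom (pc1 S) (pc1 S)) (H1 : pcd S ∘ x = pcc S ∘ y)
    (H2 : pcd S ∘ y = pcc S ∘ z) : c ∘ gc (assoc_at H1 H2) = gm (pcc S ∘ x).
Proof. exact: (f_equal (@gc _ _ _ _ _ _ _) (c_assoc_at H1 H2)). Qed.

Lemma data_da1 : d ∘ a1 = d.
Proof. by rewrite data_da unit_d_d. Qed.
Lemma data_da2 : d ∘ a2 = d.
Proof. by rewrite data_da unit_d_d. Qed.
Lemma data_da3 : d ∘ a3 = d.
Proof. by rewrite data_da comp_idr. Qed.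
Lemma data_ca1 : c ∘ a1 = c.
Proof. by rewrite data_ca comp_idr. Qed.
Lemma data_ca2 : c ∘ a2 = c.
Proof. by rewrite data_ca unit_c_c. Qed.
Lemma data_ca3 : c ∘ a3 = c.
Proof. by rewrite data_ca unit_c_c. Qed.

Lemma data_pmul_r (x : hom (pc1 S) (pc1 S))
    (H : pcd S ∘ x = pcc S ∘ (pce S ∘ pcd S)) :
  gm (pmul H) = u ∘ gm x.
Proof.
have dx : pcd S ∘ x = pcd S by rewrite H unit_c_d.
have [k [-> [k1 k2]]] := pmul_at H.
apply: data_m_u => //; rewrite k2.
by rewrite -{1}dx comp_assoc.
Qed.

Lemma data_pmul_l (y : hom (pc1 S) (pc1 S))
    (H : pcd S ∘ (pce S ∘ pcc S) = pcc S ∘ y) :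
  gm (pmul H) = v ∘ gm y.
Proof.
have cy : pcc S ∘ y = pcc S by rewrite -H unit_d_c.
have [k [-> [k1 k2]]] := pmul_at H.
apply: data_m_v => //; rewrite k1.
by rewrite -{1}cy comp_assoc.
Qed.

Lemma data_cod1 : gm (cod2 α1) = u ∘ u.
Proof. by rewrite cod2_assoc_at data_pmul_r data_pmul_r comp_idr. Qed.
Lemma data_cod2 : gm (cod2 α2) = u ∘ v.
Proof. by rewrite cod2_assoc_at data_pmul_r data_pmul_l comp_idr. Qed.
Lemma data_dom2 : gm (dom2 α2) = v ∘ u.
Proof. by rewrite dom2_assoc_at data_pmul_l data_pmul_r comp_idr. Qed.

Let eded : e ∘ d ∘ (e ∘ d) = e ∘ d.
Proof. by rewrite -comp_assoc (comp_assoc d) data_de comp_idl. Qed.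
Let ecec : e ∘ c ∘ (e ∘ c) = e ∘ c.
Proof. by rewrite -comp_assoc (comp_assoc c) data_ce comp_idl. Qed.
Let edec : e ∘ d ∘ (e ∘ c) = e ∘ c.
Proof. by rewrite -comp_assoc (comp_assoc d) data_de comp_idl. Qed.

(** The graphs of [m] and [θ].  Relations chain through the nested composites of
    the pentagon without proofs of composability appearing in the terms. *)
Definition is2 (T : A) (x y w : hom T (dgA D)) :=
  forall i : hom T (dg2 LA D), q2_1 ∘ i = x -> q2_2 ∘ i = y -> m ∘ i = w.
Definition is3 (T : A) (x y z w : hom T (dgA D)) :=
  forall i : hom T (dg3 LA D),
    q3_1 ∘ i = x -> q3_2 ∘ i = y -> q3_3 ∘ i = z -> θ ∘ i = w.

Lemma pmul_is (T : K) (x y : hom T (pc1 S)) (H : pcd S ∘ x = pcc S ∘ y)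
    (U : A) (i : hom U (gcar T)) x' y' w :
  gm x ∘ i = x' -> gm y ∘ i = y' -> is2 x' y' w -> gm (pmul H) ∘ i = w.
Proof.
have [k [-> [k1 k2]]] := pmul_at H; move=> <- <- Hw.
by rewrite -comp_assoc; apply: Hw; rewrite comp_assoc ?k1 ?k2.
Qed.

Lemma pmul2_is (T : K) (x y : cell T (pc1 S))
    (H : lwhisk (pcd S) x = lwhisk (pcc S) y)
    (U : A) (i : hom U (gcar T)) x' y' w :
  gc x ∘ i = x' -> gc y ∘ i = y' -> is2 x' y' w -> gc (pmul2 H) ∘ i = w.
Proof.
have [k [-> [k1 k2]]] := pmul2_at H; move=> <- <- Hw.
by rewrite -comp_assoc; apply: Hw; rewrite comp_assoc ?k1 ?k2.
Qed.

Lemma assoc_is (T : K) (x y z : hom T (pc1 S)) (H1 : pcd S ∘ x = pcc S ∘ y)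
    (H2 : pcd S ∘ y = pcc S ∘ z) (U : A) (i : hom U (gcar T)) x' y' z' w :
  gm x ∘ i = x' -> gm y ∘ i = y' -> gm z ∘ i = z' -> is3 x' y' z' w ->
  gc (assoc_at H1 H2) ∘ i = w.
Proof.
have [k [-> [k1 [k2 k3]]]] := assoc_at_at H1 H2; move=> <- <- <- Hw.
by rewrite -comp_assoc; apply: Hw; rewrite comp_assoc ?k1 ?k2 ?k3.
Qed.

Let m_ued (x : hom (dgA D) (dgA D)) : d ∘ x = d -> is2 x (e ∘ d) (u ∘ x).
Proof. by move=> dx i H1 H2; apply: data_m_u => //; rewrite -comp_assoc dx. Qed.
Let m_vec (x : hom (dgA D) (dgA D)) : c ∘ x = c -> is2 (e ∘ c) x (v ∘ x).
Proof. by move=> cx i H1 H2; apply: data_m_v => //; rewrite -comp_assoc cx. Qed.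
Let m_eded : is2 (e ∘ d) (e ∘ d) (e ∘ d).
Proof.
by move=> i H1 H2; rewrite (data_m_u H1) ?eded // comp_assoc data_ue.
Qed.
Let m_ecec : is2 (e ∘ c) (e ∘ c) (e ∘ c).
Proof.
by move=> i H1 H2; rewrite (data_m_u H1) ?edec // comp_assoc data_ue.
Qed.

Let θ_1ed (x : hom (dgA D) (dgA D)) :
  d ∘ x = d -> is3 x (e ∘ d) (e ∘ d) (a1 ∘ x).
Proof. by move=> dx i H1 H2 H3; apply: data_θ_1; rewrite // -comp_assoc dx. Qed.
Let θ_2ecd (x : hom (dgA D) (dgA D)) :
  c ∘ x = c -> d ∘ x = d -> is3 (e ∘ c) x (e ∘ d) (a2 ∘ x).
Proof.
by move=> cx dx i H1 H2 H3; apply: data_θ_2; rewrite // -comp_assoc ?cx ?dx.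
Qed.
Let θ_3ec (x : hom (dgA D) (dgA D)) :
  c ∘ x = c -> is3 (e ∘ c) (e ∘ c) x (a3 ∘ x).
Proof. by move=> cx i H1 H2 H3; apply: data_θ_3; rewrite // -comp_assoc cx. Qed.

Let m_1ed : is2 (idm _) (e ∘ d) u.
Proof. by move=> i H1 H2; rewrite (data_m_u H1) ?comp_idr. Qed.
Let m_ec1 : is2 (e ∘ c) (idm _) v.
Proof. by move=> i H1 H2; rewrite (data_m_v (y := idm _)) ?comp_idr. Qed.
Let θ_1edd : is3 (idm _) (e ∘ d) (e ∘ d) a1.
Proof. by move=> i H1 H2 H3; rewrite (data_θ_1 H1) ?comp_idr. Qed.
Let θ_ec1ed : is3 (e ∘ c) (idm _) (e ∘ d) a2.
Proof. by move=> i H1 H2 H3; rewrite (data_θ_2 (x := idm _)) ?comp_idr. Qed.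
Let θ_ecec1 : is3 (e ∘ c) (e ∘ c) (idm _) a3.
Proof. by move=> i H1 H2 H3; rewrite (data_θ_3 (x := idm _)) ?comp_idr. Qed.

Lemma triangle_at_1 (i : hom (dgA D) (dg2 LA D)) :
  q2_1 ∘ i = idm _ -> q2_2 ∘ i = e ∘ d ->
  V[gc (vcomp (runit_times_1 S) (triangle_assoc S) (triangle_proof S)) ∘ i] =
    p⟨V[u ∘ ρ], V[u ∘ u], V[a1]⟩ /\
  gc (one_times_lunit S) ∘ i = u.
Proof.
move=> i1 i2; rewrite vcomp_at.
have mid : e ∘ d ∘ q2_1 ∘ i = e ∘ d by rewrite -comp_assoc i1 comp_idr.
have -> : gc (triangle_assoc S) ∘ i = a1.
  rewrite /triangle_assoc.
  by apply: (assoc_is _ _ (x' := idm _) (y' := e ∘ d) (z' := e ∘ d)).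
have -> : gc (runit_times_1 S) ∘ i = u ∘ ρ.
  apply: (pmul2_is _ (x' := ρ) (y' := e ∘ d)) (m_ued data_dr) => //.
  by rewrite -[RHS]comp_idr -[X in _ = _ ∘ X]i1 comp_assoc.
split.
  rewrite triangle_proof cod2_assoc_at.
  have -> // :
      gm (pmulL (unitr_proof (pcs2_1 S)) (tri_mid_proof S)) ∘ i = u ∘ u.
  apply: (pmul_is _ (x' := u) (y' := e ∘ d)) (m_ued data_du) => //.
  by apply: (pmul_is _ (x' := idm _) (y' := e ∘ d)).
apply: (pmul2_is _ (x' := idm _) (y' := e ∘ d)) => //.
change (λ ∘ q2_2 ∘ i = e ∘ d).
by rewrite -comp_assoc i2 comp_assoc le.
Qed.

Lemma triangle_at_2 (i : hom (dgA D) (dg2 LA D)) :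
  q2_1 ∘ i = e ∘ c -> q2_2 ∘ i = idm _ ->
  V[gc (vcomp (runit_times_1 S) (triangle_assoc S) (triangle_proof S)) ∘ i] =
    p⟨V[v], V[v], V[a3]⟩ /\
  gc (one_times_lunit S) ∘ i = v ∘ λ.
Proof.
move=> i1 i2; rewrite vcomp_at.
have mid : e ∘ d ∘ q2_1 ∘ i = e ∘ c by rewrite -comp_assoc i1 edec.
have -> : gc (triangle_assoc S) ∘ i = a3.
  rewrite /triangle_assoc.
  by apply: (assoc_is _ _ (x' := e ∘ c) (y' := e ∘ c) (z' := idm _)).
have -> : gc (runit_times_1 S) ∘ i = v.
  apply: (pmul2_is _ (x' := e ∘ c) (y' := idm _)) => //.
  change (ρ ∘ q2_1 ∘ i = e ∘ c).
  by rewrite -comp_assoc i1 comp_assoc re.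
split.
  rewrite triangle_proof cod2_assoc_at.
  have -> // : gm (pmulL (unitr_proof (pcs2_1 S)) (tri_mid_proof S)) ∘ i = v.
  apply: (pmul_is _ (x' := e ∘ c) (y' := idm _)) => //.
  by apply: (pmul_is _ (x' := e ∘ c) (y' := e ∘ c)).
apply: (pmul2_is _ (x' := e ∘ c) (y' := λ)) (m_vec data_cl) => //.
by rewrite -[RHS]comp_idr -[X in _ = _ ∘ X]i2 comp_assoc.
Qed.

Local Notation pent_short S :=
  (vcomp (pent_m11 S) (pent_11m S) (pent_short_proof S)).
Local Notation pent_long S :=
  (vcomp (pent_long1 S) (pent_1a S) (pent_long2_proof S)).
(** The value of the pentagon at an arbitrary quadruple [(x,y,z,w)], in terms of
    the values of [m] and [θ] occurring in it: [xy] stands for [x ⊗ y], [xz] for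
    [x ⊗ (y ⊗ z)], [yw] for [(y ⊗ z) ⊗ w], and [b], [g] for the associators at
    [(x,y,z)] and [(y,z,w)]. *)
Lemma pentagon_at (T : A) (i : hom T (gcar (pcs4 S)))
    (x y z w xy yz zw xz yw g b s0 s1 s2 l0 l1 l2 l3 l4 : hom T (dgA D)) :
  gm (pcs4_1 S) ∘ i = x -> gm (pcs4_2 S) ∘ i = y ->
  gm (pcs4_3 S) ∘ i = z -> gm (pcs4_4 S) ∘ i = w ->
  is2 x y xy -> is2 y z yz -> is2 z w zw -> is2 x yz xz -> is2 yz w yw ->
  is3 x y z b -> is3 y z w g ->
  is3 xy z w s0 -> is2 xy zw s1 -> is3 x y zw s2 ->
  is2 b w l0 -> is2 xz w l1 -> is3 x yz w l2 -> is2 x yw l3 -> is2 x g l4 ->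
  V[gc (pent_short S) ∘ i] = p⟨V[s0], V[s1], V[s2]⟩ /\
  V[gc (pent_long S) ∘ i] = p⟨p⟨V[l0], V[l1], V[l2]⟩, V[l3], V[l4]⟩.
Proof.
move=> i1 i2 i3 i4 Hxy Hyz Hzw Hxz Hyw Hb Hg Hs0 Hs1 Hs2 Hl0 Hl1 Hl2 Hl3 Hl4.
have exy := pmul_is (pcs4_12 S) i1 i2 Hxy.
have eyz := pmul_is (pcs4_23 S) i2 i3 Hyz.
have ezw := pmul_is (pcs4_34 S) i3 i4 Hzw.
have exz := pmul_is (pmulR_proof (pcs4_12 S) (pcs4_23 S)) i1 eyz Hxz.
have eyw := pmul_is (pmulL_proof (pcs4_23 S) (pcs4_34 S)) eyz i4 Hyw.
have eb := assoc_is (pcs4_12 S) (pcs4_23 S) i1 i2 i3 Hb.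
have eg := assoc_is (pcs4_23 S) (pcs4_34 S) i2 i3 i4 Hg.
have es0 : gc (pent_m11 S) ∘ i = s0 := assoc_is
  (pmulL_proof (pcs4_12 S) (pcs4_23 S)) (pcs4_34 S) exy i3 i4 Hs0.
have es2 : gc (pent_11m S) ∘ i = s2 := assoc_is
  (pcs4_12 S) (pmulR_proof (pcs4_23 S) (pcs4_34 S)) i1 i2 ezw Hs2.
have el2 : gc (pent_1m1 S) ∘ i = l2 := assoc_is
  (pmulR_proof (pcs4_12 S) (pcs4_23 S)) (pmulL_proof (pcs4_23 S) (pcs4_34 S))
  i1 eyz i4 Hl2.
have iw : gc (id2 (pcs4_4 S)) ∘ i = w by exact: i4.
have ix : gc (id2 (pcs4_1 S)) ∘ i = x by exact: i1.
have el0 : gc (pent_a1 S) ∘ i = l0 := pmul2_is (pent_a1_proof S) eb iw Hl0.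
have el4 : gc (pent_1a S) ∘ i = l4 := pmul2_is (pent_1a_proof S) ix eg Hl4.
have es1 : gm (pmulR (pmulL_proof (pcs4_12 S) (pcs4_23 S)) (pcs4_34 S)) ∘ i
    = s1 := pmul_is (pmulR_proof (pmulL_proof (pcs4_12 S) (pcs4_23 S))
    (pcs4_34 S)) exy ezw Hs1.
have el1 : gm (pmulL (pmulR_proof (pcs4_12 S) (pcs4_23 S))
    (pmulL_proof (pcs4_23 S) (pcs4_34 S))) ∘ i = l1 :=
  pmul_is (pmulL_proof (pmulR_proof (pcs4_12 S) (pcs4_23 S))
    (pmulL_proof (pcs4_23 S) (pcs4_34 S))) exz i4 Hl1.
have el3 : gm (pmulR (pmulR_proof (pcs4_12 S) (pcs4_23 S))
    (pmulL_proof (pcs4_23 S) (pcs4_34 S))) ∘ i = l3 :=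
  pmul_is (pmulR_proof (pmulR_proof (pcs4_12 S) (pcs4_23 S))
    (pmulL_proof (pcs4_23 S) (pcs4_34 S))) i1 eyw Hl3.
split; rewrite vcomp_at.
  by rewrite es0 es2 dom2_assoc_at es1.
rewrite el4 dom2_vcomp dom2_assoc_at el3 vcomp_at el0 el2.
by rewrite (pent_long1_proof S) cod2_assoc_at el1.
Qed.

Hypothesis a1e : a1 ∘ e = e.

Let θ_eded : is3 (e ∘ d) (e ∘ d) (e ∘ d) (e ∘ d).
Proof.
by move=> i H1 H2 H3; rewrite (data_θ_1 H1) ?eded // comp_assoc a1e.
Qed.
Let θ_ecec : is3 (e ∘ c) (e ∘ c) (e ∘ c) (e ∘ c).
Proof.
by move=> i H1 H2 H3; rewrite (data_θ_1 H1) ?edec // comp_assoc a1e.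
Qed.

Let dd (f g : hom (dgA D) (dgA D)) : d ∘ f = d -> d ∘ g = d -> d ∘ (f ∘ g) = d.
Proof. by move=> df dg; rewrite comp_assoc df. Qed.
Let cc (f g : hom (dgA D) (dgA D)) : c ∘ f = c -> c ∘ g = c -> c ∘ (f ∘ g) = c.
Proof. by move=> cf cg; rewrite comp_assoc cf. Qed.

Lemma pentagon_at_1 (i : hom (dgA D) (gcar (pcs4 S))) :
  gm (pcs4_1 S) ∘ i = idm _ -> gm (pcs4_2 S) ∘ i = e ∘ d ->
  gm (pcs4_3 S) ∘ i = e ∘ d -> gm (pcs4_4 S) ∘ i = e ∘ d ->
  V[gc (pent_short S) ∘ i] = p⟨V[a1 ∘ u], V[u ∘ u], V[a1]⟩ /\
  V[gc (pent_long S) ∘ i] =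
    p⟨p⟨V[u ∘ a1], V[u ∘ u], V[a1]⟩, V[u], V[u]⟩.
Proof.
move=> i1 i2 i3 i4.
exact (pentagon_at i1 i2 i3 i4 m_1ed m_eded m_eded m_1ed m_eded θ_1edd θ_eded
  (θ_1ed data_du) (m_ued data_du) θ_1edd (m_ued data_da1) (m_ued data_du)
  θ_1edd m_1ed m_1ed).
Qed.

Lemma pentagon_at_2 (i : hom (dgA D) (gcar (pcs4 S))) :
  gm (pcs4_1 S) ∘ i = e ∘ c -> gm (pcs4_2 S) ∘ i = idm _ ->
  gm (pcs4_3 S) ∘ i = e ∘ d -> gm (pcs4_4 S) ∘ i = e ∘ d ->
  V[gc (pent_short S) ∘ i] = p⟨V[a1 ∘ v], V[u ∘ v], V[a2]⟩ /\
  V[gc (pent_long S) ∘ i] =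
    p⟨p⟨V[u ∘ a2], V[u ∘ (v ∘ u)], V[a2 ∘ u]⟩, V[v ∘ (u ∘ u)], V[v ∘ a1]⟩.
Proof.
move=> i1 i2 i3 i4.
exact (pentagon_at i1 i2 i3 i4 m_ec1 m_1ed m_eded (m_vec data_cu)
  (m_ued data_du) θ_ec1ed θ_1edd (θ_1ed data_dv) (m_ued data_dv) θ_ec1ed
  (m_ued data_da2) (m_ued (dd data_dv data_du))
  (θ_2ecd data_cu data_du) (m_vec (cc data_cu data_cu)) (m_vec data_ca1)).
Qed.

Lemma pentagon_at_3 (i : hom (dgA D) (gcar (pcs4 S))) :
  gm (pcs4_1 S) ∘ i = e ∘ c -> gm (pcs4_2 S) ∘ i = e ∘ c ->
  gm (pcs4_3 S) ∘ i = idm _ -> gm (pcs4_4 S) ∘ i = e ∘ d ->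
  V[gc (pent_short S) ∘ i] = p⟨V[a2], V[v ∘ u], V[a3 ∘ u]⟩ /\
  V[gc (pent_long S) ∘ i] =
    p⟨p⟨V[u ∘ a3], V[u ∘ (v ∘ v)], V[a2 ∘ v]⟩, V[v ∘ (u ∘ v)], V[v ∘ a2]⟩.
Proof.
move=> i1 i2 i3 i4.
exact (pentagon_at i1 i2 i3 i4 m_ecec m_ec1 m_1ed (m_vec data_cv)
  (m_ued data_dv) θ_ecec1 θ_ec1ed θ_ec1ed (m_vec data_cu) (θ_3ec data_cu)
  (m_ued data_da3) (m_ued (dd data_dv data_dv))
  (θ_2ecd data_cv data_dv) (m_vec (cc data_cu data_cv)) (m_vec data_ca2)).
Qed.

Lemma pentagon_at_4 (i : hom (dgA D) (gcar (pcs4 S))) :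
  gm (pcs4_1 S) ∘ i = e ∘ c -> gm (pcs4_2 S) ∘ i = e ∘ c ->
  gm (pcs4_3 S) ∘ i = e ∘ c -> gm (pcs4_4 S) ∘ i = idm _ ->
  V[gc (pent_short S) ∘ i] = p⟨V[a3], V[v ∘ v], V[a3 ∘ v]⟩ /\
  V[gc (pent_long S) ∘ i] =
    p⟨p⟨V[v], V[v], V[a3]⟩, V[v ∘ v], V[v ∘ a3]⟩.
Proof.
move=> i1 i2 i3 i4.
exact (pentagon_at i1 i2 i3 i4 m_ecec m_ecec m_ec1 m_ecec m_ec1
  θ_ecec θ_ecec1 θ_ecec1 (m_vec data_cv) (θ_3ec data_cv) m_ec1 m_ec1
  θ_ecec1 (m_vec data_cv) (m_vec data_ca3)).
Qed.

Lemma wm_pcs4 (wmA : weakly_maltsev LA) (W : A)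
    (h k : hom (gcar (pcs4 S)) W) :
  (forall i : hom (dgA D) (gcar (pcs4 S)), gm (pcs4_1 S) ∘ i = idm _ ->
     gm (pcs4_2 S) ∘ i = e ∘ d -> gm (pcs4_3 S) ∘ i = e ∘ d ->
     gm (pcs4_4 S) ∘ i = e ∘ d -> h ∘ i = k ∘ i) ->
  (forall i : hom (dgA D) (gcar (pcs4 S)), gm (pcs4_1 S) ∘ i = e ∘ c ->
     gm (pcs4_2 S) ∘ i = idm _ -> gm (pcs4_3 S) ∘ i = e ∘ d ->
     gm (pcs4_4 S) ∘ i = e ∘ d -> h ∘ i = k ∘ i) ->
  (forall i : hom (dgA D) (gcar (pcs4 S)), gm (pcs4_1 S) ∘ i = e ∘ c ->
     gm (pcs4_2 S) ∘ i = e ∘ c -> gm (pcs4_3 S) ∘ i = idm _ ->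
     gm (pcs4_4 S) ∘ i = e ∘ d -> h ∘ i = k ∘ i) ->
  (forall i : hom (dgA D) (gcar (pcs4 S)), gm (pcs4_1 S) ∘ i = e ∘ c ->
     gm (pcs4_2 S) ∘ i = e ∘ c -> gm (pcs4_3 S) ∘ i = e ∘ c ->
     gm (pcs4_4 S) ∘ i = idm _ -> h ∘ i = k ∘ i) ->
  h = k.
Proof.
move=> H1 H2 H3 H4.
have [r [r1 [r2 r3]]] : exists r : hom (dgB D) (dg3 LA D),
    q3_1 ∘ r = e /\ q3_2 ∘ r = e /\ q3_3 ∘ r = e.
  by apply: (dg3_ex (D := D)); rewrite data_de data_ce.
pose q := gm (pb2 GA (pcd S) (pcc S ∘ pcs3_1 S)).
have E2 T (i : hom T (gcar (pcs4 S))) : gm (pcs4_2 S) ∘ i = q3_1 ∘ (q ∘ i).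
  by rewrite comp_assoc.
have E3 T (i : hom T (gcar (pcs4 S))) : gm (pcs4_3 S) ∘ i = q3_2 ∘ (q ∘ i).
  by rewrite comp_assoc.
have E4 T (i : hom T (gcar (pcs4 S))) : gm (pcs4_4 S) ∘ i = q3_3 ∘ (q ∘ i).
  by rewrite comp_assoc.
apply: (wm_pb wmA (r := e) (s := r) (f := gm (pcd S))
  (g := gm (pcc S ∘ pcs3_1 S))).
- exact: data_de.
- change (c ∘ q3_1 ∘ r = idm (dgB D)).
  by rewrite -comp_assoc r1 data_ce.
- move=> i i1 i2; apply: H1 => //.
  + by rewrite E2 [q ∘ i]i2 comp_assoc r1.
  + by rewrite E3 [q ∘ i]i2 comp_assoc r2.
  + by rewrite E4 [q ∘ i]i2 comp_assoc r3.
- move=> j j1 j2.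
  have F1 T (i : hom T _) : gm (pcs4_1 S) ∘ (j ∘ i) = e ∘ c ∘ (q3_1 ∘ i).
    rewrite (comp_assoc (gm (pcs4_1 S))) [gm (pcs4_1 S) ∘ j]j1.
    by change (e ∘ (c ∘ q3_1) ∘ i = e ∘ c ∘ (q3_1 ∘ i)); rewrite !comp_assoc.
  have Fq T (i : hom T _) : q ∘ (j ∘ i) = i.
    by rewrite (comp_assoc q) [q ∘ j]j2 comp_idl.
  apply: (wm3 wmA data_de data_ce) => i i1 i2 i3; rewrite -!comp_assoc.
  + by apply: H2; rewrite ?F1 ?E2 ?E3 ?E4 ?Fq ?i1 ?i2 ?i3 ?comp_idr.
  + by apply: H3; rewrite ?F1 ?E2 ?E3 ?E4 ?Fq ?i1 ?i2 ?i3 ?ecec.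
  + by apply: H4; rewrite ?F1 ?E2 ?E3 ?E4 ?Fq ?i1 ?i2 ?i3 ?ecec.
Qed.

Section Coherent.
Hypothesis wmA : weakly_maltsev LA.
Hypothesis a1E : V[a1] = p⟨V[u ∘ u], V[ρ ∘ ρ], V[ρ]⟩.
Hypothesis a2E : V[a2] = p⟨V[u ∘ v], V[ρ ∘ λ], V[λ ∘ ρ]⟩.
Hypothesis a3E : V[a3] = p⟨V[v], V[λ], V[λ ∘ λ]⟩.

Let HP1 := gP1 (g := pc1 S).
Let st : s ∘ t = t := gst (pc1 S).
Let ts : t ∘ s = s := gts (pc1 S).
Let Hr := data_contraction_r.
Let Hl := data_contraction_l.

Lemma coherent_triangle : triangle S.
Proof.
apply: gcell_ext; apply: (wm2 wmA data_de data_ce) => i i1 i2; apply: Vfaith.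
  have [-> ->] := triangle_at_1 i1 i2.
  exact (canonical_triangle_1 HP1 st ts Hr a1E).
have [-> ->] := triangle_at_2 i1 i2.
exact (canonical_triangle_2 HP1 st ts Hl a3E).
Qed.

Lemma coherent_pentagon : pentagon S.
Proof.
apply: gcell_ext; apply: wm_pcs4 => // i i1 i2 i3 i4; apply: Vfaith.
- have [-> ->] := pentagon_at_1 i1 i2 i3 i4.
  exact (canonical_pentagon_1 HP1 st ts Hr a1E).
- have [-> ->] := pentagon_at_2 i1 i2 i3 i4.
  exact (canonical_pentagon_2 HP1 st ts Hr Hl a1E a2E).
- have [-> ->] := pentagon_at_3 i1 i2 i3 i4.
  exact (canonical_pentagon_3 HP1 st ts Hr Hl a2E a3E).
- have [-> ->] := pentagon_at_4 i1 i2 i3 i4.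
  exact (canonical_pentagon_4 HP1 st ts Hl a3E).
Qed.
End Coherent.

(** * The diagram of an internal bicategory *)

Section FromBicategory.
Hypotheses (Htri : triangle S) (Hpent : pentagon S).
Let HP1 := gP1 (g := pc1 S).
Let st : s ∘ t = t := gst (pc1 S).
Let ts : t ∘ s = s := gts (pc1 S).
Let Hr := data_contraction_r.
Let Hl := data_contraction_l.

Lemma assoc_canonical_1 : V[a1] = p⟨V[u ∘ u], V[ρ ∘ ρ], V[ρ]⟩.
Proof.
have [i [i1 i2]] : exists i : hom (dgA D) (dg2 LA D),
    q2_1 ∘ i = idm _ /\ q2_2 ∘ i = e ∘ d.
  by apply: dg2_ex; rewrite comp_idr comp_assoc data_ce comp_idl.
have [E1 E2] := triangle_at_1 i1 i2.
apply: (triangle_determines_1 HP1 st ts Hr).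
  by rewrite -data_cod1; symmetry; apply: t_gcod.
by rewrite -E1 -{1}E2 Htri.
Qed.

Lemma assoc_unit_3 : V[v ∘ λ] = p⟨V[v], V[v], V[a3]⟩.
Proof.
have [i [i1 i2]] : exists i : hom (dgA D) (dg2 LA D),
    q2_1 ∘ i = e ∘ c /\ q2_2 ∘ i = idm _.
  by apply: dg2_ex; rewrite comp_idr comp_assoc data_de comp_idl.
have [E1 E2] := triangle_at_2 i1 i2.
by rewrite -E1 -E2 Htri.
Qed.

Lemma assoc_canonical_3 : V[a3] = p⟨V[v], V[λ], V[λ ∘ λ]⟩.
Proof. exact: (triangle_determines_3 HP1 st ts Hl assoc_unit_3). Qed.

(** The pentagon is used at [(1,1,x,1)].  The other hypothesis of
    [pentagon_determines_2] compares the two pastings of the horizontal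
    composite of [α2] and [λ]. *)
Lemma assoc_canonical_2 : V[a2] = p⟨V[u ∘ v], V[ρ ∘ λ], V[λ ∘ ρ]⟩.
Proof.
have H3 : pcd S ∘ (pce S ∘ pcc S) = pcc S ∘ pcs3_1 S ∘ tri match_ec1 match_1ed.
  by rewrite -comp_assoc pcs3_1_tri match_ecec.
pose i : hom (pc1 S) (pcs4 S) := pb_pair GA H3.
have i1 : pcs4_1 S ∘ i = pce S ∘ pcc S by apply: pb1_pair.
have i234 : pcs4_234 S ∘ i = tri match_ec1 match_1ed by apply: pb2_pair.
have i2 : pcs4_2 S ∘ i = pce S ∘ pcc S.
  by rewrite /pcs4_2 -comp_assoc i234 pcs3_1_tri.
have i3 : pcs4_3 S ∘ i = idm (pc1 S).
  by rewrite /pcs4_3 -comp_assoc i234 pcs3_2_tri.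
have i4 : pcs4_4 S ∘ i = pce S ∘ pcd S.
  by rewrite /pcs4_4 -comp_assoc i234 pcs3_3_tri.
have := pentagon_at_3 (f_equal (@gm _ _ _ _ _ _ _) i1)
  (f_equal (@gm _ _ _ _ _ _ _) i2) (f_equal (@gm _ _ _ _ _ _ _) i3)
  (f_equal (@gm _ _ _ _ _ _ _) i4).
rewrite Hpent => -[-> E].
have a3E : a3 = v ∘ λ by apply: Vfaith; rewrite assoc_unit_3 mal_r.
rewrite a3E in E.
apply: (pentagon_determines_2 HP1 st ts Hr Hl).
- by rewrite -data_dom2; symmetry; apply: s_gdom.
- by rewrite -data_cod2; symmetry; apply: t_gcod.
- have El : V[a2 ∘ λ] = p⟨V[u ∘ v ∘ λ], V[u ∘ v ∘ v], V[a2 ∘ v]⟩.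
    by rewrite -data_cod2; exact: cell_interchange_l.
  have Er : V[a2 ∘ λ] = p⟨V[a2], V[v ∘ u], V[v ∘ u ∘ λ]⟩.
    rewrite -data_dom2 (cell_interchange_r α2 (pc_lunit S)).
    have -> : gcod Vfaith (pc_lunit S) = gid (pc1 S) by exact (cod2_lunit S).
    by rewrite !comp_idr.
  by rewrite !comp_assoc -El.
- by rewrite comp_assoc E.
Qed.

Lemma assoc_unit_e : a1 ∘ e = e.
Proof.
apply: Vfaith; rewrite fhom_comp assoc_canonical_1 mal_comp -!fhom_comp.
by rewrite -!comp_assoc !re !data_ue mal_l.
Qed.

Lemma data_is_alpha1 : is_alpha1 p (D := D) a1.
Proof.
rewrite /is_alpha1 assoc_canonical_1; apply: V_ext => T x.
by rewrite !mal_comp !act_comp (alpha1E HP1 st ts Hr).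
Qed.

Lemma data_is_alpha2 : is_alpha2 p (D := D) a2.
Proof.
rewrite /is_alpha2 assoc_canonical_2; apply: V_ext => T x.
by rewrite !mal_comp !act_comp (alpha2E HP1 st ts Hr Hl).
Qed.

Lemma data_is_alpha3 : is_alpha3 p (D := D) a3.
Proof.
rewrite /is_alpha3 assoc_canonical_3; apply: V_ext => T x.
by rewrite !mal_comp !act_comp (alpha3E HP1 st ts Hl).
Qed.

Lemma data_θ_e (T : A) (i : hom T (dg3 LA D)) (z : hom T (dgB D)) :
  q3_1 ∘ i = e ∘ z -> q3_2 ∘ i = e ∘ z -> q3_3 ∘ i = e ∘ z -> θ ∘ i = e ∘ z.
Proof.
move=> i1 i2 i3.
have edz : e ∘ d ∘ (e ∘ z) = e ∘ z.
  by rewrite -!comp_assoc (comp_assoc d) data_de comp_idl.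
by rewrite (data_θ_1 i1) ?edz // comp_assoc assoc_unit_e.
Qed.

(** [j] is the inclusion [(y,z) ↦ (1,y,z)], so that [θ ∘ j] plays the role of
    [μ]; [split_decomp] is applied to it, and then to [θ] with the pair
    [(y,z)] as one variable. *)
Lemma data_is_theta : is_theta p (D := D) θ.
Proof.
have [ee [ee1 ee2]] : exists ee : hom (dgB D) (dg2 LA D),
    q2_1 ∘ ee = e /\ q2_2 ∘ ee = e by apply: dg2_ex; rewrite data_de data_ce.
have H : d ∘ (e ∘ c ∘ q2_1) = c ∘ q2_1 ∘ idm _.
  by rewrite comp_idr !comp_assoc data_de comp_idl.
pose j := pb_pair LA H.
have j1 : q3_1 ∘ j = e ∘ c ∘ q2_1 by apply: pb1_pair.
have j23 : dg3_23 LA D ∘ j = idm _ by apply: pb2_pair.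
have j2 T (i : hom T (dg2 LA D)) : q3_2 ∘ (j ∘ i) = q2_1 ∘ i.
  by rewrite /dg3_2 -comp_assoc (comp_assoc (dg3_23 LA D)) j23 comp_idl.
have j3 T (i : hom T (dg2 LA D)) : q3_3 ∘ (j ∘ i) = q2_2 ∘ i.
  by rewrite /dg3_3 -comp_assoc (comp_assoc (dg3_23 LA D)) j23 comp_idl.
have j1' T (i : hom T (dg2 LA D)) : q3_1 ∘ (j ∘ i) = e ∘ c ∘ (q2_1 ∘ i).
  by rewrite (comp_assoc q3_1) j1 -!comp_assoc.
have ez T (z : hom T (dgB D)) : e ∘ c ∘ (e ∘ z) = e ∘ z.
  by rewrite -!comp_assoc (comp_assoc c) data_ce comp_idl.
have Hmu : is_mu p (D := D) (θ ∘ j).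
{  exists a2, a3; split; first exact: data_is_alpha2.
  split; first exact: data_is_alpha3.
  apply: (split_decomp data_de data_ce) => T i x i1 i2; rewrite -comp_assoc.
  - by apply: data_θ_2; rewrite ?j1' ?j2 ?j3 ?[q2_1 ∘ i]i1 ?[q2_2 ∘ i]i2.
  - by apply: data_θ_e; rewrite ?j1' ?j2 ?j3 ?[q2_1 ∘ i]i1 ?[q2_2 ∘ i]i2 ?ez.
  - apply: data_θ_3; rewrite ?j1' ?j2 ?j3 ?[q2_1 ∘ i]i1 ?[q2_2 ∘ i]i2 //.
    by rewrite -(comp_assoc e c x) ez. }
exists a1, (θ ∘ j); split; first exact: data_is_alpha1.
split; first exact: Hmu.
apply: (split_decomp (s := ee) data_de) =>
  [|T i x i1 i2|T i x i1 i2|T i x i1 i2].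
- by rewrite -comp_assoc ee1 data_ce.
- apply: data_θ_1 => //; rewrite /dg3_2 /dg3_3 -comp_assoc [dg3_23 LA D ∘ i]i2.
    by rewrite !comp_assoc ee1.
  by rewrite !comp_assoc ee2.
- apply: data_θ_e => //; rewrite /dg3_2 /dg3_3 -comp_assoc [dg3_23 LA D ∘ i]i2.
    by rewrite !comp_assoc ee1.
  by rewrite !comp_assoc ee2.
- rewrite -comp_assoc; congr (_ ∘ _).
  apply: (pb_ext LA).
    by rewrite [LHS]i1 [RHS]j1' -!comp_assoc.
  by rewrite [LHS]i2 comp_assoc [X in X ∘ x]j23 comp_idl.
Qed.
End FromBicategory.

End Restriction.

Section Existence.
Local Notation K := (gstar LA p Vfaith).
Local Notation GA := (gstar_pullbacks LA p Vfaith Vlim).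

Lemma diagram_of_bicategory (C : internal_bicategory LA p Vfaith Vlim) :
  bicategory_diagram LA p (diagram_of C) /\
  is_m p (D := diagram_of C) (gm (pcm C)) /\
  is_theta p (D := diagram_of C) (gc (pc_assoc C)).
Proof.
have [s1 t1] := ib_discrete C.
have [hl hr] := ib_homogeneous C.
have le : gc (pc_lunit C) ∘ gm (pce C) = gm (pce C).
  exact: (f_equal (@gc _ _ _ _ _ _ _) hl).
have re : gc (pc_runit C) ∘ gm (pce C) = gm (pce C).
  exact: (f_equal (@gc _ _ _ _ _ _ _) hr).
have Hm : is_m p (D := diagram_of C) (gm (pcm C)) := data_is_m re.
have Hth : is_theta p (D := diagram_of C) (gc (pc_assoc C)) :=
  data_is_theta le re (ps_triangle C) (ps_pentagon C).
split; last by [].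
have Hl := f_equal (@gm _ _ _ _ _ _ _) (cod2_lunit C).
have Hr := f_equal (@gm _ _ _ _ _ _ _) (cod2_runit C).
split => //.
- exact: data_de.
- exact: data_ce.
- exact: gst.
- exact: gts.
- by rewrite /= -gm_s s1 comp_idl.
- by rewrite /= -gm_t t1 comp_idl.
- by rewrite /= -gm_s s1 comp_idl.
- by rewrite /= -gm_t t1 comp_idl.
- by rewrite /= gm_s s1 comp_idr.
- by rewrite /= gm_t t1 comp_idr.
- exact: data_dl.
- exact: data_dr.
- exact: data_cl.
- exact: data_cr.
- by rewrite -(gcod_morE (pc_lunit C)) [gcod_mor _]Hl fhom_id.
- by rewrite -(gcod_morE (pc_runit C)) [gcod_mor _]Hr fhom_id.
- exact: gP1.
- have [a1 [mu [_ [Hmu _]]]] := Hth.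
  by exists (gm (pcm C)), mu.
- by exists (gc (pc_assoc C)).
Qed.

(** * The bicategory of a diagram *)

Section FromDiagram.
Variables (D : diagram A) (HD : bicategory_diagram LA p D).
Hypothesis wmA : weakly_maltsev LA.
Local Notation d := (dgd D).
Local Notation c := (dgc D).
Local Notation e := (dge D).
Local Notation s := (dgs D).
Local Notation t := (dgt D).
Local Notation λ := (dgl D).
Local Notation ρ := (dgr D).
Local Notation q2_1 := (dg2_1 LA D).
Local Notation q2_2 := (dg2_2 LA D).
Local Notation q3_1 := (dg3_1 LA D).
Local Notation q3_2 := (dg3_2 D).
Local Notation q3_3 := (dg3_3 D).

Variables u v a1 a2 a3 : hom (dgA D) (dgA D).
Variables (m mu : hom (dg2 LA D) (dgA D)) (th : hom (dg3 LA D) (dgA D)).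
Hypotheses (Hu : is_u p u) (Hv : is_v p v).
Hypotheses (H1 : is_alpha1 p a1) (H2 : is_alpha2 p a2) (H3 : is_alpha3 p a3).
Hypothesis Hm : V[m] =
  p⟨V[u ∘ dg2_1 LA D], V[e ∘ d ∘ dg2_1 LA D], V[v ∘ dg2_2 LA D]⟩.
Hypothesis Hmu : V[mu] =
  p⟨V[a2 ∘ dg2_1 LA D], V[e ∘ d ∘ dg2_1 LA D], V[a3 ∘ dg2_2 LA D]⟩.
Hypothesis Hth : V[th] =
  p⟨V[a1 ∘ dg3_1 LA D], V[e ∘ d ∘ dg3_1 LA D], V[mu ∘ dg3_23 LA D]⟩.

Let de := bd_de HD.
Let ce := bd_ce HD.
Let st := bd_st HD.
Let ts := bd_ts HD.
Let HP1 := bd_P1 HD.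
Let tl := cod_id_t HD (bd_codl HD).
Let tr := cod_id_t HD (bd_codr HD).

Lemma unit_2cell_l : s ∘ λ ∘ s = s ∘ λ.
Proof. exact: (lam_s HD Hu Hv H2 H3 Hm Hmu). Qed.

Lemma unit_2cell_r : s ∘ ρ ∘ s = s ∘ ρ.
Proof. exact: (rho_s HD Hu Hv H1 H2 H3 Hm Hmu Hth). Qed.

Let Hr : contraction s t u ρ.
Proof.
exact: (unit_contraction HP1 st ts unit_2cell_r tr
  (cod_id_elt HD (bd_codr HD)) Hu).
Qed.

Let Hl : contraction s t v λ.
Proof.
exact: (unit_contraction HP1 st ts unit_2cell_l tl
  (cod_id_elt HD (bd_codl HD)) Hv).
Qed.

Let a1E : V[a1] = p⟨V[u ∘ u], V[ρ ∘ ρ], V[ρ]⟩.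
Proof.
rewrite H1; apply: V_ext => T x.
by rewrite !mal_comp !act_comp (alpha1E HP1 st ts Hr).
Qed.
Let a2E : V[a2] = p⟨V[u ∘ v], V[ρ ∘ λ], V[λ ∘ ρ]⟩.
Proof.
rewrite H2; apply: V_ext => T x.
by rewrite !mal_comp !act_comp (alpha2E HP1 st ts Hr Hl).
Qed.
Let a3E : V[a3] = p⟨V[v], V[λ], V[λ ∘ λ]⟩.
Proof.
rewrite H3; apply: V_ext => T x.
by rewrite !mal_comp !act_comp (alpha3E HP1 st ts Hl).
Qed.

Let Huu := contraction_comp HP1 st ts Hr Hr.
Let Huv := contraction_comp HP1 st ts Hr Hl.
Let Hvu := contraction_comp HP1 st ts Hl Hr.
Let Hvv := contraction_comp HP1 st ts Hl Hl.

(** With [f] equal to [d] or [c], this places the cells built by [p] over the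
    same objects as their entries. *)
Let over_mal (Z : A) (f : hom (dgA D) Z) (g k k' a : hom (dgA D) (dgA D)) :
  V[a] = p⟨V[g], V[k], V[k']⟩ ->
  f ∘ g = f -> f ∘ k = f -> f ∘ k' = f -> f ∘ a = f.
Proof.
move=> aE fg fk fk'; apply: Vfaith.
by rewrite fhom_comp aE mal_nat -!fhom_comp fg fk fk' mal_l.
Qed.

Let over2 (Z : A) (f : hom (dgA D) Z) (g k : hom (dgA D) (dgA D)) :
  f ∘ g = f -> f ∘ k = f -> f ∘ (g ∘ k) = f.
Proof. by move=> fg fk; rewrite comp_assoc fg. Qed.

Let over_formulas (Z : A) (f : hom (dgA D) Z) :
  f ∘ s = f -> f ∘ t = f -> f ∘ λ = f -> f ∘ ρ = f ->
  (f ∘ u = f /\ f ∘ v = f) /\ f ∘ a1 = f /\ f ∘ a2 = f /\ f ∘ a3 = f.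
Proof.
move=> fs ft fl fr.
have fu : f ∘ u = f by apply: (over_mal Hu); rewrite -?comp_assoc ?over2.
have fv : f ∘ v = f by apply: (over_mal Hv); rewrite -?comp_assoc ?over2.
split; first by [].
by split; [|split]; [apply: (over_mal a1E)|apply: (over_mal a2E)|
  apply: (over_mal a3E)]; rewrite ?over2.
Qed.

Let fix_mal (g k k' a : hom (dgA D) (dgA D)) :
  V[a] = p⟨V[g], V[k], V[k']⟩ ->
  g ∘ e = e -> k ∘ e = e -> k' ∘ e = e -> a ∘ e = e.
Proof.
move=> aE ge ke ke'; apply: Vfaith.
by rewrite fhom_comp aE mal_comp -!fhom_comp ge ke ke' mal_l.
Qed.

Let fix2 (g k : hom (dgA D) (dgA D)) : g ∘ e = e -> k ∘ e = e -> g ∘ k ∘ e = e.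
Proof. by move=> ge ke; rewrite -comp_assoc ke. Qed.

Let le := bd_le HD.
Let re := bd_re HD.
Let se := bd_se HD.
Let te := bd_te HD.
Let ue : u ∘ e = e. Proof. by apply: (fix_mal Hu); rewrite ?fix2. Qed.
Let ve : v ∘ e = e. Proof. by apply: (fix_mal Hv); rewrite ?fix2. Qed.
Let a1e : a1 ∘ e = e. Proof. by apply: (fix_mal a1E); rewrite ?fix2. Qed.
Let a2e : a2 ∘ e = e. Proof. by apply: (fix_mal a2E); rewrite ?fix2. Qed.
Let a3e : a3 ∘ e = e. Proof. by apply: (fix_mal a3E); rewrite ?fix2. Qed.

Let Hd := over_formulas (bd_ds HD) (bd_dt HD) (bd_dl HD) (bd_dr HD).
Let Hc := over_formulas (bd_cs HD) (bd_ct HD) (bd_cl HD) (bd_cr HD).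
Let du := proj1 (proj1 Hd).
Let dv := proj2 (proj1 Hd).
Let da1 := proj1 (proj2 Hd).
Let da2 := proj1 (proj2 (proj2 Hd)).
Let da3 := proj2 (proj2 (proj2 Hd)).
Let cu := proj1 (proj1 Hc).
Let cv := proj2 (proj1 Hc).
Let ca1 := proj1 (proj2 Hc).
Let ca2 := proj1 (proj2 (proj2 Hc)).
Let ca3 := proj2 (proj2 (proj2 Hc)).

Let edz (T : A) (x : hom T (dgB D)) : e ∘ d ∘ (e ∘ x) = e ∘ x.
Proof. by rewrite -!comp_assoc (comp_assoc d) de comp_idl. Qed.

Let m_u (T : A) (i : hom T (dg2 LA D)) (x : hom T (dgA D)) :
  q2_1 ∘ i = x -> q2_2 ∘ i = e ∘ d ∘ x -> m ∘ i = u ∘ x.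
Proof.
move=> i1 i2; apply: Vfaith.
rewrite fhom_comp Hm mal_comp -!fhom_comp -!comp_assoc i1 i2.
by rewrite !comp_assoc ve mal_l.
Qed.

Let m_v (T : A) (i : hom T (dg2 LA D)) (y : hom T (dgA D)) :
  q2_1 ∘ i = e ∘ c ∘ y -> q2_2 ∘ i = y -> m ∘ i = v ∘ y.
Proof.
move=> i1 i2; apply: Vfaith.
rewrite fhom_comp Hm mal_comp -!fhom_comp -!comp_assoc i1 i2.
rewrite -(comp_assoc e c y) (comp_assoc u) ue [e ∘ (d ∘ _)]comp_assoc.
by rewrite edz mal_r.
Qed.

Let mu_2 (T : A) (i : hom T (dg2 LA D)) (x : hom T (dgA D)) :
  q2_1 ∘ i = x -> q2_2 ∘ i = e ∘ d ∘ x -> mu ∘ i = a2 ∘ x.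
Proof.
move=> i1 i2; apply: Vfaith.
rewrite fhom_comp Hmu mal_comp -!fhom_comp -!comp_assoc i1 i2.
by rewrite !comp_assoc a3e mal_l.
Qed.

Let mu_3 (T : A) (i : hom T (dg2 LA D)) (y : hom T (dgA D)) :
  q2_1 ∘ i = e ∘ c ∘ y -> q2_2 ∘ i = y -> mu ∘ i = a3 ∘ y.
Proof.
move=> i1 i2; apply: Vfaith.
rewrite fhom_comp Hmu mal_comp -!fhom_comp -!comp_assoc i1 i2.
rewrite -(comp_assoc e c y) (comp_assoc a2) a2e [e ∘ (d ∘ _)]comp_assoc.
by rewrite edz mal_r.
Qed.

Let th_1 (T : A) (i : hom T (dg3 LA D)) (x : hom T (dgA D)) :
  q3_1 ∘ i = x -> q3_2 ∘ i = e ∘ d ∘ x -> q3_3 ∘ i = e ∘ d ∘ x ->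
  th ∘ i = a1 ∘ x.
Proof.
move=> i1 i2 i3; apply: Vfaith.
have mui : mu ∘ (dg3_23 LA D ∘ i) = e ∘ d ∘ x.
  have i2' : q2_1 ∘ (dg3_23 LA D ∘ i) = e ∘ (d ∘ x).
    by rewrite comp_assoc [LHS]i2 comp_assoc.
  have i3' : q2_2 ∘ (dg3_23 LA D ∘ i) = e ∘ d ∘ (e ∘ (d ∘ x)).
    by rewrite comp_assoc [LHS]i3 edz comp_assoc.
  by rewrite (mu_2 i2' i3') comp_assoc a2e comp_assoc.
rewrite fhom_comp Hth mal_comp -!fhom_comp -!comp_assoc i1 mui.
by rewrite !comp_assoc mal_l.
Qed.

(** On triples whose first entry is a unit, [th] is [mu]. *)
Let th_23 (T : A) (i : hom T (dg3 LA D)) (y : hom T (dgA D)) :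
  q3_1 ∘ i = e ∘ c ∘ y -> th ∘ i = mu ∘ (dg3_23 LA D ∘ i).
Proof.
move=> i1; apply: Vfaith.
rewrite fhom_comp Hth mal_comp -!fhom_comp -!comp_assoc i1.
rewrite -(comp_assoc e c y) (comp_assoc a1) a1e [e ∘ (d ∘ _)]comp_assoc.
by rewrite edz mal_r.
Qed.

Let th_2 (T : A) (i : hom T (dg3 LA D)) (x : hom T (dgA D)) :
  q3_1 ∘ i = e ∘ c ∘ x -> q3_2 ∘ i = x -> q3_3 ∘ i = e ∘ d ∘ x ->
  th ∘ i = a2 ∘ x.
Proof.
by move=> i1 i2 i3; rewrite (th_23 i1); apply: mu_2; rewrite comp_assoc.
Qed.

Let th_3 (T : A) (i : hom T (dg3 LA D)) (x : hom T (dgA D)) :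
  q3_1 ∘ i = e ∘ c ∘ x -> q3_2 ∘ i = e ∘ c ∘ x -> q3_3 ∘ i = x ->
  th ∘ i = a3 ∘ x.
Proof.
by move=> i1 i2 i3; rewrite (th_23 i1); apply: mu_3; rewrite comp_assoc.
Qed.

Local Notation K := (gstar LA p Vfaith).
Local Notation GA := (gstar_pullbacks LA p Vfaith Vlim).

Lemma discrete_P1 (X : A) : P1 p (idm X) (idm X).
Proof.
apply: (P1_intro Vfaith) => T a b c0; rewrite !comp_idl => -> ->.
by exists c0; rewrite mal_l.
Qed.

Definition discrete_gobj (X : A) : gobj p :=
  GObj (comp_idl (idm X)) (comp_idl (idm X)) (@discrete_P1 X).

Definition dg_gobj : gobj p := GObj st ts HP1.

Local Notation X := dg_gobj.
Local Notation X0 := (discrete_gobj (dgB D)).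

Let d_s : gs X0 ∘ d = d ∘ gs X.
Proof. by rewrite /= comp_idl (bd_ds HD). Qed.
Let d_t : gt X0 ∘ d = d ∘ gt X.
Proof. by rewrite /= comp_idl (bd_dt HD). Qed.
Let c_s : gs X0 ∘ c = c ∘ gs X.
Proof. by rewrite /= comp_idl (bd_cs HD). Qed.
Let c_t : gt X0 ∘ c = c ∘ gt X.
Proof. by rewrite /= comp_idl (bd_ct HD). Qed.
Let e_s : gs X ∘ e = e ∘ gs X0.
Proof. by rewrite /= comp_idr. Qed.
Let e_t : gt X ∘ e = e ∘ gt X0.
Proof. by rewrite /= comp_idr. Qed.

Definition dg_d : gmor X X0 := @GMor A B LB V p X X0 d d_s d_t.
Definition dg_c : gmor X X0 := @GMor A B LB V p X X0 c c_s c_t.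
Definition dg_e : gmor X0 X := @GMor A B LB V p X0 X e e_s e_t.

Let l_t : gt X ∘ λ ∘ gt X = gt X ∘ λ.
Proof. by rewrite /= tl -{2}st comp_assoc ts st. Qed.
Let r_t : gt X ∘ ρ ∘ gt X = gt X ∘ ρ.
Proof. by rewrite /= tr -{2}st comp_assoc ts st. Qed.

Definition dg_l : gcell X X := @GCell A B LB V p X X λ unit_2cell_l l_t.
Definition dg_r : gcell X X := @GCell A B LB V p X X ρ unit_2cell_r r_t.

Local Notation P2 := (gpb LA Vfaith Vlim dg_d dg_c).

Let P2_gs (i : hom (dgA D) (dg2 LA D)) :
  q2_1 ∘ (gs P2 ∘ i) = s ∘ (q2_1 ∘ i) /\ q2_2 ∘ (gs P2 ∘ i) = s ∘ (q2_2 ∘ i).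
Proof.
split; first by rewrite (comp_assoc q2_1) [q2_1 ∘ gs P2]q1_s -comp_assoc.
by rewrite (comp_assoc q2_2) [q2_2 ∘ gs P2]q2_s -comp_assoc.
Qed.
Let P2_gt (i : hom (dgA D) (dg2 LA D)) :
  q2_1 ∘ (gt P2 ∘ i) = t ∘ (q2_1 ∘ i) /\ q2_2 ∘ (gt P2 ∘ i) = t ∘ (q2_2 ∘ i).
Proof.
split; first by rewrite (comp_assoc q2_1) [q2_1 ∘ gt P2]q1_t -comp_assoc.
by rewrite (comp_assoc q2_2) [q2_2 ∘ gt P2]q2_t -comp_assoc.
Qed.

Let se' (T : A) (z : hom T (dgB D)) : s ∘ (e ∘ z) = e ∘ z.
Proof. by rewrite comp_assoc (bd_se HD). Qed.
Let te' (T : A) (z : hom T (dgB D)) : t ∘ (e ∘ z) = e ∘ z.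
Proof. by rewrite comp_assoc (bd_te HD). Qed.

Let m_s : gs X ∘ m = m ∘ gs P2.
Proof.
apply: (wm2 wmA de ce) => i i1 i2; rewrite -!comp_assoc.
all: have [j1 j2] := P2_gs i.
  have E1 : m ∘ i = u by rewrite (m_u i1) ?comp_idr.
  have E2 : m ∘ (gs P2 ∘ i) = u ∘ s.
    apply: m_u; first by rewrite j1 i1 comp_idr.
    by rewrite j2 i2 se' -comp_assoc (bd_ds HD).
  by rewrite [m ∘ i]E1 [RHS]E2; apply: (ct_fs Hr).
have E1 : m ∘ i = v by rewrite (m_v (y := idm _)) ?comp_idr.
have E2 : m ∘ (gs P2 ∘ i) = v ∘ s.
  apply: m_v; last by rewrite j2 i2 comp_idr.
  by rewrite j1 i1 se' -comp_assoc (bd_cs HD).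
by rewrite [m ∘ i]E1 [RHS]E2; apply: (ct_fs Hl).
Qed.

Let m_t : gt X ∘ m = m ∘ gt P2.
Proof.
apply: (wm2 wmA de ce) => i i1 i2; rewrite -!comp_assoc.
all: have [j1 j2] := P2_gt i.
  have E1 : m ∘ i = u by rewrite (m_u i1) ?comp_idr.
  have E2 : m ∘ (gt P2 ∘ i) = u ∘ t.
    apply: m_u; first by rewrite j1 i1 comp_idr.
    by rewrite j2 i2 te' -comp_assoc (bd_dt HD).
  by rewrite [m ∘ i]E1 [RHS]E2; apply: (ct_ft Hr).
have E1 : m ∘ i = v by rewrite (m_v (y := idm _)) ?comp_idr.
have E2 : m ∘ (gt P2 ∘ i) = v ∘ t.
  apply: m_v; last by rewrite j2 i2 comp_idr.
  by rewrite j1 i1 te' -comp_assoc (bd_ct HD).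
by rewrite [m ∘ i]E1 [RHS]E2; apply: (ct_ft Hl).
Qed.

Definition dg_m : gmor P2 X := @GMor A B LB V p P2 X m m_s m_t.

Let dm : d ∘ m = d ∘ q2_2.
Proof.
apply: (wm2 wmA de ce) => i i1 i2; rewrite -!comp_assoc i2.
  by rewrite (m_u i1) ?comp_idr // du comp_assoc de comp_idl.
by rewrite (m_v (y := idm _)) ?comp_idr // dv.
Qed.

Let cm : c ∘ m = c ∘ q2_1.
Proof.
apply: (wm2 wmA de ce) => i i1 i2; rewrite -!comp_assoc i1.
  by rewrite (m_u i1) ?comp_idr // cu.
by rewrite (m_v (y := idm _)) ?comp_idr // cv comp_assoc ce comp_idl.
Qed.

Definition dg_pre : pre_pseudocategory GA.
Proof.
refine (@PrePseudocategory K GA X0 X dg_d dg_c dg_e dg_m _ _ _ _).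
- by apply: gmor_ext; apply: de.
- by apply: gmor_ext; apply: ce.
- by apply: gmor_ext; apply: dm.
- by apply: gmor_ext; apply: cm.
Defined.

Local Notation P3 := (pcs3 dg_pre).

Let P3_gs (i : hom (dgA D) (dg3 LA D)) :
  q3_1 ∘ (gs P3 ∘ i) = s ∘ (q3_1 ∘ i) /\
  q3_2 ∘ (gs P3 ∘ i) = s ∘ (q3_2 ∘ i) /\
  q3_3 ∘ (gs P3 ∘ i) = s ∘ (q3_3 ∘ i).
Proof.
have E : dg3_23 LA D ∘ (gs P3 ∘ i) = gs P2 ∘ (dg3_23 LA D ∘ i).
  by rewrite (comp_assoc (dg3_23 LA D)) [dg3_23 LA D ∘ gs P3]q2_s -comp_assoc.
split; first by rewrite (comp_assoc q3_1) [q3_1 ∘ gs P3]q1_s -comp_assoc.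
have [j1 j2] := P2_gs (dg3_23 LA D ∘ i).
split; first by rewrite -!(comp_assoc q2_1) [X in q2_1 ∘ X]E j1.
by rewrite -!(comp_assoc q2_2) [X in q2_2 ∘ X]E j2.
Qed.

Let P3_gt (i : hom (dgA D) (dg3 LA D)) :
  q3_1 ∘ (gt P3 ∘ i) = t ∘ (q3_1 ∘ i) /\
  q3_2 ∘ (gt P3 ∘ i) = t ∘ (q3_2 ∘ i) /\
  q3_3 ∘ (gt P3 ∘ i) = t ∘ (q3_3 ∘ i).
Proof.
have E : dg3_23 LA D ∘ (gt P3 ∘ i) = gt P2 ∘ (dg3_23 LA D ∘ i).
  by rewrite (comp_assoc (dg3_23 LA D)) [dg3_23 LA D ∘ gt P3]q2_t -comp_assoc.
split; first by rewrite (comp_assoc q3_1) [q3_1 ∘ gt P3]q1_t -comp_assoc.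
have [j1 j2] := P2_gt (dg3_23 LA D ∘ i).
split; first by rewrite -!(comp_assoc q2_1) [X in q2_1 ∘ X]E j1.
by rewrite -!(comp_assoc q2_2) [X in q2_2 ∘ X]E j2.
Qed.

(** The values of [th] at [i] and at the source and the target of [i], which are
    what the 2-cell conditions and the domain and codomain of [th] involve. *)
Let th_at (i : hom (dgA D) (dg3 LA D)) (a : hom (dgA D) (dgA D)) :
  Prop := th ∘ i = a /\ th ∘ (gs P3 ∘ i) = a ∘ s /\ th ∘ (gt P3 ∘ i) = a ∘ t.

Let th_at_1 (i : hom (dgA D) (dg3 LA D)) : q3_1 ∘ i = idm _ ->
  q3_2 ∘ i = e ∘ d -> q3_3 ∘ i = e ∘ d -> th_at i a1.
Proof.
move=> i1 i2 i3; have [j1 [j2 j3]] := P3_gs i; have [k1 [k2 k3]] := P3_gt i.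
split; first by rewrite (th_1 i1) ?comp_idr.
by split; apply: th_1;
  rewrite ?j1 ?j2 ?j3 ?k1 ?k2 ?k3 ?i1 ?i2 ?i3 ?se' ?te' ?comp_idr //
    -comp_assoc ?(bd_ds HD) ?(bd_dt HD).
Qed.

Let th_at_2 (i : hom (dgA D) (dg3 LA D)) : q3_1 ∘ i = e ∘ c ->
  q3_2 ∘ i = idm _ -> q3_3 ∘ i = e ∘ d -> th_at i a2.
Proof.
move=> i1 i2 i3; have [j1 [j2 j3]] := P3_gs i; have [k1 [k2 k3]] := P3_gt i.
split; first by rewrite (th_2 (x := idm _)) ?comp_idr.
by split; apply: th_2;
  rewrite ?j1 ?j2 ?j3 ?k1 ?k2 ?k3 ?i1 ?i2 ?i3 ?se' ?te' ?comp_idr //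
    -comp_assoc ?(bd_ds HD) ?(bd_dt HD) ?(bd_cs HD) ?(bd_ct HD).
Qed.

Let th_at_3 (i : hom (dgA D) (dg3 LA D)) : q3_1 ∘ i = e ∘ c ->
  q3_2 ∘ i = e ∘ c -> q3_3 ∘ i = idm _ -> th_at i a3.
Proof.
move=> i1 i2 i3; have [j1 [j2 j3]] := P3_gs i; have [k1 [k2 k3]] := P3_gt i.
split; first by rewrite (th_3 (x := idm _)) ?comp_idr.
by split; apply: th_3;
  rewrite ?j1 ?j2 ?j3 ?k1 ?k2 ?k3 ?i1 ?i2 ?i3 ?se' ?te' ?comp_idr //
    -comp_assoc ?(bd_cs HD) ?(bd_ct HD).
Qed.

Let th_s : gs X ∘ th ∘ gs P3 = gs X ∘ th.
Proof.
apply: (wm3 wmA de ce) => i i1 i2 i3; rewrite -!comp_assoc.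
- have [E [-> _]] := th_at_1 i1 i2 i3; rewrite [th ∘ i]E comp_assoc.
  exact: (can_s st ts Hr Huu a1E).
- have [E [-> _]] := th_at_2 i1 i2 i3; rewrite [th ∘ i]E comp_assoc.
  exact: (can_s st ts Hvu Huv a2E).
- have [E [-> _]] := th_at_3 i1 i2 i3; rewrite [th ∘ i]E comp_assoc.
  exact: (can_s st ts Hvv Hl a3E).
Qed.

Let th_t : gt X ∘ th ∘ gt P3 = gt X ∘ th.
Proof.
apply: (wm3 wmA de ce) => i i1 i2 i3; rewrite -!comp_assoc.
- have [E [_ ->]] := th_at_1 i1 i2 i3; rewrite [th ∘ i]E comp_assoc.
  exact: (can_t st ts Hr Huu a1E).
- have [E [_ ->]] := th_at_2 i1 i2 i3; rewrite [th ∘ i]E comp_assoc.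
  exact: (can_t st ts Hvu Huv a2E).
- have [E [_ ->]] := th_at_3 i1 i2 i3; rewrite [th ∘ i]E comp_assoc.
  exact: (can_t st ts Hvv Hl a3E).
Qed.

Definition dg_th : gcell P3 X := @GCell A B LB V p P3 X th th_s th_t.

Let dom_at (i : hom (dgA D) (dg3 LA D)) (f kf g kg a : hom (dgA D) (dgA D)) :
  contraction s t f kf -> contraction s t g kg ->
  V[a] = p⟨V[g], V[kg], V[kf]⟩ -> th_at i a ->
  gdom_mor dg_th ∘ i = f /\ gcod_mor dg_th ∘ i = g.
Proof.
move=> Hf Hg aE [E [Es Et]]; split; apply: Vfaith; rewrite fhom_comp.
  rewrite gdom_morE mal_comp -!fhom_comp -!comp_assoc.
  rewrite [th ∘ i]E [th ∘ (gt P3 ∘ i)]Et comp_assoc.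
  exact: (can_dom HP1 st ts Hf Hg aE).
rewrite gcod_morE mal_comp -!fhom_comp -!comp_assoc.
rewrite [th ∘ i]E [th ∘ (gs P3 ∘ i)]Es comp_assoc.
exact: (can_cod HP1 st ts Hf Hg aE).
Qed.

Let pmul_is (T : K) (x y : hom T (pc1 dg_pre))
    (H : pcd dg_pre ∘ x = pcc dg_pre ∘ y) (U : A) (i : hom U (gcar T))
    (x' y' w : hom U (dgA D)) :
  gm x ∘ i = x' -> gm y ∘ i = y' ->
  (forall k : hom U (dg2 LA D), q2_1 ∘ k = x' -> q2_2 ∘ k = y' -> m ∘ k = w) ->
  gm (pmul H) ∘ i = w.
Proof.
have [k [-> [k1 k2]]] := pre_pmul_at H; move=> <- <- Hw.
rewrite -comp_assoc; apply: Hw.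
  by rewrite (comp_assoc q2_1) [q2_1 ∘ k]k1.
by rewrite (comp_assoc q2_2) [q2_2 ∘ k]k2.
Qed.

Let m_ued (x : hom (dgA D) (dgA D)) (dx : d ∘ x = d) (k : hom _ (dg2 LA D)) :
  q2_1 ∘ k = x -> q2_2 ∘ k = e ∘ d -> m ∘ k = u ∘ x.
Proof. by move=> k1 k2; apply: m_u => //; rewrite -comp_assoc dx. Qed.

Let m_vec (y : hom (dgA D) (dgA D)) (cy : c ∘ y = c) (k : hom _ (dg2 LA D)) :
  q2_1 ∘ k = e ∘ c -> q2_2 ∘ k = y -> m ∘ k = v ∘ y.
Proof. by move=> k1 k2; apply: m_v => //; rewrite -comp_assoc cy. Qed.

Let m_1ed (k : hom (dgA D) (dg2 LA D)) :
  q2_1 ∘ k = idm _ -> q2_2 ∘ k = e ∘ d -> m ∘ k = u.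
Proof. by move=> k1 k2; rewrite (m_u k1) ?comp_idr. Qed.

Let m_ec1 (k : hom (dgA D) (dg2 LA D)) :
  q2_1 ∘ k = e ∘ c -> q2_2 ∘ k = idm _ -> m ∘ k = v.
Proof. by move=> k1 k2; rewrite (m_v (y := idm _)) ?comp_idr. Qed.

Let m_eded (k : hom (dgA D) (dg2 LA D)) :
  q2_1 ∘ k = e ∘ d -> q2_2 ∘ k = e ∘ d -> m ∘ k = e ∘ d.
Proof. by move=> k1 k2; rewrite (m_u k1) ?edz // comp_assoc ue. Qed.

Let m_ecec (k : hom (dgA D) (dg2 LA D)) :
  q2_1 ∘ k = e ∘ c -> q2_2 ∘ k = e ∘ c -> m ∘ k = e ∘ c.
Proof. by move=> k1 k2; rewrite (m_u k1) ?edz // comp_assoc ue. Qed.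

(** The domain [x ⊗ (y ⊗ z)] is evaluated at the three kinds of triples, where
    it becomes [u], [vu] and [vv]. *)
Let dom_th : gdom Vfaith dg_th = pmulR (pcs3_12 dg_pre) (pcs3_p23 dg_pre).
Proof.
apply: gmor_ext; apply: (wm3 wmA de ce) => i i1 i2 i3.
- have [-> _] := dom_at Hr Huu a1E (th_at_1 i1 i2 i3).
  have E := pmul_is (pcs3_p23 dg_pre) i2 i3 m_eded.
  by rewrite (pmul_is (pmulR_proof (pcs3_12 dg_pre) (pcs3_p23 dg_pre))
    i1 E m_1ed).
- have [-> _] := dom_at Hvu Huv a2E (th_at_2 i1 i2 i3).
  have E := pmul_is (pcs3_p23 dg_pre) i2 i3 m_1ed.
  by rewrite (pmul_is (pmulR_proof (pcs3_12 dg_pre) (pcs3_p23 dg_pre))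
    i1 E (m_vec cu)).
- have [-> _] := dom_at Hvv Hl a3E (th_at_3 i1 i2 i3).
  have E := pmul_is (pcs3_p23 dg_pre) i2 i3 m_ec1.
  by rewrite (pmul_is (pmulR_proof (pcs3_12 dg_pre) (pcs3_p23 dg_pre))
    i1 E (m_vec cv)).
Qed.

(** At the three kinds of triples [(x ⊗ y) ⊗ z] becomes [uu], [uv] and [v]. *)
Let cod_th : gcod Vfaith dg_th = pmulL (pcs3_12 dg_pre) (pcs3_p23 dg_pre).
Proof.
apply: gmor_ext; apply: (wm3 wmA de ce) => i i1 i2 i3.
- have [_ ->] := dom_at Hr Huu a1E (th_at_1 i1 i2 i3).
  have E := pmul_is (pcs3_12 dg_pre) i1 i2 m_1ed.
  by rewrite (pmul_is (pmulL_proof (pcs3_12 dg_pre) (pcs3_p23 dg_pre))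
    E i3 (m_ued du)).
- have [_ ->] := dom_at Hvu Huv a2E (th_at_2 i1 i2 i3).
  have E := pmul_is (pcs3_12 dg_pre) i1 i2 m_ec1.
  by rewrite (pmul_is (pmulL_proof (pcs3_12 dg_pre) (pcs3_p23 dg_pre))
    E i3 (m_ued dv)).
- have [_ ->] := dom_at Hvv Hl a3E (th_at_3 i1 i2 i3).
  have E := pmul_is (pcs3_12 dg_pre) i1 i2 m_ecec.
  by rewrite (pmul_is (pmulL_proof (pcs3_12 dg_pre) (pcs3_p23 dg_pre))
    E i3 m_ec1).
Qed.

Let edi f : d ∘ (e ∘ f) = f :> hom (dgA D) (dgB D).
Proof. by rewrite comp_assoc de comp_idl. Qed.
Let eci f : c ∘ (e ∘ f) = f :> hom (dgA D) (dgB D).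
Proof. by rewrite comp_assoc ce comp_idl. Qed.

Let d_th : d ∘ th = d ∘ q3_3.
Proof.
apply: (wm3 wmA de ce) => i i1 i2 i3.
all: rewrite -(comp_assoc d th) -(comp_assoc d q3_3) i3.
- by have [-> _] := th_at_1 i1 i2 i3; rewrite da1 edi.
- by have [-> _] := th_at_2 i1 i2 i3; rewrite da2 edi.
- by have [-> _] := th_at_3 i1 i2 i3; rewrite da3 comp_idr.
Qed.

Let c_th : c ∘ th = c ∘ q3_1.
Proof.
apply: (wm3 wmA de ce) => i i1 i2 i3.
all: rewrite -(comp_assoc c th) -(comp_assoc c q3_1) i1.
- by have [-> _] := th_at_1 i1 i2 i3; rewrite ca1 comp_idr.
- by have [-> _] := th_at_2 i1 i2 i3; rewrite ca2 eci.
- by have [-> _] := th_at_3 i1 i2 i3; rewrite ca3 eci.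
Qed.

Let dom_l : gm (gdom Vfaith dg_l) = v.
Proof. by apply: Vfaith; rewrite [LHS]gdom_morE [RHS]Hv. Qed.
Let dom_r : gm (gdom Vfaith dg_r) = u.
Proof. by apply: Vfaith; rewrite [LHS]gdom_morE [RHS]Hu. Qed.

Definition dg_data : pseudo_data GA.
Proof.
refine (@PseudoData K GA dg_pre dg_th dg_l dg_r dom_th cod_th _ _ _ _
  (gstar_invertible dg_th) (gstar_invertible dg_l) (gstar_invertible dg_r)
  _ _ _ _ _ _ _).
- apply: gmor_ext; rewrite [LHS]dom_l.
  have [k [-> [k1 k2]]] := pre_pmul_at (unitl_proof (idm (pc1 dg_pre))).
  by symmetry; apply: m_ec1; rewrite ?[LHS]k1 ?[LHS]k2 /= ?comp_idr.
- apply: gmor_ext; apply: Vfaith; rewrite [LHS]gcod_morE [RHS]fhom_id.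
  exact: (bd_codl HD).
- apply: gmor_ext; rewrite [LHS]dom_r.
  have [k [-> [k1 k2]]] := pre_pmul_at (unitr_proof (idm (pc1 dg_pre))).
  by symmetry; apply: m_1ed; rewrite ?[LHS]k1 ?[LHS]k2 /= ?comp_idr.
- apply: gmor_ext; apply: Vfaith; rewrite [LHS]gcod_morE [RHS]fhom_id.
  exact: (bd_codr HD).
- by apply: gcell_ext; apply: d_th.
- by apply: gcell_ext; apply: c_th.
- by apply: gcell_ext; apply: (bd_dl HD).
- by apply: gcell_ext; apply: (bd_cl HD).
- by apply: gcell_ext; apply: (bd_dr HD).
- by apply: gcell_ext; apply: (bd_cr HD).
- by apply: gcell_ext; rewrite /= le re.
Defined.

Let alpha_at (x y z : hom (pc1 dg_data) (pc1 dg_data))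
    (E1 : pcd dg_data ∘ x = pcc dg_data ∘ y)
    (E2 : pcd dg_data ∘ y = pcc dg_data ∘ z) (a : hom (dgA D) (dgA D)) :
  (forall k : hom (dgA D) (dg3 LA D), q3_1 ∘ k = gm x -> q3_2 ∘ k = gm y ->
     q3_3 ∘ k = gm z -> th ∘ k = a) -> gc (assoc_at E1 E2) = a.
Proof.
have [k [-> [k1 [k2 k3]]]] := assoc_at_at E1 E2.
by move=> Ha; apply: Ha.
Qed.

Let alpha_1 : gc (assoc_at (match_1ed dg_data) (match_eded dg_data)) = a1.
Proof.
apply: alpha_at => k k1 k2 k3.
by rewrite (th_1 k1) ?comp_idr.
Qed.
Let alpha_2 : gc (assoc_at (match_ec1 dg_data) (match_1ed dg_data)) = a2.
Proof.
apply: alpha_at => k k1 k2 k3.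
by rewrite (th_2 (x := idm _)) ?comp_idr.
Qed.
Let alpha_3 : gc (assoc_at (match_ecec dg_data) (match_ec1 dg_data)) = a3.
Proof.
apply: alpha_at => k k1 k2 k3.
by rewrite (th_3 (x := idm _)) ?comp_idr.
Qed.

Let dg_a1E : V[gc (assoc_at (match_1ed dg_data) (match_eded dg_data))] =
  p⟨V[gm (dom2 (pc_runit dg_data)) ∘ gm (dom2 (pc_runit dg_data))],
    V[ρ ∘ ρ], V[ρ]⟩.
Proof. by rewrite alpha_1 [gm (dom2 (pc_runit dg_data))]dom_r. Qed.
Let dg_a2E : V[gc (assoc_at (match_ec1 dg_data) (match_1ed dg_data))] =
  p⟨V[gm (dom2 (pc_runit dg_data)) ∘ gm (dom2 (pc_lunit dg_data))],
    V[ρ ∘ λ], V[λ ∘ ρ]⟩.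
Proof.
rewrite alpha_2 [gm (dom2 (pc_runit dg_data))]dom_r.
by rewrite [gm (dom2 (pc_lunit dg_data))]dom_l.
Qed.
Let dg_a3E : V[gc (assoc_at (match_ecec dg_data) (match_ec1 dg_data))] =
  p⟨V[gm (dom2 (pc_lunit dg_data))], V[λ], V[λ ∘ λ]⟩.
Proof. by rewrite alpha_3 [gm (dom2 (pc_lunit dg_data))]dom_l. Qed.

Let dg_a1e :
  gc (assoc_at (match_1ed dg_data) (match_eded dg_data)) ∘ e = e.
Proof. by rewrite alpha_1 a1e. Qed.

Definition dg_pseudocategory : pseudocategory GA :=
  Pseudocategory
    (coherent_pentagon (S := dg_data) re dg_a1e wmA dg_a1E dg_a2E dg_a3E)
    (coherent_triangle (S := dg_data) le re wmA dg_a1E dg_a3E).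

Lemma dg_homogeneous : homogeneous dg_pseudocategory.
Proof. by split; apply: gcell_ext; [exact: le|exact: re]. Qed.

Lemma dg_discrete : discrete (pc0 dg_pseudocategory).
Proof. by []. Qed.

Lemma diagram_realized :
  exists C : internal_bicategory LA p Vfaith Vlim, diagram_of C = D.
Proof.
exists (InternalBicategory dg_homogeneous dg_discrete).
by rewrite /diagram_of /=; case: (D).
Qed.
End FromDiagram.

Lemma bicategory_of_diagram (wmA : weakly_maltsev LA) (D : diagram A) :
  bicategory_diagram LA p D ->
  exists C : internal_bicategory LA p Vfaith Vlim, diagram_of C = D.
Proof.
move=> HD.
have [m [_ [[u [v [Hu [Hv Hm]]]] _]]] := bd_P2 HD.
have [th [a1 [mu [H1 [[a2 [a3 [H2 [H3 Hmu]]]] Hth]]]]] := bd_P3 HD.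
exact: (diagram_realized HD wmA Hu Hv H1 H2 H3 Hm Hmu Hth).
Qed.

(** * Uniqueness *)

Lemma is_m_uniq (D : diagram A) (m m' : hom (dg2 LA D) (dgA D)) :
  is_m p m -> is_m p m' -> m = m'.
Proof.
move=> [u [v [Hu [Hv Hm]]]] [u' [v' [Hu' [Hv' Hm']]]]; apply: Vfaith.
have eu : u = u' by apply: Vfaith; rewrite Hu Hu'.
have ev : v = v' by apply: Vfaith; rewrite Hv Hv'.
by rewrite Hm Hm' eu ev.
Qed.

Lemma is_theta_uniq (D : diagram A) (th th' : hom (dg3 LA D) (dgA D)) :
  is_theta p th -> is_theta p th' -> th = th'.
Proof.
move=> [a [mu [Ha [[b [c0 [Hb [Hc Hmu]]]] Hth]]]].
move=> [a' [mu' [Ha' [[b' [c' [Hb' [Hc' Hmu']]]] Hth']]]]; apply: Vfaith.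
have ea : a = a' by apply: Vfaith; rewrite Ha Ha'.
have eb : b = b' by apply: Vfaith; rewrite Hb Hb'.
have ec : c0 = c' by apply: Vfaith; rewrite Hc Hc'.
have emu : mu = mu' by apply: Vfaith; rewrite Hmu Hmu' eb ec.
by rewrite Hth Hth' ea emu.
Qed.

Ltac irr H H' := have ? := proof_irrelevance _ H H'; subst H'.

Lemma internal_bicategory_ext (C C' : internal_bicategory LA p Vfaith Vlim) :
  ps_data C = ps_data C' -> C = C'.
Proof.
case: C => [[S pent tri] homg disc]; case: C' => [[S' pent' tri'] homg' disc'].
move=> /= E; subst S'.
have E1 := proof_irrelevance _ pent pent'; subst pent'.
have E2 := proof_irrelevance _ tri tri'; subst tri'.
by irr homg homg'; irr disc disc'.
Qed.

(** Equality of diagrams identifies the objects and, up to [inj_pair2], the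
    underlying morphisms of [d], [c], [e], [λ], [ρ]; discreteness identifies
    the structure on the object of objects.  Only then do [m] and [θ] have the
    same type and can be compared by their formulas. *)
Lemma pseudo_data_ext (S S' : pseudo_data GA) :
  discrete (pc0 S) -> discrete (pc0 S') ->
  is_m p (D := data_diagram S) (gm (pcm S)) ->
  is_theta p (D := data_diagram S) (gc (pc_assoc S)) ->
  is_m p (D := data_diagram S') (gm (pcm S')) ->
  is_theta p (D := data_diagram S') (gc (pc_assoc S')) ->
  data_diagram S = data_diagram S' -> S = S'.
Proof.
case: S => pre α l r da ca dl cl dr cr ia il ir d_a c_a d_l c_l d_r c_r lre.
case: S' => pre' α' l' r' da' ca' dl' cl' dr' cr' ia' il' ir'
  d_a' c_a' d_l' c_l' d_r' c_r' lre'.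
rewrite /data_diagram /=.
case: pre α l r da ca dl cl dr cr ia il ir d_a c_a d_l c_l d_r c_r lre.
case: pre' α' l' r' da' ca' dl' cl' dr' cr' ia' il' ir'
  d_a' c_a' d_l' c_l' d_r' c_r' lre'.
move=> /=.
case=> [B0' s0' t0' st0' ts0' P0']; case=> [A0' s1' t1' st1' ts1' P1'].
case=> [d' d1' d2']; case=> [c' c1' c2']; case=> [e' e1' e2'].
move=> m' de' ce' dm' cm' α'; case=> [l' l1' l2']; case=> [r' r1' r2'].
move=> da' ca' dl' cl' dr' cr' ia' il' ir' d_a' c_a' d_l' c_l' d_r' c_r' lre'.
case=> [B0 s0 t0 st0 ts0 P0]; case=> [A0 s1 t1 st1 ts1 P1].
case=> [d d1 d2]; case=> [c c1 c2]; case=> [e e1 e2].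
move=> m de ce dm cm α; case=> [l l1 l2]; case=> [r r1 r2].
move=> da ca dl cl dr cr ia il ir d_a c_a d_l c_l d_r c_r lre.
rewrite /discrete /= => -[disc disc'] [disc1 disc1'] Hm Hth Hm' Hth' E.
injection E => Er El Et Es Ee Ec Ed EB EA; subst A0' B0'.
have {}Er : r = r' := inj_pair2 _ _ _ _ _ Er.
have {}El : l = l' := inj_pair2 _ _ _ _ _ El.
have {}Et : t1 = t1' := inj_pair2 _ _ _ _ _ Et.
have {}Es : s1 = s1' := inj_pair2 _ _ _ _ _ Es.
have {}Ee : e = e' :=
  inj_pair2 _ _ _ _ _ (inj_pair2 _ _ _ _ _ Ee).
have {}Ec : c = c' :=
  inj_pair2 _ _ _ _ _ (inj_pair2 _ _ _ _ _ Ec).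
have {}Ed : d = d' :=
  inj_pair2 _ _ _ _ _ (inj_pair2 _ _ _ _ _ Ed).
subst r' l' t1' s1' e' c' d' s0 t0 s0' t0'.
irr st0 st0'; irr ts0 ts0'; irr P0 P0'; irr st1 st1'; irr ts1 ts1'; irr P1 P1'.
irr d1 d1'; irr d2 d2'; irr c1 c1'; irr c2 c2'; irr e1 e1'; irr e2 e2'.
irr l1 l1'; irr l2 l2'; irr r1 r1'; irr r2 r2'.
have Em : m = m' by apply: gmor_ext; apply: is_m_uniq Hm Hm'.
subst m'; irr de de'; irr ce ce'; irr dm dm'; irr cm cm'.
have Eα : α = α' by apply: gcell_ext; apply: is_theta_uniq Hth Hth'.
subst α'; irr da da'; irr ca ca'; irr dl dl'; irr cl cl'; irr dr dr'.
irr cr cr'.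
irr ia ia'; irr il il'; irr ir ir'; irr d_a d_a'; irr c_a c_a'.
by irr d_l d_l'; irr c_l c_l'; irr d_r d_r'; irr c_r c_r'; irr lre lre'.
Qed.

Lemma diagram_of_inj (C C' : internal_bicategory LA p Vfaith Vlim) :
  diagram_of C = diagram_of C' -> C = C'.
Proof.
have [_ [Hm Hth]] := diagram_of_bicategory C.
have [_ [Hm' Hth']] := diagram_of_bicategory C'.
move=> E; apply: internal_bicategory_ext.
exact: (pseudo_data_ext (ib_discrete C) (ib_discrete C') Hm Hth Hm' Hth' E).
Qed.

End Existence.
End Elements.

Theorem proposition6p4 (A B : category) (LA : finite_limits A)
    (LB : finite_limits B) (V : functor A B) (p : maltsev_op LB V)
    (Vfaith : faithful V) (Vlim : preserves_finite_limits V)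
    (wmA : weakly_maltsev LA) :
  (forall C : internal_bicategory LA p Vfaith Vlim,
     bicategory_diagram LA p (diagram_of C) /\
     is_m p (D := diagram_of C) (gm (pcm C)) /\
     is_theta p (D := diagram_of C) (gc (pc_assoc C))) /\
  (forall D : diagram A, bicategory_diagram LA p D ->
     exists! C : internal_bicategory LA p Vfaith Vlim, diagram_of C = D).
Proof.
split; first by move=> C; apply: diagram_of_bicategory.
move=> D HD; have [C HC] := bicategory_of_diagram Vfaith Vlim wmA HD.
exists C; split => // C' HC'; apply: diagram_of_inj.
by rewrite HC HC'.
Qed.
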